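(* Consider the change point model in the context with $T\to\infty$, $d=d_T\to\infty$ and errors given by the mixed case $e_{i,t}=s_i\,\eta_{i,t}(d)+\Phi_i\,\eta_{d+1,t}(d)$, $1\le i\le d$ (see context), with $\nu>4$, $0<c\le s_i\le C<\infty$ and $\Phi_i^2\le C<\infty$ for all $i$ and some constants $c,C$. Let $\sigma_i^2=\operatorname{var}e_{i,1}=s_i^2+\Phi_i^2$, $A_d=\sum_{i=1}^d\Phi_i^2/\sigma_i^2$, and assume $A_d/\sqrt d\to\infty$. Assume that $x\mapsto\int_0^xg(t)\,dt-x\int_0^1g(t)\,dt$ is not identically zero on $[0,1]$. Then the corresponding panel statistics $\frac{\sqrt d}{A_d}\max_{0\le x\le1}V_{d,T}(x)$ and $\frac{\sqrt d}{A_d}\int_0^1V_{d,T}(x)\,dx$ for testing $H_0:\boldsymbol\Delta_d=\mathbf 0$ against $H_1:\boldsymbol\Delta_d\ne\mathbf 0$ have high dimensional efficiency $$\mathcal E_3(\boldsymbol\Delta_d)=\frac1{\sqrt{A_d}}\sqrt{\boldsymbol\Delta_d^T\operatorname{diag}\left(\frac1{s_1^2+\Phi_1^2},\ldots,\frac1{s_d^2+\Phi_d^2}\right)\boldsymbol\Delta_d}.$$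
   Context: Model: for $1\le i\le d=d_T$, $1\le t\le T$, $X_{i,t}=\mu_i+\delta_{i,T}\,g(t/T)+e_{i,t}$ with $g:[0,1]\to\mathbb R$ Riemann-integrable; $\boldsymbol\Delta_d=(\delta_{1,T},\ldots,\delta_{d,T})^T$. The innovations $\eta_{1,t}(d),\ldots,\eta_{d+1,t}(d)$ are independent with mean $0$, variance $1$, and $\operatorname E|\eta_{i,t}(d)|^\nu$ bounded uniformly in $i$ and $d$; the vectors $(\eta_{1,t}(d),\ldots,\eta_{d+1,t}(d))$, $t=1,\ldots,T$, are independent and identically distributed. Panel process (scaled by the component variances only, ignoring the dependence between components): $$V_{d,T}(x)=\frac1{\sqrt d}\sum_{i=1}^d\left(\frac1{\sigma_i^2}Z_{T,i}^2(x)-\frac{\lfloor Tx\rfloor(T-\lfloor Tx\rfloor)}{T^2}\right),\qquad Z_{T,i}(x)=\frac1{T^{1/2}}\left(\sum_{t=1}^{\lfloor Tx\rfloor}X_{i,t}-\frac{\lfloor Tx\rfloor}{T}\sum_{t=1}^TX_{i,t}\right).$$ High dimensional efficiency: let $T\to\infty$ and $d=d_T\to\infty$. A test of $H_0:\mathbf a=0$ against $H_1:\mathbf a\ne0$ with statistic $\mathcal T$ has (absolute) high dimensional efficiency $\mathcal E(\mathbf a_d)$ for a sequence of alternatives $\mathbf a_d$ if (i) $\mathcal T\to L$ in distribution under $H_0$ for some non-degenerate limit distribution $L$; (ii) $\mathcal T\to\infty$ in probability if $\sqrt T\,\mathcal E(\mathbf a_d)\to\infty$; (iii) $\mathcal T\to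 L$ in distribution if $\sqrt T\,\mathcal E(\mathbf a_d)\to0$. It is defined only up to multiplicative constants. *)

(* Defs.v *)
From HB Require Import structures.
From mathcomp Require Import all_boot all_order all_algebra.
From mathcomp Require Import all_classical all_reals all_analysis.

Set Implicit Arguments.
Unset Strict Implicit.
Unset Printing Implicit Defensive.

Import Order.TTheory GRing.Theory Num.Theory.
Import numFieldNormedType.Exports.

Local Open Scope classical_set_scope.
Local Open Scope ring_scope.

(* Components are numbered from 0: [i : 'I_n] is component i+1, and the index
   [ord_max : 'I_n.+1] of an innovation vector is that of the common factor.
   Times keep their usual numbering 1, ..., T. *)

(** Riemann integral *)

Section riemann.
Context {R : realType}.

(* A tagged partition of [a, b] with n cells: the points x 0 <= ... <= x n and
   the tags xi 0, ..., xi n.-1. *)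
Definition tagged_partition (a b : R) (n : nat) (x xi : nat -> R) : Prop :=
  [/\ x 0%N = a, x n = b & forall k, (k < n)%N -> x k <= xi k <= x k.+1].

Definition riemann_sum (f : R -> R) (n : nat) (x xi : nat -> R) : R :=
  \sum_(k < n) f (xi k) * (x k.+1 - x k).

Definition is_riemann_int (f : R -> R) (a b I : R) : Prop :=
  forall eps : R, 0 < eps -> exists2 delta : R, 0 < delta &
    forall (n : nat) (x xi : nat -> R), tagged_partition a b n x xi ->
      (forall k, (k < n)%N -> x k.+1 - x k < delta) ->
      `|riemann_sum f n x xi - I| < eps.

Definition riemann_integrable (f : R -> R) (a b : R) : Prop :=
  exists I, is_riemann_int f a b I.

(* Meaningful when f is Riemann integrable on [a, b], a <= b: the value of the
   integral is then unique. *)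
Definition riemann_int (f : R -> R) (a b : R) : R :=
  get [set I | is_riemann_int f a b I].

End riemann.

Section probability_notions.
Context {disp : measure_display} {Omega : measurableType disp} {R : realType}.
Context (P : probability Omega R).

Definition mutually_independent (I : finType) {disp' : measure_display}
    {S : measurableType disp'} (X : I -> Omega -> S) : Prop :=
  forall (J : {set I}) (B : I -> set S), (forall i, measurable (B i)) ->
    P (\bigcap_(i in [set i | i \in J]) (X i @^-1` B i)) =
    (\prod_(i in J) P (X i @^-1` B i))%E.

Definition identically_distributed (I : Type) {disp' : measure_display}
    {S : measurableType disp'} (X : I -> Omega -> S) : Prop :=
  forall (i j : I) (B : set S), measurable B ->
    P (X i @^-1` B) = P (X j @^-1` B).

Definition cvg_in_distribution (X : nat -> Omega -> R) (L : probability R R) :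
    Prop :=
  forall f : R -> R, continuous f -> (exists M : R, forall x, `|f x| <= M) ->
    ('E_P[f \o X n])%E @[n --> \oo] --> ('E_L[f])%E.

Definition dvg_in_probability (X : nat -> Omega -> R) : Prop :=
  forall M : R, P [set w | M < X n w] @[n --> \oo] --> 1%E.

Definition non_degenerate (L : probability R R) : Prop :=
  ~ exists c : R, L [set c] = 1%E.

(* [stat T a] is the statistic at sample size T, in dimension [d T], when the
   true parameter is a.  The limit law L is common to all the sequences of
   alternatives (it is determined by the behaviour under the null a = 0). *)
Definition high_dim_efficiency (d : nat -> nat)
    (stat : forall T : nat, 'cV[R]_(d T) -> Omega -> R)
    (E : forall T : nat, 'cV[R]_(d T) -> R) : Prop :=
  (forall T a, measurable_fun [set: Omega] (stat T a)) /\
  exists L : probability R R,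
    [/\ non_degenerate L,
        cvg_in_distribution (fun T => stat T 0) L &
        forall a : (forall T : nat, 'cV[R]_(d T)), (forall T, a T != 0) ->
          ((Num.sqrt T%:R * E T (a T)) @[T --> \oo] --> +oo ->
             dvg_in_probability (fun T => stat T (a T))) /\
          ((Num.sqrt T%:R * E T (a T)) @[T --> \oo] --> (0 : R) ->
             cvg_in_distribution (fun T => stat T (a T)) L)].

(* The conditions at sample size T and dimension n on the innovations
   eta i t, i : 'I_n.+1, 1 <= t <= T. *)
Record innovations (n T : nat) (eta : 'I_n.+1 -> nat -> {RV P >-> R}) : Prop := {
  innov_indep_comp : forall t, (1 <= t <= T)%N ->
    mutually_independent (fun i : 'I_n.+1 => eta i t : Omega -> R);
  innov_mean : forall i t, (1 <= t <= T)%N -> ('E_P[eta i t] = 0)%E;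
  innov_var : forall i t, (1 <= t <= T)%N -> ('V_P[eta i t] = 1)%E;
  innov_indep_time :
    mutually_independent
      (fun (t : 'I_T) (w : Omega) => [tuple eta i t.+1 w | i < n.+1]);
  innov_ident_time :
    identically_distributed
      (fun (t : 'I_T) (w : Omega) => [tuple eta i t.+1 w | i < n.+1])
}.

Definition mixed_error (s Phi : nat -> R) (n : nat)
    (eta : 'I_n.+1 -> nat -> {RV P >-> R}) (i : 'I_n) (t : nat) (w : Omega) : R :=
  s i * eta (widen_ord (leqnSn n) i) t w + Phi i * eta ord_max t w.

End probability_notions.

Section panel.
Context {R : realType}.

Definition change_obs (mu : nat -> R) (g : R -> R) (T n : nat) (a : 'cV[R]_n)
    (e : 'I_n -> nat -> R) (i : 'I_n) (t : nat) : R :=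
  mu i + a i 0 * g (t%:R / T%:R) + e i t.

(* For x >= 0, [Num.truncn] is the floor function with values in nat. *)
Definition cusum (T : nat) (X : nat -> R) (x : R) : R :=
  let k := Num.truncn (T%:R * x) in
  (Num.sqrt T%:R)^-1 *
    (\sum_(1 <= t < k.+1) X t - k%:R / T%:R * \sum_(1 <= t < T.+1) X t).

Definition panel (sigma2 : nat -> R) (T n : nat) (X : 'I_n -> nat -> R) (x : R) :
    R :=
  let k := Num.truncn (T%:R * x) in
  (Num.sqrt n%:R)^-1 *
    \sum_(i < n) (cusum T (X i) x ^+ 2 / sigma2 i
                  - k%:R * (T%:R - k%:R) / T%:R ^+ 2).

(* x |-> panel sigma2 T X x takes finitely many values on [0, 1], so that this
   supremum is a maximum. *)
Definition panel_max (sigma2 : nat -> R) (T n : nat) (X : 'I_n -> nat -> R) : R :=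
  sup [set panel sigma2 T X x | x in `[0, 1]].

Definition panel_int (sigma2 : nat -> R) (T n : nat) (X : 'I_n -> nat -> R) : R :=
  \int[lebesgue_measure]_(x in `[0, 1]) panel sigma2 T X x.

Definition common_part (s Phi : nat -> R) (n : nat) : R :=
  \sum_(i < n) Phi i ^+ 2 / (s i ^+ 2 + Phi i ^+ 2).

Definition efficiency3 (s Phi : nat -> R) (n : nat) (a : 'cV[R]_n) : R :=
  (Num.sqrt (common_part s Phi n))^-1 *
    Num.sqrt ((a^T *m diag_mx (\row_(i < n) (s i ^+ 2 + Phi i ^+ 2)^-1) *m a) 0 0).

End panel.

(* Main.v *)
From HB Require Import structures.
Require Import Defs.
From mathcomp Require Import all_boot all_order all_algebra.
From mathcomp Require Import all_classical all_reals all_analysis.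
From mathcomp Require Import measurable_realfun ring lra zify.

(* Write B_i(k), k = floor(T x), for the CUSUM bridge of the innovations of
   component i, B_0(k) for that of the common factor, gamma_k for the CUSUM of
   the values g(t/T), and E for the efficiency at the alternative.  The scaled
   panel process at k is
     B_0(k)^2 - k (T - k) / T^2 + T E^2 gamma_k^2 + error,
   where the error consists of a quadratic form and of linear forms in the B_i,
   with weights whose squares sum to at most d, A_d and A_d E^2.  Doob's L^2
   inequality bounds the expected maximum over k of the error by a constant times
     sqrt d / A_d + 1 / sqrt A_d + (1 / sqrt A_d + 1) sqrt T E.
   If sqrt T E -> 0, the statistic is therefore close in L^1 to a functional of
   the scalar walk B_0; if sqrt T E -> oo, it is at least c T E^2 - O_P(sqrt T E)
   because the mean of gamma_k^2 stays away from 0.  A bridge is not a martingale,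
   but B_i^2 is a combination with bounded weights of squares of the forward walk
   and of the time-reversed walk, to which Doob's inequality does apply.

   The law of the functional of B_0 converges without any invariance principle or
   Brownian motion.  Against a bounded Lipschitz f, the functional is a Lipschitz
   function of the increments over m blocks, up to an error vanishing with m
   uniformly in T.  Lindeberg's argument replaces these increments by Rademacher
   walks, so that for fixed m the expectations converge, and hence they are Cauchy
   in T.  The limits define a positive functional on bounded Lipschitz functions,
   which is tight; its distribution function has a Stieltjes measure, the limit
   law L.  L charges every half-line ]A, oo[: the statistic dominates the square of
   the time average of B_0, whose Rademacher version has tails bounded below by
   comparing its exponential moments at theta and 2 theta.  In particular L is not
   a point mass. *)

Import Order.TTheory GRing.Theory Num.Theory.
Import numFieldNormedType.Exports.
Local Open Scope classical_set_scope.
Local Open Scope ring_scope.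
Set Implicit Arguments.
Unset Strict Implicit.
Unset Printing Implicit Defensive.

(** * Real-valued expectation *)

(** The innovations at two sample sizes need not be related in any way, so nothing converges along a
    path and only laws can be compared. This is why the Cauchy property in T goes through a
    deterministic number, free of T, that all large T approximate. Fourth moments have two uses.
    They give the squares of the innovations a variance, so that the compensated quadratic form of
    the d idiosyncratic bridges is of order sqrt d, negligible against A_d. They also control
    oscillations over m blocks: each block has a fourth moment of order m^(-2), so the sum over the
    blocks is O(1/m), where second moments would give O(1) only. The efficiency separates the two
    regimes because the change enters the statistic as the square of sqrt T E, while the error is at
    most linear in it. Conditional expectations are avoided: orthogonality to functions of the past
    replaces the martingale property. *)

Section expectation.
Context {d : measure_display} {Omega : measurableType d} {R : realType}.
Variable P : probability Omega R.
Implicit Types X Y : Omega -> R.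

(** An infinite integral gets a junk real value here, hence the [L1] hypotheses in the rules
    below. *)
Definition Ex X : R := \int[P]_w X w.
Definition L1 X : Prop := P.-integrable setT (EFin \o X).

Lemma L1_meas X : L1 X -> measurable_fun setT X.
Proof. by move=> /integrableP[/measurable_EFinP]. Qed.

Lemma L1_le X Y : measurable_fun setT X -> L1 Y -> (forall w, `|X w| <= Y w) ->
  L1 X.
Proof.
move=> mX iY XY; apply: le_integrable iY => //; first exact/measurable_EFinP.
by move=> w _ /=; rewrite lee_fin (le_trans (XY w))// ler_norm.
Qed.

Lemma L1_cst c : L1 (fun=> c).
Proof.
apply/integrableP; split; first exact/measurable_EFinP/measurable_cst.
by rewrite integral_cst//= probability_setT mule1 ltry.
Qed.

Lemma L1D X Y : L1 X -> L1 Y -> L1 (fun w => X w + Y w).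
Proof. by move=> iX iY; exact: (integrableD measurableT iX iY). Qed.

Lemma L1Z c X : L1 X -> L1 (fun w => c * X w).
Proof. by move=> iX; exact: (integrableZl measurableT c iX). Qed.

Lemma L1N X : L1 X -> L1 (fun w => - X w).
Proof. by move=> /(L1Z (-1)); under eq_fun do rewrite mulN1r. Qed.

Lemma L1B X Y : L1 X -> L1 Y -> L1 (fun w => X w - Y w).
Proof. by move=> iX /L1N; exact: L1D. Qed.

Lemma L1_abs X : L1 X -> L1 (fun w => `|X w|).
Proof. by move=> iX; exact: (integrable_abse iX). Qed.

Lemma L1_sum (I : Type) (r : seq I) (Q : pred I) (F : I -> Omega -> R) :
  (forall i, Q i -> L1 (F i)) -> L1 (fun w => \sum_(i <- r | Q i) F i w).
Proof.
move=> iF; elim: r => [|i r IH].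
  rewrite [X in L1 X](_ : _ = fun=> 0); first exact: L1_cst.
  by apply/funext => w; rewrite big_nil.
rewrite [X in L1 X](_ : _ = fun w => if Q i then F i w + \sum_(j <- r | Q j) F j w else \sum_(j <- r | Q j) F j w); last first.
  by apply/funext => w; rewrite big_cons.
case Qi: (Q i) => //.
by apply: L1D => //; exact: iF.
Qed.

Lemma L1_bounded X M : measurable_fun setT X -> (forall w, `|X w| <= M) -> L1 X.
Proof. by move=> mX XM; exact: (L1_le mX (L1_cst M)). Qed.

Lemma Ex_cst c : Ex (fun=> c) = c.
Proof. by rewrite /Ex Rintegral_cst//= probability_setT mulr1. Qed.

Lemma ExD X Y : L1 X -> L1 Y -> Ex (fun w => X w + Y w) = Ex X + Ex Y.
Proof. by move=> iX iY; rewrite /Ex RintegralD. Qed.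

Lemma ExB X Y : L1 X -> L1 Y -> Ex (fun w => X w - Y w) = Ex X - Ex Y.
Proof. by move=> iX iY; rewrite /Ex RintegralB. Qed.

Lemma ExZ c X : L1 X -> Ex (fun w => c * X w) = c * Ex X.
Proof. by move=> iX; rewrite /Ex RintegralZl. Qed.

Lemma ExN X : L1 X -> Ex (fun w => - X w) = - Ex X.
Proof.
by move=> iX; rewrite -mulN1r -ExZ//; congr Ex; apply/funext => w; rewrite mulN1r.
Qed.

Lemma Ex_sum (I : Type) (r : seq I) (Q : pred I) (F : I -> Omega -> R) :
  (forall i, Q i -> L1 (F i)) ->
  Ex (fun w => \sum_(i <- r | Q i) F i w) = \sum_(i <- r | Q i) Ex (F i).
Proof.
move=> iF; elim: r => [|i r IH].
  rewrite big_nil -[RHS]Ex_cst; congr Ex; apply/funext => w.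
  by rewrite big_nil.
rewrite big_cons; case: ifP => Qi; rewrite -IH.
  rewrite -ExD; [|exact: iF|exact: L1_sum].
  by congr Ex; apply/funext => w; rewrite big_cons Qi.
by congr Ex; apply/funext => w; rewrite big_cons Qi.
Qed.

Lemma Ex_le X Y : L1 X -> L1 Y -> (forall w, X w <= Y w) -> Ex X <= Ex Y.
Proof. by move=> iX iY XY; apply: le_Rintegral => // w _; exact: XY. Qed.

Lemma Ex_ge0 X : (forall w, 0 <= X w) -> 0 <= Ex X.
Proof. by move=> X0; apply: Rintegral_ge0 => w _; exact: X0. Qed.

Lemma Ex_abs X : L1 X -> `|Ex X| <= Ex (fun w => `|X w|).
Proof. by move=> iX; exact: le_normr_Rintegral. Qed.

Lemma Ex_abs_le X Y : L1 X -> L1 Y -> (forall w, `|X w| <= Y w) -> `|Ex X| <= Ex Y.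
Proof.
move=> iX iY XY; apply: le_trans (Ex_abs iX) _.
by apply: Ex_le => //; exact: L1_abs.
Qed.

Lemma expectationE X : L1 X -> 'E_P[X]%E = (Ex X)%:E.
Proof.
move=> iX; rewrite unlock /Ex /Rintegral fineK//; exact: integrable_fin_num.
Qed.

(** Markov's inequality; it turns a bound on the mean of the error into one on probabilities. *)
Lemma prob_le_Ex X lam : L1 X -> (forall w, 0 <= X w) -> 0 < lam ->
  (P [set w | (lam <= X w)%R] <= (Ex X / lam)%:E)%E.
Proof.
move=> iX X0 lam0.
have mX := L1_meas iX.
have mA : measurable [set w | lam <= X w].
  by rewrite -[X in measurable X]setTI; exact: measurable_fun_le.
have -> : (P [set w | (lam <= X w)%R] = (Ex (\1_[set w | lam <= X w]))%:E)%E.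
  rewrite /Ex /Rintegral integral_indic// setIT fineK//.
  exact: fin_num_measure.
rewrite lee_fin ler_pdivlMr// mulrC -ExZ; last first.
  apply: (@L1_bounded _ 1); first exact: measurable_indic.
  by move=> w; rewrite indicE; case: (_ \in _); rewrite ?normr1 ?normr0.
apply: Ex_le => //.
  apply: L1Z; apply: (@L1_bounded _ 1); first exact: measurable_indic.
  by move=> w; rewrite indicE; case: (_ \in _); rewrite ?normr1 ?normr0.
move=> w; rewrite indicE; case: (boolP (_ \in _)) => [|_]; rewrite ?mulr1 ?mulr0//.
by rewrite inE.
Qed.

Definition L2 X : Prop := measurable_fun setT X /\ L1 (fun w => X w ^+ 2).

Lemma L2_meas X : L2 X -> measurable_fun setT X. Proof. by case. Qed.

Lemma L2M X Y : L2 X -> L2 Y -> L1 (fun w => X w * Y w).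
Proof.
move=> [mX iX] [mY iY]; apply: (@L1_le _ (fun w => X w ^+ 2 + Y w ^+ 2)).
- exact: measurable_funM.
- exact: L1D.
- by move=> w; rewrite ler_norml; apply/andP; split; nra.
Qed.

Lemma L2_cst c : L2 (fun=> c).
Proof. by split; [exact: measurable_cst|exact: L1_cst]. Qed.

Lemma L2_L1 X : L2 X -> L1 X.
Proof. by move=> /L2M/(_ (L2_cst 1)); under eq_fun do rewrite mulr1. Qed.

Lemma L2_le X Y : measurable_fun setT X -> L2 Y -> (forall w, `|X w| <= `|Y w|) ->
  L2 X.
Proof.
move=> mX [mY iY] XY; split => //.
apply: L1_le iY _; first exact: measurable_funX.
by move=> w; rewrite normrX -[leRHS]real_normK ?num_real// ler_sqr ?nnegrE.
Qed.

Lemma L2Z c X : L2 X -> L2 (fun w => c * X w).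
Proof.
move=> [mX iX]; split; first exact: measurable_funM.
by under eq_fun do rewrite exprMn; exact: L1Z.
Qed.

Lemma L2D X Y : L2 X -> L2 Y -> L2 (fun w => X w + Y w).
Proof.
move=> [mX iX] [mY iY]; split; first exact: measurable_funD.
apply: (@L1_le _ (fun w => 2 * X w ^+ 2 + 2 * Y w ^+ 2)).
- by apply: measurable_funX; exact: measurable_funD.
- by apply: L1D; exact: L1Z.
- by move=> w; rewrite ger0_norm ?sqr_ge0//; have := sqr_ge0 (X w - Y w); nra.
Qed.

Lemma L2N X : L2 X -> L2 (fun w => - X w).
Proof. by move=> /(L2Z (-1)); under eq_fun do rewrite mulN1r. Qed.

Lemma L2B X Y : L2 X -> L2 Y -> L2 (fun w => X w - Y w).
Proof. by move=> iX /L2N; exact: L2D. Qed.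

Lemma L2_sum (I : Type) (r : seq I) (Q : pred I) (F : I -> Omega -> R) :
  (forall i, Q i -> L2 (F i)) -> L2 (fun w => \sum_(i <- r | Q i) F i w).
Proof.
move=> iF; elim: r => [|i r IH].
  rewrite [X in L2 X](_ : _ = fun=> 0); first exact: L2_cst.
  by apply/funext => w; rewrite big_nil.
rewrite [X in L2 X](_ : _ = fun w => if Q i then F i w + \sum_(j <- r | Q j) F j w else \sum_(j <- r | Q j) F j w); last first.
  by apply/funext => w; rewrite big_cons.
case Qi: (Q i) => //.
by apply: L2D => //; exact: iF.
Qed.

Lemma L2_abs X : L2 X -> L2 (fun w => `|X w|).
Proof.
move=> iX; apply: L2_le (iX) _.
  by apply: measurableT_comp => //; exact: L2_meas.
by move=> w; rewrite normr_id.
Qed.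

(** Encoded as square-integrability of the square, so that the rules for [L2] carry over. *)
Definition L4 X : Prop := measurable_fun setT X /\ L2 (fun w => X w ^+ 2).

Lemma L4_meas X : L4 X -> measurable_fun setT X. Proof. by case. Qed.

Lemma L4_L2 X : L4 X -> L2 X.
Proof. by move=> [mX iX]; split => //; exact: L2_L1. Qed.

Lemma L4M X Y : L4 X -> L4 Y -> L2 (fun w => X w * Y w).
Proof.
move=> [mX iX] [mY iY].
apply: (@L2_le _ (fun w => X w ^+ 2 + Y w ^+ 2)).
- exact: measurable_funM.
- exact: L2D.
- move=> w; rewrite [leRHS]ger0_norm ?addr_ge0 ?sqr_ge0//.
  by rewrite ler_norml; apply/andP; split; nra.
Qed.

Lemma L4_cst c : L4 (fun=> c).
Proof. by split; [exact: measurable_cst|exact: L2_cst]. Qed.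

Lemma L4Z c X : L4 X -> L4 (fun w => c * X w).
Proof.
move=> [mX iX]; split; first exact: measurable_funM.
by under eq_fun do rewrite exprMn; exact: L2Z.
Qed.

Lemma L4D X Y : L4 X -> L4 Y -> L4 (fun w => X w + Y w).
Proof.
move=> iX iY; have [mX _] := iX; have [mY _] := iY.
split; first exact: measurable_funD.
have -> : (fun w => (X w + Y w) ^+ 2) =
   (fun w => (X w * X w + 2 * (X w * Y w)) + Y w * Y w).
  by apply/funext => w; ring.
by apply: L2D; [apply: L2D; [|apply: L2Z]|]; exact: L4M.
Qed.

Lemma L4_sum (I : Type) (r : seq I) (Q : pred I) (F : I -> Omega -> R) :
  (forall i, Q i -> L4 (F i)) -> L4 (fun w => \sum_(i <- r | Q i) F i w).
Proof.
move=> iF; elim: r => [|i r IH].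
  rewrite [X in L4 X](_ : _ = fun=> 0); first exact: L4_cst.
  by apply/funext => w; rewrite big_nil.
rewrite [X in L4 X](_ : _ = fun w => if Q i then F i w + \sum_(j <- r | Q j) F j w else \sum_(j <- r | Q j) F j w); last first.
  by apply/funext => w; rewrite big_cons.
case Qi: (Q i) => //.
by apply: L4D => //; exact: iF.
Qed.

End expectation.

(** * Independence of the past and the future *)

Section independence.
Context {d : measure_display} {Omega : measurableType d} {R : realType}.
Variable P : probability Omega R.

Definition indep_pair (X Y : Omega -> R) : Prop := forall A B : set R,
  measurable A -> measurable B ->
  P (X @^-1` A `&` Y @^-1` B) = (P (X @^-1` A) * P (Y @^-1` B))%E.

Section mfun.
Variables X Y : {mfun Omega >-> R}.
Hypothesis XY : indep_pair X Y.

Let mXY : measurable_fun setT (fun w => (X w, Y w)).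
Proof. exact: measurable_fun_pair. Qed.

Let XY' : {mfun Omega >-> (R * R)%type} := HB.pack (fun w => (X w, Y w))
  (isMeasurableFun.Build _ _ _ _ _ mXY).

(** Independence is a statement on rectangles, and rectangles determine a measure on the product;
    Fubini then gives the product rule. *)
Let law_eq (A : set (R * R)) : measurable A ->
  (distribution P X \x distribution P Y)%E A = distribution P XY' A.
Proof.
by move=> mA; apply: product_measure_unique => // B C mB mC; exact: XY.
Qed.

Let pair_law (f : R * R -> \bar R) : measurable_fun setT f ->
  (forall z, 0 <= f z)%E ->
  (\int[P]_w f (X w, Y w) =
   \int[distribution P X]_x \int[distribution P Y]_y f (x, y))%E.
Proof.
move=> mf f0.
rewrite -[RHS]fubini_tonelli1// -(ge0_integral_distribution XY' mf f0).
by apply: eq_measure_integral => A mA _; apply/esym; exact: law_eq.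
Qed.

Let mn : measurable_fun setT (fun x : R => `|x|%:E).
Proof. by apply/measurable_EFinP. Qed.

Let mnn : measurable_fun setT (fun z : R * R => (`|z.1|%:E * `|z.2|%:E)%E).
Proof.
by apply: emeasurable_funM; apply/measurable_EFinP; apply: measurableT_comp.
Qed.

Let int_abs : L1 P X -> L1 P Y ->
  (\int[distribution P X]_x \int[distribution P Y]_y (`|x|%:E * `|y|%:E) < +oo)%E.
Proof.
move=> /integrableP[_ iX] /integrableP[_ iY].
under eq_integral => x _ /=.
  rewrite ge0_integralZl_EFin//.
  rewrite (ge0_integral_distribution Y mn); last by move=> y; rewrite lee_fin.
  over.
rewrite /= ge0_integralZr//; last first.
  by apply: integral_ge0 => w _; rewrite lee_fin.
rewrite (ge0_integral_distribution X mn); last by move=> y; rewrite lee_fin.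
apply: lte_mul_pinfty => //.
- by apply: integral_ge0 => w _; rewrite lee_fin.
- rewrite ge0_fin_numE//; apply: integral_ge0 => w _; rewrite lee_fin//.
Qed.

Let L1M : L1 P X -> L1 P Y -> L1 P (fun w => X w * Y w).
Proof.
move=> iX iY; apply/integrableP; split.
  by apply/measurable_EFinP; exact: measurable_funM.
have -> : (\int[P]_w `|(EFin \o (fun w => X w * Y w)%R) w| =
   \int[P]_w ((fun z : R * R => `|z.1|%:E * `|z.2|%:E) (X w, Y w)))%E.
  by apply: eq_integral => w _ /=; rewrite -EFinM normrM.
rewrite (pair_law mnn); first exact: int_abs.
by move=> z; rewrite -EFinM lee_fin mulr_ge0.
Qed.

Let ExM : L1 P X -> L1 P Y -> Ex P (fun w => X w * Y w) = Ex P X * Ex P Y.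
Proof.
move=> iX iY; have iXY := L1M iX iY.
pose f (z : R * R) : \bar R := (z.1 * z.2)%:E.
have mf : measurable_fun setT f.
  by apply/measurable_EFinP; exact: measurable_funM.
have fi : (distribution P X \x distribution P Y)%E.-integrable setT f.
  apply/integrableP; split => //.
  rewrite fubini_tonelli1//; last exact: measurableT_comp.
  rewrite /fubini_F /=; apply: le_lt_trans (int_abs iX iY).
  rewrite le_eqVlt; apply/orP; left; apply/eqP.
  apply: eq_integral => x _; apply: eq_integral => y _.
  by rewrite /f /= normrM EFinM.
rewrite /Ex /Rintegral.
have -> : (\int[P]_w (X w * Y w)%:E = \int[P]_w (f \o XY') w)%E by [].
rewrite -(integral_distribution (X := XY') mf)//.
rewrite -(eq_measure_integral _ (fun A mA _ => law_eq mA)).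
rewrite -integral12_prod_meas1// /fubini_F /f /=.
have iYd : (distribution P Y).-integrable setT (EFin \o idfun).
  apply/integrableP; split; first by apply/measurable_EFinP; exact: measurable_id.
  rewrite (ge0_integral_distribution Y mn); last by move=> y; rewrite lee_fin.
  by case/integrableP: iY.
under eq_integral => x _.
  under eq_integral do rewrite EFinM.
  rewrite (integralZl _ iYd)//= (integral_distribution (X := Y)) //.
  over.
have yfin : (\int[P]_x (EFin \o Y) x \is a fin_num)%E by exact: integrable_fin_num.
rewrite -(fineK yfin).
rewrite integralZr//; last first.
  apply/integrableP; split; first by apply/measurable_EFinP; exact: measurable_id.
  rewrite (ge0_integral_distribution X mn); last by move=> y; rewrite lee_fin.
  by case/integrableP: iX.
rewrite (integral_distribution (X := X)) // fineM//.
exact: integrable_fin_num.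
Qed.

Lemma indep_mfun : L1 P X -> L1 P Y ->
  L1 P (fun w => X w * Y w) /\ Ex P (fun w => X w * Y w) = Ex P X * Ex P Y.
Proof. by move=> iX iY; split; [exact: L1M|exact: ExM]. Qed.

End mfun.

Lemma indep_ExM (X Y : Omega -> R) : indep_pair X Y -> L1 P X -> L1 P Y ->
  L1 P (fun w => X w * Y w) /\ Ex P (fun w => X w * Y w) = Ex P X * Ex P Y.
Proof.
move=> XY iX iY.
pose X' : {mfun Omega >-> R} :=
  HB.pack X (isMeasurableFun.Build _ _ _ _ _ (L1_meas iX)).
pose Y' : {mfun Omega >-> R} :=
  HB.pack Y (isMeasurableFun.Build _ _ _ _ _ (L1_meas iY)).
exact: (@indep_mfun X' Y').
Qed.

(** * Independence of the past sigma-algebra from the present vector *)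

Section cylinders.
Context {dV : measure_display} {V : measurableType dV} {I : finType}.
Variable Y : I -> Omega -> V.
Hypothesis mY : forall i, measurable_fun setT (Y i).
Hypothesis indY : mutually_independent P Y.

(** A pi-system generating the sigma-algebra of the coordinates in [S]. *)
Definition cylinder (S : {set I}) : set (set Omega) :=
  [set E | exists B : I -> set V, (forall i, measurable (B i)) /\
     E = \bigcap_(i in [set i | i \in S]) (Y i @^-1` B i)].

Lemma cylinder_measurable S : cylinder S `<=` measurable.
Proof.
move=> _ [B [mB ->]]; apply: fin_bigcap_measurable => // i _.
by rewrite -[X in measurable X]setTI; exact: mY.
Qed.

Lemma cylinderS (S S' : {set I}) : S \subset S' -> cylinder S `<=` cylinder S'.
Proof.
move=> SS' _ [B [mB ->]]; exists (fun i => if i \in S then B i else setT); split.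
  by move=> i; case: ifP.
apply/seteqP; split=> [w H i /= iS'|w H i /= iS].
  by case: ifPn => // iS; exact: H.
by have := H i (fintype.subsetP SS' _ iS); rewrite iS.
Qed.

Lemma cylinder_coord (S : {set I}) i B : i \in S -> measurable B ->
  cylinder S (Y i @^-1` B).
Proof.
move=> iS mB; exists (fun j => if j == i then B else setT); split.
  by move=> j; case: ifP.
apply/seteqP; split=> [w H j /= jS|w H].
  by case: eqP => // ->.
by have := H i iS; rewrite eqxx.
Qed.

(** Both sides are finite measures in [A]: the restriction of [P] to the event at [t], and a
    multiple of [P]. They agree on the pi-system of cylinders, hence on what it generates. *)
Lemma indep_cylinder (S : {set I}) t A B : t \notin S -> <<s cylinder S >> A ->
  measurable B ->
  P (A `&` Y t @^-1` B) = (P A * P (Y t @^-1` B))%E.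
Proof.
move=> tS sA mB.
have mE : measurable (Y t @^-1` B) by rewrite -[X in measurable X]setTI; exact: mY.
have pE0 : 0 <= fine (P (Y t @^-1` B)) by rewrite fine_ge0.
pose m1 : {measure set Omega -> \bar R} := mrestr P mE.
pose m2 : {measure set Omega -> \bar R} := mscale (NngNum pE0) P.
have m2E X : m2 X = (P X * P (Y t @^-1` B))%E.
  by rewrite /m2 /= /mscale /= fineK ?fin_num_measure// muleC.
rewrite -m2E.
apply: (@g_sigma_algebra_measure_unique _ _ _ (cylinder S) _ (fun=> setT) _ _ m1 m2) => //.
- exact: cylinder_measurable.
- move=> _; exists (fun=> setT); split => //.
  by apply/seteqP; split.
- by rewrite bigcup_const.
- move=> _ _ [B1 [mB1 ->]] [B2 [mB2 ->]]; exists (fun i => B1 i `&` B2 i).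
  by split; [move=> i; exact: measurableI|rewrite bigcapI].
- move=> _ [B1 [mB1 ->]]; rewrite m2E /m1 /= /mrestr.
  pose B' i := if i == t then B else B1 i.
  have mB' i : measurable (B' i) by rewrite /B'; case: ifP.
  have -> : \bigcap_(i in [set i | i \in S]) Y i @^-1` B1 i `&` Y t @^-1` B =
     \bigcap_(i in [set i | i \in t |: S]) Y i @^-1` B' i.
    apply/seteqP; split=> [w [H1 H2] i /=|w H].
      rewrite /B' in_setU1; case: eqP => [->//|_] /= iS; exact: H1.
    split=> [i /= iS|].
      have := H i; rewrite /= in_setU1 iS orbT => /(_ isT); rewrite /B'.
      by case: eqP => // it; move: iS tS; rewrite it => ->.
    by have := H t; rewrite /= in_setU1 eqxx => /(_ isT); rewrite /B' eqxx.
  rewrite (indY _ mB') (indY _ mB1) big_setU1//= /B' eqxx muleC; congr (_ * _)%E.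
  by apply: eq_bigr => i iS; case: eqP => // it; move: iS tS; rewrite it => ->.
- move=> k; rewrite /m1 /= /mrestr (le_lt_trans (probability_le1 _ _)) ?ltry//.
  exact: measurableI.
Qed.

(** [phi] acts on the whole vector at time [t], so that it may be one component as well as the
    product of two. *)
Lemma indep_cylinder_ExM (S : {set I}) t (H : Omega -> R) (phi : V -> R) :
  t \notin S -> measurable_fun setT (H : g_sigma_algebraType (cylinder S) -> R) ->
  measurable_fun setT phi -> L1 P H -> L1 P (phi \o Y t) ->
  L1 P (fun w => H w * phi (Y t w)) /\
  Ex P (fun w => H w * phi (Y t w)) = Ex P H * Ex P (phi \o Y t).
Proof.
move=> tS mH mphi iH iphi; apply: indep_ExM => // A B mA mB.
have mA' : <<s cylinder S >> (H @^-1` A).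
  by have := mH measurableT _ mA; rewrite setTI.
have mB' : measurable (phi @^-1` B).
  by rewrite -[X in measurable X]setTI; exact: mphi.
exact: (indep_cylinder tS mA' mB').
Qed.

End cylinders.
End independence.

(** * Running maxima and the maximal inequality *)

Section running_max.
Context {R : realType}.
Implicit Types u v : nat -> R.

Fixpoint rmax u n : R := if n is m.+1 then Num.max (rmax u m) (u n) else u 0%N.

Lemma rmax_ge u n k : (k <= n)%N -> u k <= rmax u n.
Proof.
elim: n => [|n IH] /=; first by rewrite leqn0 => /eqP ->.
rewrite leq_eqVlt ltnS le_max => /orP[/eqP ->|/IH ->//].
by rewrite lexx orbT.
Qed.

Lemma rmax_le u n c : (forall k, (k <= n)%N -> u k <= c) -> rmax u n <= c.
Proof.
elim: n => [|n IH] uc /=; first exact: uc.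
by rewrite ge_max IH ?uc// => k kn; apply: uc; rewrite ltnW.
Qed.

Lemma rmax_ex u n : exists2 k, (k <= n)%N & rmax u n = u k.
Proof.
elim: n => [|n [k kn IH]] /=; first by exists 0%N.
by case: (leP (rmax u n) (u n.+1)) => _; [exists n.+1|exists k => //; exact: ltnW].
Qed.

Lemma rmax_ge0 u n : 0 <= u 0%N -> 0 <= rmax u n.
Proof. by move=> /le_trans; apply; exact: rmax_ge. Qed.

Lemma measurable_rmax d (T : measurableType d) (u : nat -> T -> R) n :
  (forall k, (k <= n)%N -> measurable_fun setT (u k)) ->
  measurable_fun setT (fun w => rmax (u^~ w) n).
Proof.
elim: n => [|n IH] mu /=; first exact: mu.
apply: measurable_maxr; last exact: mu.
by apply: IH => k kn; apply: mu; exact: ltnW.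
Qed.

(** Doob's inequality path by path: the sum is a discrete stochastic integral, which has mean zero
    for a martingale. The induction works because the running maximum moves only when it is attained
    by the new value. *)
Lemma rmax_pathwise u n : u 0%N = 0 ->
  rmax u n ^+ 2 <= 4 * u n ^+ 2 - 4 * \sum_(j < n) rmax u j * (u j.+1 - u j).
Proof.
move=> u0.
have H : 2 * \sum_(j < n) rmax u j * (u j.+1 - u j) <=
    2 * rmax u n * u n - rmax u n ^+ 2.
  elim: n => [|n IH]; first by rewrite big_ord0 /= u0; lra.
  rewrite big_ord_recr /=; case: (leP (rmax u n) (u n.+1)) => h.
    have := sqr_ge0 (u n.+1 - rmax u n); nra.
  nra.
have := sqr_ge0 (rmax u n - 2 * u n); nra.
Qed.

End running_max.

Section adapted.
Context {d : measure_display} {Omega : measurableType d} {R : realType}.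
Implicit Types (G : set (set Omega)) (H : Omega -> R).

Definition adapted G H :=
  measurable_fun setT (H : g_sigma_algebraType G -> R).

Lemma adaptedS G G' H : G `<=` <<s G' >> -> adapted G H -> adapted G' H.
Proof.
move=> GG' mH _ B mB; apply: (smallest_sub _ GG'); last exact: mH.
exact: smallest_sigma_algebra.
Qed.

Lemma adapted_sum G (I : Type) (r : seq I) (Q : pred I) (F : I -> Omega -> R) :
  (forall i, Q i -> adapted G (F i)) ->
  adapted G (fun w => \sum_(i <- r | Q i) F i w).
Proof.
move=> mF; elim: r => [|i r IH].
  rewrite [X in adapted G X](_ : _ = fun=> 0); first exact: measurable_cst.
  by apply/funext => w; rewrite big_nil.
rewrite [X in adapted G X](_ : _ = fun w => if Q i then
   F i w + \sum_(j <- r | Q j) F j w else \sum_(j <- r | Q j) F j w); last first.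
  by apply/funext => w; rewrite big_cons.
by case Qi: (Q i) => //; apply: measurable_funD => //; exact: mF.
Qed.

End adapted.

Section doob.
Context {d : measure_display} {Omega : measurableType d} {R : realType}.
Variable P : probability Omega R.
Variables (Fil : nat -> set (set Omega)) (n : nat) (D : nat -> Omega -> R).
Hypothesis FilS : forall j, (j < n)%N -> Fil j `<=` <<s Fil j.+1 >>.
Hypothesis DL2 : forall j, (j < n)%N -> L2 P (D j).
Hypothesis aD : forall j, (j < n)%N -> adapted (Fil j.+1) (D j).
(** The martingale property in dual form, tested against square-integrable functions of the past. *)
Hypothesis oD : forall j H, (j < n)%N -> adapted (Fil j) H -> L2 P H ->
  Ex P (fun w => H w * D j w) = 0.

Definition psum (D : nat -> Omega -> R) (k : nat) (w : Omega) : R :=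
  \sum_(j < k) D j w.

Let aM k : (k <= n)%N -> adapted (Fil k) (psum D k).
Proof.
elim: k => [|k IH] kn.
  rewrite /psum [X in adapted _ X](_ : _ = fun=> 0); first exact: measurable_cst.
  by apply/funext => w; rewrite big_ord0.
rewrite /psum [X in adapted _ X](_ : _ = fun w => psum D k w + D k w); last first.
  by apply/funext => w; rewrite big_ord_recr.
apply: measurable_funD; last exact: aD.
by apply: adaptedS (IH (ltnW kn)); exact: FilS.
Qed.

Let psL2 k : (k <= n)%N -> L2 P (psum D k).
Proof.
by move=> kn; apply: L2_sum => i _; apply: DL2; exact: leq_trans kn.
Qed.

Let FilS' j k : (j <= k)%N -> (k <= n)%N -> Fil j `<=` <<s Fil k >>.
Proof.
elim: k => [|k IH]; first by rewrite leqn0 => /eqP -> _; exact: sub_sigma_algebra.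
rewrite leq_eqVlt => /orP[/eqP -> _|jk kn]; first exact: sub_sigma_algebra.
apply: subset_trans (IH jk (ltnW kn)) _.
apply: smallest_sub; first exact: smallest_sigma_algebra.
exact: FilS.
Qed.

Lemma Ex_martingale_sq k : (k <= n)%N ->
  Ex P (fun w => psum D k w ^+ 2) = \sum_(j < k) Ex P (fun w => D j w ^+ 2).
Proof.
elim: k => [|k IH] kn.
  rewrite big_ord0 -[RHS](Ex_cst P); congr Ex; apply/funext => w.
  by rewrite /psum big_ord0 expr0n.
rewrite big_ord_recr /= -IH ?(ltnW kn)//.
have -> : (fun w => psum D k.+1 w ^+ 2) = (fun w =>
    (psum D k w ^+ 2 + 2 * (psum D k w * D k w)) + D k w ^+ 2).
  by apply/funext => w; rewrite /psum big_ord_recr /=; ring.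
have [_ i1] := psL2 (ltnW kn); have [_ i2] := DL2 kn.
have i3 := L2M (psL2 (ltnW kn)) (DL2 kn).
rewrite ExD//; last by apply: L1D => //; exact: L1Z.
rewrite ExD//; last exact: L1Z.
by rewrite ExZ// oD ?mulr0 ?addr0//; [apply: aM; exact: ltnW|apply: psL2; exact: ltnW].
Qed.

Let doob1 (s : R) : s ^+ 2 = 1 ->
  L2 P (fun w => rmax (fun k => s * psum D k w) n) /\
  Ex P (fun w => rmax (fun k => s * psum D k w) n ^+ 2) <=
  4 * \sum_(j < n) Ex P (fun w => D j w ^+ 2).
Proof.
move=> s2.
have L2r k : (k <= n)%N -> L2 P (fun w => rmax (fun k => s * psum D k w) k).
  move=> kn.
  apply: (@L2_le _ _ _ _ _ (fun w => \sum_(j < k.+1) `|s * psum D j w|)).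
  - apply: measurable_rmax => j jk; apply: measurable_funM => //.
    by apply: (@L2_meas _ _ _ P); apply: psL2; exact: leq_trans kn.
  - apply: L2_sum => j _; apply: L2_abs; apply: L2Z; apply: psL2.
    by rewrite (leq_trans _ kn)// -ltnS.
  - move=> w; rewrite [leRHS]ger0_norm ?sumr_ge0//.
    have [j jk ->] := rmax_ex (fun k => s * psum D k w) k.
    rewrite (bigD1 (Ordinal (jk : (j < k.+1)%N)))//= lerDl.
    by rewrite sumr_ge0.
have ar k : (k <= n)%N -> adapted (Fil k) (fun w => rmax (fun k => s * psum D k w) k).
  move=> kn; apply: measurable_rmax => j jk; apply: measurable_funM => //.
  by apply: (adaptedS (FilS' jk kn)); apply: aM; exact: leq_trans kn.
split; first exact: L2r.
have [_ i1] := L2r n (leqnn n).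
have [_ i2] := psL2 (leqnn n).
have i3 (j : 'I_n) : L1 P (fun w => rmax (fun k => s * psum D k w) j * D j w).
  by apply: L2M; [apply: L2r; exact: ltnW|exact: DL2].
rewrite -Ex_martingale_sq// -(ExZ 4 i2).
(* The stochastic integral of [rmax_pathwise] is inserted for free: the running maximum at [j] is
   known at time [j], so each of its terms has mean zero. *)
have -> : Ex P (fun w => 4 * psum D n w ^+ 2) = Ex P (fun w => 4 * psum D n w ^+ 2
    - 4 * \sum_(j < n) s * (rmax (fun k => s * psum D k w) j * D j w)).
  rewrite ExB ?ExZ//; last 3 first.
    by apply: L1_sum => j _; exact: L1Z.
    exact: L1Z.
    by apply: L1Z; apply: L1_sum => j _; exact: L1Z.
  rewrite Ex_sum; last by move=> j _; exact: L1Z.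
  rewrite big1 ?mulr0 ?subr0// => j _; rewrite ExZ// oD ?mulr0//.
    by apply: ar; exact: ltnW.
  by apply: L2r; exact: ltnW.
apply: Ex_le => //.
  apply: L1B; first exact: L1Z.
  by apply: L1Z; apply: L1_sum => j _; exact: L1Z.
move=> w.
have := @rmax_pathwise R (fun k => s * psum D k w) n.
rewrite /psum big_ord0 mulr0 => /(_ erefl)/le_trans; apply.
rewrite -/(psum D n w) exprMn s2 mul1r lerD2l lerN2 ler_pM2l//.
by apply: ler_sum => j _; rewrite big_ord_recr /= le_eqVlt; apply/orP; left; apply/eqP; ring.
Qed.

Definition maxabs (D : nat -> Omega -> R) (k : nat) (w : Omega) : R :=
  rmax (fun k => `|psum D k w|) k.

(** The absolute value is handled by running maxima of the walk and of its opposite, so the constant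
    is twice Doob's 4. *)
Lemma doob_L2 : L2 P (maxabs D n) /\
  Ex P (fun w => maxabs D n w ^+ 2) <=
  8 * \sum_(j < n) Ex P (fun w => D j w ^+ 2).
Proof.
have [L1a e1] := doob1 (expr1n _ 2).
have [L1b e2] := doob1 (sqrr_sign _ 1).
have mM : measurable_fun setT (maxabs D n).
  apply: measurable_rmax => k kn; apply: measurableT_comp => //.
  exact: L2_meas (psL2 kn).
have le w : maxabs D n w ^+ 2 <= rmax (fun k => 1 * psum D k w) n ^+ 2 +
     rmax (fun k => (-1) ^+ 1 * psum D k w) n ^+ 2.
  rewrite /maxabs; have [k kn ->] := rmax_ex (fun k => `|psum D k w|) n.
  rewrite real_normK ?num_real//.
  have p0 : psum D 0 w = 0 by rewrite /psum big_ord0.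
  case: (leP 0 (psum D k w)) => h.
    have := @rmax_ge _ (fun k => 1 * psum D k w) n _ kn.
    rewrite /= mul1r => h1; apply: (@le_trans _ _ (rmax (fun k => 1 * psum D k w) n ^+ 2)).
      by rewrite ler_sqr ?nnegrE// (le_trans h).
    by rewrite lerDl sqr_ge0.
  have := @rmax_ge _ (fun k => (-1) ^+ 1 * psum D k w) n _ kn.
  rewrite /= expr1 mulN1r => h1.
  apply: (@le_trans _ _ (rmax (fun k => -1 * psum D k w) n ^+ 2)).
    by rewrite -(sqrrN (psum D k w)) ler_sqr ?nnegrE ?(le_trans _ h1)// oppr_ge0 ltW.
  by rewrite lerDr sqr_ge0.
have i : L1 P (fun w => maxabs D n w ^+ 2).
  apply: (L1_le _ (L1D L1a.2 L1b.2)); first exact: measurable_funX.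
  by move=> w; rewrite ger0_norm ?sqr_ge0.
split=> //.
have := Ex_le i (L1D L1a.2 L1b.2) le; rewrite (ExD L1a.2 L1b.2).
move: e1 e2; set A := \sum_(j < n) _.
by move=> e1 e2 /le_trans; apply; apply: le_trans (lerD e1 e2) _; lra.
Qed.

Lemma maxabs_ge k w : (k <= n)%N -> `|psum D k w| <= maxabs D n w.
Proof. exact: (@rmax_ge _ (fun k => `|psum D k w|)). Qed.

Lemma maxabs_ge0 w : 0 <= maxabs D n w.
Proof. exact: rmax_ge0. Qed.

End doob.

(** * Linear and quadratic forms of innovations *)

Section innovation_sequence.
Context {d : measure_display} {Omega : measurableType d} {R : realType}.
Variable P : probability Omega R.

(* [Fil j] generates the sigma-algebra of the past before time j.  Pairwise
   second-order properties across components suffice; K bounds fourth moments. *)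
Record iseq (I : finType) (n : nat) (z : I -> nat -> Omega -> R)
    (Fil : nat -> set (set Omega)) (K : R) : Prop := {
  is_fil : forall j, (j < n)%N -> Fil j `<=` <<s Fil j.+1 >>;
  is_film : forall j, (j <= n)%N -> Fil j `<=` measurable;
  is_adapted : forall i j, (j < n)%N -> adapted (Fil j.+1) (z i j);
  is_L4 : forall i j, (j < n)%N -> L4 P (z i j);
  is_mean : forall i j, (j < n)%N -> Ex P (z i j) = 0;
  is_cov : forall i l j, (j < n)%N ->
    Ex P (fun w => z i j w * z l j w) = (i == l)%:R;
  is_m4 : forall i j, (j < n)%N -> Ex P (fun w => z i j w ^+ 4) <= K;
  is_sqcov : forall i l j, (j < n)%N -> i != l ->
    Ex P (fun w => (z i j w ^+ 2 - 1) * (z l j w ^+ 2 - 1)) = 0;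
  is_ind1 : forall H i j, (j < n)%N -> adapted (Fil j) H -> L1 P H ->
    L1 P (fun w => H w * z i j w) /\ Ex P (fun w => H w * z i j w) = 0;
  is_ind2 : forall H i l j, (j < n)%N -> adapted (Fil j) H -> L1 P H ->
    L1 P (fun w => H w * (z i j w * z l j w)) /\
    Ex P (fun w => H w * (z i j w * z l j w)) = Ex P H * (i == l)%:R
}.

Section bounds.
Variables (I : finType) (n : nat) (z : I -> nat -> Omega -> R).
Variables (Fil : nat -> set (set Omega)) (K : R).
Hypothesis Z : iseq n z Fil K.
Implicit Type a : I -> R.

Lemma iseq_adapted_psum i k : (k <= n)%N -> adapted (Fil k) (psum (z i) k).
Proof.
elim: k => [|k IH] kn.
  rewrite /psum [X in adapted _ X](_ : _ = fun=> 0); first exact: measurable_cst.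
  by apply/funext => w; rewrite big_ord0.
rewrite /psum [X in adapted _ X](_ : _ = fun w => psum (z i) k w + z i k w); last first.
  by apply/funext => w; rewrite big_ord_recr.
apply: measurable_funD; last exact: is_adapted Z _ _ kn.
by apply: adaptedS (IH (ltnW kn)); exact: is_fil Z _ kn.
Qed.

Lemma iseq_L4_psum i k : (k <= n)%N -> L4 P (psum (z i) k).
Proof.
by move=> kn; apply: L4_sum => j _; apply: (is_L4 Z); exact: leq_trans kn.
Qed.

Lemma iseq_L2 i j : (j < n)%N -> L2 P (z i j).
Proof. by move=> jn; apply: L4_L2; exact: is_L4 Z _ _ jn. Qed.

(** Integrate [2 x ^+ 2 - 1 <= x ^+ 4] for an innovation of variance 1. *)
Lemma iseq_K_ge1 (i : I) : (0 < n)%N -> 1 <= K.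
Proof.
move=> n0; apply: le_trans (is_m4 Z i n0).
have [_ i2] := is_L4 Z i n0.
have h := is_cov Z i i n0; rewrite eqxx /= in h.
have i1 := (iseq_L2 i n0).2.
have i4 : L1 P (fun w => z i 0%N w ^+ 4).
  by have := i2.2; under eq_fun do rewrite -exprM.
have -> : 1 = Ex P (fun w => 2 * z i 0%N w ^+ 2 - 1) :> R.
  rewrite ExB ?ExZ ?Ex_cst//; [|exact: L1Z|exact: L1_cst].
  by rewrite -[X in 2 * X]/(Ex P (fun w => z i 0%N w * z i 0%N w)) h; ring.
apply: Ex_le => //; first by apply: L1B; [exact: L1Z|exact: L1_cst].
by move=> w; have := sqr_ge0 (z i 0%N w ^+ 2 - 1); nra.
Qed.

Lemma psum_cov i l k : (k <= n)%N ->
  Ex P (fun w => psum (z i) k w * psum (z l) k w) = (i == l)%:R * k%:R.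
Proof.
elim: k => [|k IH] kn.
  rewrite mulr0 -[RHS](Ex_cst P); congr Ex; apply/funext => w.
  by rewrite /psum big_ord0 mul0r.
have L4S j := iseq_L4_psum j (ltnW kn).
have L2S j := L4_L2 (L4S j).
have aS j := iseq_adapted_psum j (ltnW kn).
have [i1 e1] := is_ind1 Z l kn (aS i) (L2_L1 (L2S i)).
have [i2 e2] := is_ind1 Z i kn (aS l) (L2_L1 (L2S l)).
have i3 := L2M (iseq_L2 i kn) (iseq_L2 l kn).
have i4 := L2M (L2S i) (L2S l).
have -> : (fun w => psum (z i) k.+1 w * psum (z l) k.+1 w) = (fun w =>
   psum (z i) k w * psum (z l) k w + psum (z i) k w * z l k w
   + psum (z l) k w * z i k w + z i k w * z l k w).
  by apply/funext => w; rewrite /psum !big_ord_recr /=; ring.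
rewrite ExD//; last by apply: L1D => //; exact: L1D.
rewrite ExD//; last exact: L1D.
rewrite ExD// IH ?(ltnW kn)// e1 e2 (is_cov Z)// -natr1; ring.
Qed.

(** Increments of the martingale made of the compensated squares of the walks, as [psum_quadD]
    shows. *)
Definition quadD a j w : R :=
  \sum_i a i * (2 * (psum (z i) j w * z i j w) + (z i j w ^+ 2 - 1)).

Lemma psum_quadD a k w :
  psum (quadD a) k w = \sum_i a i * (psum (z i) k w ^+ 2 - k%:R).
Proof.
elim: k => [|k IH].
  rewrite /psum big_ord0 big1// => i _.
  by rewrite big_ord0 expr0n subrr mulr0.
rewrite /psum big_ord_recr /= -/(psum _ _ _) IH /quadD -big_split /=.
apply: eq_bigr => i _; rewrite /psum big_ord_recr /= -natr1; ring.
Qed.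

Definition linD a j w : R := \sum_i a i * z i j w.

Lemma psum_linD a k w : psum (linD a) k w = \sum_i a i * psum (z i) k w.
Proof.
rewrite /psum /linD exchange_big /=.
by apply: eq_bigr => i _; rewrite mulr_sumr.
Qed.

Let L2quad1 a j : (j < n)%N -> L2 P (fun w => \sum_i a i * (psum (z i) j w * z i j w)).
Proof.
move=> jn; apply: L2_sum => i _; apply: L2Z; apply: L4M.
  exact: iseq_L4_psum (ltnW jn).
exact: is_L4 Z _ _ jn.
Qed.

Let L2sq i j : (j < n)%N -> L2 P (fun w => z i j w ^+ 2 - 1).
Proof.
by move=> jn; apply: L2B; [exact: (is_L4 Z _ jn).2|exact: L2_cst].
Qed.

Let L2quad2 a j : (j < n)%N -> L2 P (fun w => \sum_i a i * (z i j w ^+ 2 - 1)).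
Proof. by move=> jn; apply: L2_sum => i _; apply: L2Z; exact: L2sq. Qed.

Lemma quadD_E a j w : quadD a j w = 2 * (\sum_i a i * (psum (z i) j w * z i j w))
   + \sum_i a i * (z i j w ^+ 2 - 1).
Proof. by rewrite mulr_sumr -big_split /=; apply: eq_bigr => i _; ring. Qed.

Let L2quadD a j : (j < n)%N -> L2 P (quadD a j).
Proof.
move=> jn; rewrite (funext (quadD_E a j)).
by apply: L2D; [apply: L2Z; exact: L2quad1|exact: L2quad2].
Qed.

Let Ex_quad1 a j : (j < n)%N ->
  Ex P (fun w => (\sum_i a i * (psum (z i) j w * z i j w)) ^+ 2)
  = j%:R * \sum_i a i ^+ 2.
Proof.
move=> jn.
have L4S l := iseq_L4_psum l (ltnW jn).
have aS l := iseq_adapted_psum l (ltnW jn).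
have iS i l : L1 P (fun w => psum (z i) j w * psum (z l) j w).
  by apply: L2M; exact: L4_L2.
have aSS i l : adapted (Fil j) (fun w => psum (z i) j w * psum (z l) j w).
  exact: (measurable_funM (aS i) (aS l)).
have H i l := is_ind2 Z i l jn (aSS i l) (iS i l).
have -> : (fun w => (\sum_i a i * (psum (z i) j w * z i j w)) ^+ 2) =
   (fun w => \sum_i \sum_l (a i * a l) *
     (psum (z i) j w * psum (z l) j w * (z i j w * z l j w))).
  apply/funext => w; rewrite expr2 mulr_suml; apply: eq_bigr => i _.
  by rewrite mulr_sumr; apply: eq_bigr => l _; ring.
rewrite Ex_sum; last first.
  by move=> i _; apply: L1_sum => l _; apply: L1Z; exact: (H i l).1.
rewrite mulr_sumr; apply: eq_bigr => i _.
rewrite Ex_sum; last by move=> l _; apply: L1Z; exact: (H i l).1.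
rewrite (bigD1 i)//= big1 ?addr0.
  rewrite ExZ ?(H i i).2 ?psum_cov ?(ltnW jn)//; last exact: (H i i).1.
  by rewrite eqxx /=; ring.
move=> l li; rewrite ExZ ?(H i l).2 ?(eq_sym i) ?(negPf li) ?mulr0//.
exact: (H i l).1.
Qed.

(** Off the diagonal [is_sqcov] kills every term; on it remain the variances of the squared
    innovations, the place where fourth moments are needed. *)
Let Ex_quad2 a j : (j < n)%N ->
  Ex P (fun w => (\sum_i a i * (z i j w ^+ 2 - 1)) ^+ 2) <= K * \sum_i a i ^+ 2.
Proof.
move=> jn.
have -> : (fun w => (\sum_i a i * (z i j w ^+ 2 - 1)) ^+ 2) =
   (fun w => \sum_i \sum_l (a i * a l) *
     ((z i j w ^+ 2 - 1) * (z l j w ^+ 2 - 1))).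
  apply/funext => w; rewrite expr2 mulr_suml; apply: eq_bigr => i _.
  by rewrite mulr_sumr; apply: eq_bigr => l _; ring.
have H i l := L2M (L2sq i jn) (L2sq l jn).
rewrite Ex_sum; last by move=> i _; apply: L1_sum => l _; exact: L1Z.
rewrite mulr_sumr; apply: ler_sum => i _.
rewrite Ex_sum; last by move=> l _; exact: L1Z.
rewrite (bigD1 i)//= big1 ?addr0.
  rewrite ExZ// -expr2 mulrC ler_wpM2r ?sqr_ge0//.
  apply: le_trans (is_m4 Z i jn).
  have i4 : L1 P (fun w => z i j w ^+ 4).
    by have := (is_L4 Z i jn).2.2; under eq_fun do rewrite -exprM.
  have i2 := (iseq_L2 i jn).2.
  have e2 : Ex P (fun w => z i j w ^+ 2) = 1.
    by have := is_cov Z i i jn; rewrite eqxx.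
  have -> : (fun w => (z i j w ^+ 2 - 1) * (z i j w ^+ 2 - 1)) =
    (fun w => (z i j w ^+ 4 - 2 * z i j w ^+ 2) + 1).
    by apply/funext => w; ring.
  rewrite ExD ?ExB ?ExZ ?Ex_cst ?e2//; [lra|exact: L1Z| |exact: L1_cst].
  by apply: L1B => //; exact: L1Z.
by move=> l li; rewrite ExZ// (is_sqcov Z) ?mulr0// eq_sym.
Qed.

Let Ex_quadD a j : (j < n)%N ->
  Ex P (fun w => quadD a j w ^+ 2) <= (8 + 2 * K) * n%:R * \sum_i a i ^+ 2.
Proof.
move=> jn.
have i1 := (L2quad1 a jn).2; have i2 := (L2quad2 a jn).2.
(* From [(2 x + y) ^+ 2 <= 8 x ^+ 2 + 2 y ^+ 2]. *)
apply: (@le_trans _ _ (8 * (j%:R * \sum_i a i ^+ 2) + 2 * (K * \sum_i a i ^+ 2))).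
  rewrite -Ex_quad1//.
  apply: (@le_trans _ _ (Ex P (fun w =>
     8 * (\sum_i a i * (psum (z i) j w * z i j w)) ^+ 2 +
     2 * (\sum_i a i * (z i j w ^+ 2 - 1)) ^+ 2))).
    apply: Ex_le; first exact: (L2quadD a jn).2.
      by apply: L1D; exact: L1Z.
    move=> w; rewrite quadD_E.
    set x := \sum_i _; set y := \sum_i _; have := sqr_ge0 (2 * x - y); nra.
  rewrite ExD ?ExZ//; [|exact: L1Z|exact: L1Z].
  by rewrite lerD2l ler_pM2l// Ex_quad2.
have A0 : 0 <= \sum_i a i ^+ 2 by rewrite sumr_ge0// => i _; exact: sqr_ge0.
(* [1 <= K] is known only when there is a component; without one all sums are empty. *)
case: (pickP (fun _ : I => true)) => [i _|I0]; last first.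
  by rewrite big_pred0// !mulr0 addr0.
have K1 := iseq_K_ge1 i (leq_ltn_trans (leq0n j) jn).
have n1 : 1 <= n%:R :> R by rewrite ler1n (leq_ltn_trans (leq0n j) jn).
have jn' : j%:R <= n%:R :> R by rewrite ler_nat ltnW.
have -> : 8 * (j%:R * \sum_i a i ^+ 2) + 2 * (K * \sum_i a i ^+ 2) =
  (8 * j%:R + 2 * K) * \sum_i a i ^+ 2 by ring.
apply: ler_wpM2r => //; nra.
Qed.

Let quadD_orth a j H : (j < n)%N -> adapted (Fil j) H -> L2 P H ->
  Ex P (fun w => H w * quadD a j w) = 0.
Proof.
move=> jn aH iH.
have aS l := iseq_adapted_psum l (ltnW jn).
have iS l := L4_L2 (iseq_L4_psum l (ltnW jn)).
have aHS l : adapted (Fil j) (fun w => H w * psum (z l) j w).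
  exact: (measurable_funM aH (aS l)).
have h1 l := is_ind1 Z l jn (aHS l) (L2M iH (iS l)).
have h2 l := is_ind2 Z l l jn aH (L2_L1 iH).
have -> : (fun w => H w * quadD a j w) = (fun w => \sum_i a i *
   (2 * (H w * psum (z i) j w * z i j w) + (H w * (z i j w * z i j w) - H w))).
  by apply/funext => w; rewrite mulr_sumr; apply: eq_bigr => i _; ring.
have i1 i : L1 P (fun w => H w * (z i j w * z i j w) - H w).
  by apply: L1B; [exact: (h2 i).1|exact: L2_L1].
have i2 i : L1 P (fun w => 2 * (H w * psum (z i) j w * z i j w)).
  by apply: L1Z; exact: (h1 i).1.
rewrite Ex_sum; last by move=> i _; apply: L1Z; apply: L1D.
rewrite big1// => i _; rewrite (ExZ _ (L1D (i2 i) (i1 i))) (ExD (i2 i) (i1 i)).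
rewrite (ExZ _ (h1 i).1) (ExB (h2 i).1 (L2_L1 iH)) (h1 i).2 (h2 i).2 eqxx /=; ring.
Qed.

(** After division by [n] the maximum is of the order of the Euclidean norm of the weights, at most
    sqrt d for weights in [0, 1]. *)
Lemma quad_max a : L2 P (maxabs (quadD a) n) /\
  Ex P (fun w => maxabs (quadD a) n w ^+ 2) <=
    8 * (8 + 2 * K) * n%:R ^+ 2 * \sum_i a i ^+ 2.
Proof.
have [] := @doob_L2 _ _ _ P Fil n (quadD a) (is_fil Z) _ _ _.
- by move=> j jn; exact: L2quadD.
- move=> j jn; apply: adapted_sum => i _; apply: measurable_funM => //.
  have az := is_adapted Z i jn.
  apply: measurable_funD; last by apply: measurable_funB => //; exact: measurable_funX.
  apply: measurable_funM => //; apply: measurable_funM => //.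
  apply: (adaptedS (is_fil Z jn)); exact: iseq_adapted_psum (ltnW jn).
- by move=> j H jn aH iH; exact: quadD_orth.
move=> h1 h2; split=> //; apply: le_trans h2 _.
apply: (@le_trans _ _ (8 * \sum_(j < n) (8 + 2 * K) * n%:R * \sum_i a i ^+ 2)).
  by rewrite ler_pM2l//; apply: ler_sum => j _; exact: Ex_quadD.
by rewrite sumr_const card_ord -mulr_natl le_eqVlt; apply/orP; left; apply/eqP; ring.
Qed.

Lemma lin_max a : L2 P (maxabs (linD a) n) /\
  Ex P (fun w => maxabs (linD a) n w ^+ 2) <= 8 * n%:R * \sum_i a i ^+ 2.
Proof.
have L2lin j : (j < n)%N -> L2 P (linD a j).
  by move=> jn; apply: L2_sum => i _; apply: L2Z; exact: iseq_L2.
have [] := @doob_L2 _ _ _ P Fil n (linD a) (is_fil Z) L2lin _ _.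
- move=> j jn; apply: adapted_sum => i _; apply: measurable_funM => //.
  exact: (is_adapted Z i jn).
- move=> j H jn aH iH.
  have h1 l := is_ind1 Z l jn aH (L2_L1 iH).
  have -> : (fun w => H w * linD a j w) = (fun w => \sum_i a i * (H w * z i j w)).
    by apply/funext => w; rewrite mulr_sumr; apply: eq_bigr => i _; ring.
  rewrite Ex_sum; last by move=> i _; apply: L1Z; exact: (h1 i).1.
  by rewrite big1// => i _; rewrite ExZ ?(h1 i).2 ?mulr0//; exact: (h1 i).1.
move=> h1 h2; split=> //; apply: le_trans h2 _.
rewrite -mulrA ler_pM2l// mulr_natl -[X in _ *+ X]card_ord -sumr_const.
apply: ler_sum => j _.
have -> : (fun w => linD a j w ^+ 2) =
   (fun w => \sum_i \sum_l (a i * a l) * (z i j w * z l j w)).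
  apply/funext => w; rewrite expr2 mulr_suml; apply: eq_bigr => i _.
  by rewrite mulr_sumr; apply: eq_bigr => l _; ring.
have jn := ltn_ord j.
have H i l := L2M (iseq_L2 i jn) (iseq_L2 l jn).
rewrite Ex_sum; last by move=> i _; apply: L1_sum => l _; exact: L1Z.
apply: ler_sum => i _.
rewrite Ex_sum; last by move=> l _; exact: L1Z.
rewrite (bigD1 i)//= big1 ?addr0.
  by rewrite ExZ// (is_cov Z)// eqxx mulr1.
by move=> l li; rewrite ExZ// (is_cov Z)// (eq_sym i) (negPf li) mulr0.
Qed.

(** With a single weight 1, [quadD] has partial sums [psum (z i) k w ^+ 2 - k%:R], so the second
    moment of its maximum bounds the fourth moment of that of the walk; no maximal inequality of
    order 4 is needed. *)
Lemma walk_max4 i : L4 P (maxabs (z i) n) /\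
  Ex P (fun w => maxabs (z i) n w ^+ 4) <= (16 * (8 + 2 * K) + 2) * n%:R ^+ 2.
Proof.
pose a l : R := (l == i)%:R.
have a2 : \sum_l a l ^+ 2 = 1.
  rewrite (bigD1 i)//= /a eqxx expr1n big1 ?addr0// => l /negPf ->.
  by rewrite expr0n.
have [L2q] := quad_max a; rewrite a2 mulr1 => Eq.
have qE k w : psum (quadD a) k w = psum (z i) k w ^+ 2 - k%:R.
  rewrite psum_quadD (bigD1 i)//= /a eqxx mul1r big1 ?addr0// => l /negPf ->.
  by rewrite mul0r.
have mm : measurable_fun setT (maxabs (z i) n).
  apply: measurable_rmax => k kn; apply: measurableT_comp => //.
  exact: L4_meas (iseq_L4_psum i kn).
have le w : maxabs (z i) n w ^+ 2 <= maxabs (quadD a) n w + n%:R.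
  rewrite {1}/maxabs; have [k kn ->] := rmax_ex (fun k => `|psum (z i) k w|) n.
  rewrite real_normK ?num_real//.
  have := @maxabs_ge _ Omega R n (quadD a) k w kn; rewrite qE.
  have := ler_norm (psum (z i) k w ^+ 2 - k%:R).
  have : k%:R <= n%:R :> R by rewrite ler_nat.
  lra.
have L2b : L2 P (fun w => maxabs (quadD a) n w + n%:R).
  by apply: L2D => //; exact: L2_cst.
have q0 w : 0 <= maxabs (quadD a) n w by exact: maxabs_ge0.
have i4 : L4 P (maxabs (z i) n).
  split => //; apply: L2_le L2b _; first exact: measurable_funX.
  by move=> w; rewrite !ger0_norm ?sqr_ge0// addr_ge0.
split=> //.
apply: (@le_trans _ _ (Ex P (fun w => 2 * maxabs (quadD a) n w ^+ 2 + 2 * n%:R ^+ 2))).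
  apply: Ex_le.
  - by have := i4.2.2; under eq_fun do rewrite -exprM.
  - by apply: L1D; [apply: L1Z; exact: L2q.2|exact: L1_cst].
  - move=> w; rewrite (_ : 4 = 2 * 2)%N// exprM.
    apply: (@le_trans _ _ ((maxabs (quadD a) n w + n%:R) ^+ 2)).
      by rewrite ler_sqr ?nnegrE ?sqr_ge0// addr_ge0.
    have := sqr_ge0 (maxabs (quadD a) n w - n%:R); nra.
rewrite (ExD (L1Z 2 L2q.2) (L1_cst P _)) (ExZ _ L2q.2) Ex_cst; nra.
Qed.

End bounds.
End innovation_sequence.

Section from_innovations.
Context {d : measure_display} {Omega : measurableType d} {R : realType}.
Variable P : probability Omega R.

Lemma indep_pair_comp (X Y : Omega -> R) (f g : R -> R) :
  measurable_fun setT f -> measurable_fun setT g ->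
  indep_pair P X Y -> indep_pair P (f \o X) (g \o Y).
Proof.
move=> mf mg XY A B mA mB; apply: (XY (f @^-1` A) (g @^-1` B)).
  by rewrite -[X in measurable X]setTI; exact: mf.
by rewrite -[X in measurable X]setTI; exact: mg.
Qed.

Lemma mutually_independent_pair (I : finType) (X : I -> Omega -> R) i l :
  mutually_independent P X -> i != l -> indep_pair P (X i) (X l).
Proof.
move=> H il A B mA mB.
have := H [set i; l]%SET (fun k => if k == i then A else B).
rewrite big_setU1 ?inE//= big_set1 eqxx eq_sym (negPf il) => <-; last first.
  by move=> k; case: ifP.
congr (P _); apply/seteqP; split=> [w [wA wB] k /=|w H'].
  by rewrite !inE => /orP[/eqP ->|/eqP ->]; rewrite ?eqxx// eq_sym (negPf il).
split; first by have := H' i; rewrite /= !inE eqxx; exact.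
by have := H' l; rewrite /= !inE eqxx orbT eq_sym (negPf il); exact.
Qed.

Variables (n T : nat) (eta : 'I_n.+1 -> nat -> {RV P >-> R}).
Hypothesis eta_innov : innovations T eta.
Variables (nu M : R).
Hypothesis nu4 : 4 < nu.
Hypothesis eta_moment : forall (i : 'I_n.+1) t, (1 <= t <= T)%N ->
  ('E_P[fun w => (`|eta i t w| `^ nu)%R] <= M%:E)%E.

Let x4_le (x : R) : x ^+ 4 <= 1 + `|x| `^ nu.
Proof.
have -> : x ^+ 4 = `|x| ^+ 4 by rewrite -normrX ger0_norm// exprn_even_ge0.
case: (leP `|x| 1) => h.
  by rewrite (@le_trans _ _ 1) ?exprn_ile1// lerDl powR_ge0.
rewrite -powR_mulrn//; apply: (@le_trans _ _ (`|x| `^ nu)); last by rewrite lerDr.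
by apply: ler_powR; rewrite ltW.
Qed.

Let pow_L1 i t : (1 <= t <= T)%N ->
  L1 P (fun w => `|eta i t w| `^ nu) /\ Ex P (fun w => `|eta i t w| `^ nu) <= M.
Proof.
move=> tT.
have m : measurable_fun setT (fun w => `|eta i t w| `^ nu).
  by apply: (measurableT_comp (measurable_powR nu)); exact: measurableT_comp.
have i1 : L1 P (fun w => `|eta i t w| `^ nu).
  apply/integrableP; split; first exact/measurable_EFinP.
  have := eta_moment i tT; rewrite unlock => h.
  apply: le_lt_trans (ltry M); apply: le_trans h.
  rewrite le_eqVlt; apply/orP; left; apply/eqP; apply: eq_integral => w _ /=.
  by rewrite ger0_norm ?powR_ge0.
split=> //; have := eta_moment i tT.
by rewrite (expectationE i1) lee_fin.
Qed.

Let eta_L4 i t : (1 <= t <= T)%N ->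
  L4 P (eta i t : Omega -> R) /\ Ex P (fun w => (eta i t w : R) ^+ 4) <= 1 + M.
Proof.
move=> tT; have [i1 e1] := pow_L1 i tT.
have i2 : L1 P (fun w => 1 + `|eta i t w| `^ nu) by apply: L1D => //; exact: L1_cst.
have i4 : L1 P (fun w => (eta i t w : R) ^+ 4).
  apply: L1_le i2 _; first exact: measurable_funX.
  by move=> w; rewrite ger0_norm ?x4_le// exprn_even_ge0.
split; last first.
  apply: (le_trans (Ex_le i4 i2 _)) => // .
  by rewrite (ExD (L1_cst P 1) i1) Ex_cst lerD2l.
split=> //; split; first exact: measurable_funX.
by under eq_fun do rewrite -exprM.
Qed.

Let eta_mean i t : (1 <= t <= T)%N -> Ex P (eta i t) = 0.
Proof.
move=> tT; have i1 := L2_L1 (L4_L2 (eta_L4 i tT).1).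
by have := innov_mean eta_innov i tT; rewrite (expectationE i1) => -[].
Qed.

Let eta_var i t : (1 <= t <= T)%N ->
  Ex P (fun w => (eta i t w : R) * eta i t w) = 1.
Proof.
move=> tT; have iL2 := L4_L2 (eta_L4 i tT).1.
have := innov_var eta_innov i tT; rewrite /variance unlock.
rewrite (innov_mean eta_innov i tT) /=.
have -> : ((eta i t \- cst 0) * (eta i t \- cst 0))%R =
   (fun w => (eta i t w : R) * eta i t w).
  by apply/funext => w; rewrite !fctE /= !subr0.
by rewrite (expectationE (L2M iL2 iL2)) => -[].
Qed.

Let eta_indep i l t : (1 <= t <= T)%N -> i != l ->
  indep_pair P (eta i t) (eta l t).
Proof.
move=> tT il.
exact: (mutually_independent_pair (innov_indep_comp eta_innov tT) il).
Qed.

Let Y (t : 'I_T) (w : Omega) : n.+1.-tuple R := [tuple (eta i t.+1 w : R) | i < n.+1].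

Let mY t : measurable_fun setT (Y t).
Proof.
apply/measurable_fun_tnthP => i.
apply: (eq_measurable_fun (eta i t.+1 : Omega -> R)) => // w _.
by rewrite /= tnth_mktuple.
Qed.

Variables (N : nat) (tau : nat -> nat).
Hypothesis tauT : forall j, (j < N)%N -> (1 <= tau j <= T)%N.
Hypothesis tau_inj : forall j k, (j < N)%N -> (k < N)%N -> tau j = tau k -> j = k.

(** The times [tau 0], ..., [tau j.-1] already visited, shifted by one because ordinals start at
    0. *)
Let S (j : nat) : {set 'I_T} := [set t : 'I_T | has (fun k => tau k == t.+1) (iota 0 j)]%SET.

Let tau_ord j : (j < N)%N -> exists2 t : 'I_T, t.+1 = tau j & t \notin S j.
Proof.
move=> jN; have /andP[t1 tT] := tauT jN.
have h : ((tau j).-1 < T)%N by rewrite prednK.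
exists (Ordinal h); first by rewrite /= prednK.
rewrite inE; apply/hasPn => k; rewrite mem_iota add0n => /andP[_ kj] /=.
apply/eqP => E; have h' : tau k = tau j by rewrite E /= prednK.
by move: (kj); rewrite (tau_inj (ltn_trans kj jN) jN h') ltnn.
Qed.

Let SS j : S j \subset S j.+1.
Proof.
apply/fintype.subsetP => t; rewrite !inE => /hasP[k]; rewrite mem_iota => /andP[_ kj] h.
by apply/hasP; exists k => //; rewrite mem_iota /= (leq_trans kj).
Qed.

Let eta_tau j i (t : 'I_T) : t.+1 = tau j ->
  (eta i (tau j) : Omega -> R) = (fun x : n.+1.-tuple R => tnth x i) \o Y t.
Proof. by move=> <-; apply/funext => w /=; rewrite tnth_mktuple. Qed.

(** The order in which distinct times are visited is irrelevant, the past being what has been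
    visited. The forward walk, the reversed walk and the walks restarted at a block are all
    instances. *)
Lemma innovations_iseq : exists Fil,
  iseq P N (fun i j => eta i (tau j) : Omega -> R) Fil (1 + M).
Proof.
exists (fun j => cylinder Y (S j)); split.
- move=> j jN; apply: subset_trans (@sub_sigma_algebra _ _ _).
  exact: cylinderS.
- by move=> j _; exact: cylinder_measurable.
- move=> i j jN; have [t tE _] := tau_ord jN.
  move=> _ B mB; rewrite setTI; apply: sub_sigma_algebra.
  rewrite (eta_tau i tE) comp_preimage; apply: cylinder_coord => //.
    rewrite inE; apply/hasP; exists j; last by rewrite tE.
    by rewrite mem_iota /= add0n.
  by rewrite -[X in measurable X]setTI; exact: measurable_tnth.
- by move=> i j jN; exact: (eta_L4 i (tauT jN)).1.
- by move=> i j jN; exact: eta_mean (tauT jN).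
- move=> i l j jN; have jT := tauT jN; case: eqVneq => [->|il].
    exact: eta_var.
  have i1 := L2_L1 (L4_L2 (eta_L4 i jT).1); have i2 := L2_L1 (L4_L2 (eta_L4 l jT).1).
  by rewrite (indep_ExM (eta_indep jT il) i1 i2).2 !eta_mean// mul0r.
- by move=> i j jN; exact: (eta_L4 i (tauT jN)).2.
- move=> i l j jN il; have jT := tauT jN.
  have mf : measurable_fun setT (fun x : R => x ^+ 2 - 1).
    by apply: measurable_funB => //; exact: measurable_funX.
  have h k : L1 P ((fun x : R => x ^+ 2 - 1) \o eta k (tau j)).
    by apply: L1B; [exact: L2_L1 (eta_L4 k jT).1.2|exact: L1_cst].
  rewrite (indep_ExM (indep_pair_comp mf mf (eta_indep jT il)) (h i) (h l)).2.
  suff -> : Ex P ((fun x : R => x ^+ 2 - 1) \o eta i (tau j)) = 0 by rewrite mul0r.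
  rewrite ExB ?Ex_cst; [|exact: L2_L1 (eta_L4 i jT).1.2|exact: L1_cst].
  by rewrite (_ : Ex P _ = 1) ?subrr//; exact: eta_var.
- move=> H i j jN aH iH; have [t tE tS] := tau_ord jN.
  have i1 : L1 P ((fun x : n.+1.-tuple R => tnth x i) \o Y t).
    by rewrite -(eta_tau i tE); exact: L2_L1 (L4_L2 (eta_L4 i (tauT jN)).1).
  have [h1 h2] := indep_cylinder_ExM mY (innov_indep_time eta_innov) tS aH
    (@measurable_tnth _ _ _ i) iH i1.
  rewrite (eta_tau i tE); split=> //.
  by rewrite h2 -(eta_tau i tE) (eta_mean i (tauT jN)) mulr0.
- move=> H i l j jN aH iH; have [t tE tS] := tau_ord jN.
  have jT := tauT jN.
  pose phi (x : n.+1.-tuple R) := tnth x i * tnth x l.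
  have mphi : measurable_fun setT phi.
    by apply: measurable_funM; exact: measurable_tnth.
  have phiE : phi \o Y t = (fun w => (eta i (tau j) w : R) * eta l (tau j) w).
    by rewrite (eta_tau i tE) (eta_tau l tE).
  have i1 : L1 P (phi \o Y t).
    by rewrite phiE; apply: L2M; apply: L4_L2; exact: (eta_L4 _ jT).1.
  have [h1 h2] := indep_cylinder_ExM mY (innov_indep_time eta_innov) tS aH mphi iH i1.
  rewrite (eta_tau i tE) (eta_tau l tE); split=> //.
  rewrite h2 phiE; congr (_ * _).
  case: eqVneq => [->|il]; first exact: eta_var.
  have i3 := L2_L1 (L4_L2 (eta_L4 i jT).1); have i4 := L2_L1 (L4_L2 (eta_L4 l jT).1).
  by rewrite (indep_ExM (eta_indep jT il) i3 i4).2 !eta_mean// mul0r.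
Qed.

End from_innovations.

(** * Bounded Lipschitz test functions and weak convergence *)

Section bounded_lipschitz.
Context {R : realType}.
Implicit Types f g : R -> R.

Definition blip f : Prop := (exists2 l : R, 0 <= l & forall x y, `|f x - f y| <= l * `|x - y|) /\
  exists M : R, forall x, `|f x| <= M.

Lemma blip_cst c : blip (fun=> c).
Proof.
split; last by exists `|c|.
by exists 0 => // x y; rewrite subrr normr0 mul0r.
Qed.

Lemma blipD f g : blip f -> blip g -> blip (fun x => f x + g x).
Proof.
move=> [[l l0 fl] [M fM]] [[l' l'0 gl] [M' gM]]; split; last first.
  exists (M + M') => x; apply: le_trans (ler_normD _ _) _; exact: lerD.
exists (l + l'); first exact: addr_ge0.
move=> x y; rewrite opprD addrACA mulrDl; apply: le_trans (ler_normD _ _) _.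
exact: lerD.
Qed.

Lemma blipZ c f : blip f -> blip (fun x => c * f x).
Proof.
move=> [[l l0 fl] [M fM]]; split; last first.
  by exists (`|c| * M) => x; rewrite normrM ler_wpM2l.
exists (`|c| * l); first exact: mulr_ge0.
by move=> x y; rewrite -mulrBr normrM -mulrA ler_wpM2l.
Qed.

Lemma blip_continuous f : blip f -> continuous f.
Proof.
move=> [[l l0 fl] _] x; apply/cvgrPdist_le => e e0.
apply/nbhs_ballP; exists (e / (l + 1)) => /=.
  by rewrite divr_gt0// ltr_wpDl.
move=> y; rewrite /ball /= ltr_pdivlMr ?ltr_wpDl// => h.
apply: le_trans (fl _ _) _; apply: le_trans (ltW h).
by rewrite mulrC ler_wpM2l// lerDl.
Qed.

Lemma blip_measurable f : blip f -> measurable_fun setT f.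
Proof. by move=> /blip_continuous; exact: continuous_measurable_fun. Qed.

(** A Lipschitz function of [y] lying between the indicators of []-oo, x]] and of []-oo, x + e]]. *)
Definition ramp (x e y : R) : R := Num.max 0 (Num.min 1 (1 - (y - x) / e)).

Lemma ramp_itv x e y : 0 <= ramp x e y <= 1.
Proof. by rewrite /ramp le_max lexx /= ge_max ler01 ge_min lexx. Qed.

Lemma ramp_left x e y : 0 < e -> y <= x -> ramp x e y = 1.
Proof.
move=> e0 yx; rewrite /ramp min_l ?max_r//.
by rewrite lerBrDl gerDr pmulr_lle0 ?invr_gt0// subr_le0.
Qed.

Lemma ramp_right x e y : 0 < e -> x + e <= y -> ramp x e y = 0.
Proof.
move=> e0 xy; rewrite /ramp max_l// ge_min; apply/orP; right.
by rewrite subr_le0 ler_pdivlMr// mul1r lerBrDl.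
Qed.

Lemma ramp_lip x x' e y y' : 0 < e ->
  `|ramp x e y - ramp x' e y'| <= e^-1 * (`|y - y'| + `|x - x'|).
Proof.
move=> e0; rewrite /ramp.
have -> : e^-1 * (`|y - y'| + `|x - x'|) = `|(y - y') / e| + `|(x - x') / e|.
  have e1 : 0 < e^-1 by rewrite invr_gt0.
  by rewrite !normrM (gtr0_norm e1); ring.
have : (y - x) / e - (y' - x') / e = (y - y') / e - (x - x') / e by ring.
set a := _ / e; set b := _ / e; set c := _ / e; set r := _ / e => h.
have : `|a - b| <= `|c| + `|r| by rewrite h ler_normB.
set s := `|c| + `|r|.
rewrite !ler_norml => /andP[h1 h2].
rewrite /Num.max /Num.min; repeat case: ifP; move=> *; lra.
Qed.

Lemma blip_ramp x e : 0 < e -> blip (ramp x e).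
Proof.
move=> e0; split.
  exists e^-1; first by rewrite invr_ge0 ltW.
  by move=> y y'; have := ramp_lip x x y y' e0; rewrite subrr normr0 addr0.
by exists 1 => y; have /andP[h1 h2] := ramp_itv x e y; rewrite ger0_norm.
Qed.

End bounded_lipschitz.

(** * Lipschitz regularisation of continuous test functions *)

Section inf_convolution.
Context {R : realType}.
Variables (f : R -> R) (M : R).
Hypothesis fc : continuous f.
Hypothesis fM : forall x, `|f x| <= M.

(** The Pasch-Hausdorff envelope, that is, the largest [k]-Lipschitz minorant of [f]. *)
Definition infconv (k : R) (x : R) : R := inf [set f y + k * `|x - y| | y in setT].

Let lbd k x : 0 <= k -> has_lbound [set f y + k * `|x - y| | y in setT].
Proof.
move=> k0; exists (- M) => _ [y _ <-].
have := fM y; rewrite ler_norml => /andP[h _].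
by rewrite (le_trans h)// lerDl mulr_ge0.
Qed.

Let ne k x : [set f y + k * `|x - y| | y in setT] !=set0.
Proof. by exists (f x + k * `|x - x|); exists x. Qed.

Lemma infconv_le k x : 0 <= k -> infconv k x <= f x.
Proof.
by move=> k0; apply: ge_inf; [exact: lbd|exists x => //; rewrite subrr normr0 mulr0 addr0].
Qed.

Lemma infconv_blip k : 0 <= k -> blip (infconv k).
Proof.
move=> k0; split; last first.
  exists M => x; rewrite ler_norml; apply/andP; split.
    apply: lb_le_inf; first exact: ne.
    move=> _ [y _ <-]; have := fM y; rewrite ler_norml => /andP[h _].
    by rewrite (le_trans h)// lerDl mulr_ge0.
  by apply: le_trans (infconv_le x k0) _; rewrite (le_trans (ler_norm _)).
exists k => //.
have H x y : infconv k x - infconv k y <= k * `|x - y|.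
  rewrite lerBlDr -lerBlDl; apply: lb_le_inf; first exact: ne.
  move=> _ [z _ <-]; rewrite lerBlDl.
  apply: (@le_trans _ _ (f z + k * `|x - z|)).
    by apply: ge_inf; [exact: lbd|exists z].
  rewrite addrCA lerD2l -mulrDr ler_wpM2l//.
  exact: ler_distD.
move=> x y; rewrite ler_norml H andbT lerNl opprB distrC; exact: H.
Qed.

Lemma infconv_cvg x : infconv n%:R x @[n --> \oo] --> f x.
Proof.
have M0 : 0 <= M by exact: le_trans (fM 0).
apply/cvgrPdist_le => e e0.
have := @fc x; move=> /cvgrPdist_le/(_ _ e0)/nbhs_ballP[r /= r0 Hr].
near=> n.
rewrite ger0_norm ?subr_ge0 ?infconv_le//.
rewrite lerBlDr -lerBlDl; apply: lb_le_inf; first exact: ne.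
move=> _ [y _ <-]; case: (ltP `|x - y| r) => h.
  have := Hr y h; rewrite ler_norml => /andP[_ h1].
  have : 0 <= n%:R * `|x - y| by rewrite mulr_ge0.
  rewrite lerBlDr lerBlDl in h1 *; lra.
(* At distance [r] or more the penalty is at least [2 * M], the largest possible drop of [f], so
   such points cannot lower the infimum below [f x]. *)
have : 2 * M / r <= n%:R by near: n; exact: nbhs_infty_ger.
rewrite ler_pdivrMr// => h1.
have h2 : n%:R * r <= n%:R * `|x - y| by rewrite ler_wpM2l.
have := fM x; have := fM y; rewrite !ler_norml => /andP[? ?] /andP[? ?].
rewrite lerBlDr; lra.
Unshelve. all: by end_near. Qed.

End inf_convolution.

Section expectation_of_bounded.
Context {R : realType} {d} {Omega : measurableType d} (P : probability Omega R).

Lemma L1_blip (f : R -> R) (Y : Omega -> R) : blip f -> measurable_fun setT Y ->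
  L1 P (f \o Y).
Proof.
move=> bf mY; have [M fM] := bf.2; apply: (@L1_bounded _ _ _ _ _ M).
  by apply: measurableT_comp => //; exact: blip_measurable.
by move=> w; exact: fM.
Qed.

Lemma Ex_bounded_cvg (f_ : nat -> Omega -> R) (f : Omega -> R) M :
  (forall n, measurable_fun setT (f_ n)) -> measurable_fun setT f ->
  (forall n w, `|f_ n w| <= M) -> (forall w, `|f w| <= M) ->
  (forall w, f_ n w @[n --> \oo] --> f w) ->
  Ex P (f_ n) @[n --> \oo] --> Ex P f.
Proof.
move=> mf_ mf fM_ fM fcv.
have := @dominated_cvg _ _ _ P setT measurableT (fun n w => (f_ n w)%:E)
   (fun w => (f w)%:E) (fun=> M%:E).
have mE n : measurable_fun setT (fun w => (f_ n w)%:E) by apply/measurable_EFinP.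
move=> /(_ mE) H; apply: fine_cvg.
rewrite fineK; last by apply: integrable_fin_num => //; exact: L1_bounded fM.
apply: H => //.
- by move=> w _; apply: cvg_EFin; [exact: nearW|exact: fcv].
- exact: L1_cst.
- by move=> n w _; rewrite lee_fin.
Qed.

End expectation_of_bounded.
Section convergence_in_distribution.
Context {R : realType} {d} {Omega : measurableType d} (P : probability Omega R).

(** A Lipschitz minorant with almost the same mean as [f] under [L] bounds the expectations from
    below. Applied to [f] and to its opposite, this gives convergence. *)
Let Ex_lower (X : nat -> Omega -> R) (L : probability R R) (f : R -> R) M :
  (forall n, measurable_fun setT (X n)) ->
  (forall f, blip f -> Ex P (f \o X n) @[n --> \oo] --> Ex L f) ->
  continuous f -> (forall x, `|f x| <= M) -> forall e, 0 < e ->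
  \forall n \near \oo, Ex L f - e <= Ex P (f \o X n).
Proof.
move=> mX H fc fM e e0.
have mf : measurable_fun setT f by exact: continuous_measurable_fun.
have bk (k : nat) : blip (infconv f k%:R) by exact: infconv_blip fM _ _.
have L1f n : L1 P (f \o X n).
  apply: (@L1_bounded _ _ _ _ _ M); last by move=> w; exact: fM.
  by apply: measurableT_comp; [exact: mf|exact: mX].
have infM k x : `|infconv f k%:R x| <= M.
  have k0 : 0 <= k%:R :> R by [].
  rewrite ler_norml; apply/andP; split.
    apply: lb_le_inf; first by exists (f x + k%:R * `|x - x|); exists x.
    move=> _ [y _ <-]; have := fM y; rewrite ler_norml => /andP[h _].
    by rewrite (le_trans h)// lerDl mulr_ge0.
  by apply: le_trans (infconv_le fM x k0) _; rewrite (le_trans (ler_norm _)).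
have := @Ex_bounded_cvg _ _ _ L (fun k => infconv f k%:R) f M
  (fun k => blip_measurable (bk k)) mf infM fM (fun x => @infconv_cvg _ f M fc fM x).
move=> /cvgrPdist_le/(_ (e / 2)); rewrite divr_gt0// => /(_ isT) [k _ /(_ k (leqnn k)) /= hk].
have := H _ (bk k) => /cvgrPdist_le/(_ (e / 2)); rewrite divr_gt0// => /(_ isT).
apply: filterS => n hn.
have h1 : Ex P (infconv f k%:R \o X n) <= Ex P (f \o X n).
  apply: Ex_le; [exact: L1_blip|exact: L1f|].
  by move=> w; apply: (infconv_le fM).
move: hk hn; rewrite !ler_norml => /andP[_ hk] /andP[_ hn]; lra.
Qed.

Lemma cvg_in_distribution_blip (X : nat -> Omega -> R) (L : probability R R) :
  (forall n, measurable_fun setT (X n)) ->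
  (forall f, blip f -> Ex P (f \o X n) @[n --> \oo] --> Ex L f) ->
  cvg_in_distribution P X L.
Proof.
move=> mX H f fc [M fM].
have mf : measurable_fun setT f by exact: continuous_measurable_fun.
have L1f n : L1 P (f \o X n).
  apply: (@L1_bounded _ _ _ _ _ M); last by move=> w; exact: fM.
  by apply: measurableT_comp; [exact: mf|exact: mX].
have L1L : L1 L f by exact: L1_bounded fM.
rewrite (expectationE L1L); under eq_fun do rewrite (expectationE (L1f _)).
apply: cvg_EFin; first exact: nearW.
apply/cvgrPdist_le => e e0.
have fNc : continuous (fun x => - f x) by move=> x; apply: cvgN; exact: fc.
have fNM x : `|- f x| <= M by rewrite normrN.
have := Ex_lower mX H fc fM e0; have := Ex_lower mX H fNc fNM e0.
rewrite (ExN L1L); apply: filterS2 => n /=.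
rewrite -[X in Ex P X]/(fun w => - (f \o X n) w) (ExN (L1f n)) => h1 h2.
by rewrite ler_norml; apply/andP; split; lra.
Qed.

End convergence_in_distribution.

(** * Positive functionals determined by a distribution function *)

Section positive_functionals.
Context {R : realType}.
Implicit Types (f g : R -> R) (l : (R -> R) -> R).

Record posfun l : Prop := {
  posfunD : forall f g, blip f -> blip g -> l (fun x => f x + g x) = l f + l g;
  posfunZ : forall c f, blip f -> l (fun x => c * f x) = c * l f;
  posfun_le : forall f g, blip f -> blip g -> (forall x, f x <= g x) -> l f <= l g;
  posfun_cst : forall c, l (fun=> c) = c
}.

Lemma posfunN l f : posfun l -> blip f -> l (fun x => - f x) = - l f.
Proof.
move=> pl bf; rewrite -mulN1r -(posfunZ pl)//; congr l.
by apply/funext => x; rewrite mulN1r.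
Qed.

Lemma blipN f : blip f -> blip (fun x => - f x).
Proof. by move=> /(blipZ (-1)); under eq_fun do rewrite mulN1r. Qed.

Lemma blipB f g : blip f -> blip g -> blip (fun x => f x - g x).
Proof. by move=> bf /blipN; exact: blipD. Qed.

Lemma posfunB l f g : posfun l -> blip f -> blip g ->
  l (fun x => f x - g x) = l f - l g.
Proof. by move=> pl bf bg; rewrite (posfunD pl)// ?posfunN//; exact: blipN. Qed.

Lemma posfun_norm_le l f g : posfun l -> blip f -> blip g ->
  (forall x, `|f x| <= g x) -> `|l f| <= l g.
Proof.
move=> pl bf bg fg; rewrite ler_norml -(posfunN pl bg).
apply/andP; split; apply: (posfun_le pl) => //; first exact: blipN.
  by move=> x; have := fg x; rewrite ler_norml => /andP[].
by move=> x; exact: le_trans (ler_norm _) (fg x).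
Qed.

Section uniqueness.
Variables (l1 l2 : (R -> R) -> R) (F : R -> R).
Hypothesis pl1 : posfun l1.
Hypothesis pl2 : posfun l2.
Hypothesis F1 : forall x e, 0 < e -> F x <= l1 (ramp x e) <= F (x + e).
Hypothesis F2 : forall x e, 0 < e -> F x <= l2 (ramp x e) <= F (x + e).
Hypothesis FNy : forall e, 0 < e -> exists A, F A <= e.
Hypothesis Fy : forall e, 0 < e -> exists A, 1 - e <= F A.
Hypothesis Fnd : forall x y, x <= y -> F x <= F y.

Section grid.
Variables (f : R -> R) (L M : R) (x0 e : R).
Hypothesis e0 : 0 < e.
Hypothesis L0 : 0 <= L.
Hypothesis fL : forall x y, `|f x - f y| <= L * `|x - y|.
Hypothesis fM : forall x, `|f x| <= M.

Let x i : R := x0 + i%:R * e.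

(** The piecewise linear interpolation of [f] at the grid points, constant outside the grid, written
    as a combination of ramps because ramps are what [F] controls. *)
Fixpoint stair (N : nat) (y : R) : R :=
  if N is k.+1 then stair k y + (f (x k.+1) - f (x k)) * (1 - ramp (x k) e y)
  else f (x 0%N).

Let xS i : x i.+1 = x i + e. Proof. by rewrite /x -natr1; ring. Qed.

Let x_mono i j : (i <= j)%N -> x i <= x j.
Proof. by move=> ij; rewrite lerD2l ler_wpM2r ?ler_nat// ltW. Qed.

Let stair_left N y : y <= x 0%N -> stair N y = f (x 0%N).
Proof.
move=> yx; elim: N => //= N ->; rewrite ramp_left ?subrr ?mulr0 ?addr0//.
by apply: le_trans yx _; exact: x_mono.
Qed.

Let stair_right N y : x N <= y -> stair N y = f (x N).
Proof.
elim: N => //= N IH xy; rewrite ramp_right// -?xS// IH; first ring.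
by apply: le_trans xy; exact: x_mono.
Qed.

Let stair_mid N y : x 0%N <= y -> y <= x N -> `|f y - stair N y| <= 2 * L * e.
Proof.
elim: N => [|N IH] xy yx /=.
  have -> : y = x 0%N by apply/le_anti/andP.
  by rewrite subrr normr0 !mulr_ge0// ltW.
case: (leP y (x N)) => h.
  by rewrite ramp_left// subrr mulr0 addr0; exact: IH.
rewrite stair_right ?(ltW h)//.
have h1 : `|f y - f (x N)| <= L * e.
  apply: le_trans (fL _ _) _; rewrite ler_wpM2l//.
  by rewrite ger0_norm ?subr_ge0 ?(ltW h)//; move: yx; rewrite xS; lra.
have h2 : `|(f (x N.+1) - f (x N)) * (1 - ramp (x N) e y)| <= L * e.
  rewrite normrM; have /andP[r0 r1] := ramp_itv (x N) e y.
  rewrite (@ger0_norm _ (1 - _)) ?subr_ge0//.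
  apply: (@le_trans _ _ (`|f (x N.+1) - f (x N)| * 1)).
    by rewrite ler_wpM2l// gerBl.
  rewrite mulr1; apply: le_trans (fL _ _) _; rewrite ler_wpM2l//.
  by rewrite xS addrC addKr gtr0_norm.
rewrite opprD addrA; apply: le_trans (ler_normB _ _) _; lra.
Qed.

Lemma stair_blip N : blip (stair N).
Proof.
elim: N => [|N IH] /=; first exact: blip_cst.
apply: blipD => //; apply: blipZ; apply: blipB; first exact: blip_cst.
exact: blip_ramp.
Qed.

Lemma stair_close N y : `|f y - stair N y| <= 2 * L * e +
  (2 * M * ramp (x 0%N) e y + 2 * M * (1 - ramp (x N - e) e y)).
Proof.
have M0 : 0 <= M by exact: le_trans (fM 0).
have /andP[r0 r1] := ramp_itv (x 0%N) e y.
have /andP[r2 r3] := ramp_itv (x N - e) e y.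
have p1 : 0 <= 2 * M * ramp (x 0%N) e y by rewrite !mulr_ge0.
have p2 : 0 <= 2 * M * (1 - ramp (x N - e) e y) by rewrite !mulr_ge0// subr_ge0.
have p3 : 0 <= 2 * L * e by rewrite !mulr_ge0// ltW.
have f2 u v : `|f u - f v| <= 2 * M.
  by apply: le_trans (ler_normB _ _) _; have := fM u; have := fM v; lra.
case: (leP (x 0%N) y) => h1; last first.
  rewrite (stair_left _ (ltW h1)) (ramp_left e0 (ltW h1)).
  by apply: le_trans (f2 _ _) _; lra.
case: (leP y (x N)) => h2; last first.
  rewrite (stair_right (ltW h2)) (@ramp_right _ (x N - e)) ?subrK ?(ltW h2)//.
  by apply: le_trans (f2 _ _) _; lra.
by apply: le_trans (stair_mid h1 h2) _; lra.
Qed.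

(** On the ramp of a cell both functionals take values between those of [F] at its end points; the
    sum over the cells telescopes. *)
Lemma stair_diff N : `|l1 (stair N) - l2 (stair N)| <= L * e * (F (x N) - F (x 0%N)).
Proof.
elim: N => [|N IH] /=.
  by rewrite !posfun_cst// !subrr normr0 mulr0.
have br := blip_ramp (x N) e0.
have b1 : blip (fun y => 1 - ramp (x N) e y) by apply: blipB => //; exact: blip_cst.
have b2 : blip (fun y => (f (x N.+1) - f (x N)) * (1 - ramp (x N) e y)).
  exact: blipZ.
have bs := stair_blip N.
rewrite (posfunD pl1 bs b2) (posfunD pl2 bs b2) (posfunZ pl1 _ b1) (posfunZ pl2 _ b1).
rewrite (posfunB pl1 (blip_cst 1) br) (posfunB pl2 (blip_cst 1) br).
rewrite (posfun_cst pl1) (posfun_cst pl2).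
set a := l1 (stair N); set b := l2 (stair N); set D := f _ - f _.
have -> : a + D * (1 - l1 (ramp (x N) e)) - (b + D * (1 - l2 (ramp (x N) e)))
  = (a - b) + D * (l2 (ramp (x N) e) - l1 (ramp (x N) e)) by ring.
apply: le_trans (ler_normD _ _) _.
have -> : L * e * (F (x N.+1) - F (x 0%N)) = L * e * (F (x N) - F (x 0%N)) +
  L * e * (F (x N.+1) - F (x N)) by ring.
apply: lerD => //; rewrite normrM; apply: ler_pM => //.
  by apply: le_trans (fL _ _) _; rewrite xS addrC addKr gtr0_norm.
have := F1 (x N) e0; have := F2 (x N) e0; rewrite -xS => /andP[? ?] /andP[? ?].
by rewrite ler_norml; apply/andP; split; lra.
Qed.

End grid.

(** Continuity of [F] is not assumed, so the ramps are known only up to the increments of [F]. The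
    mesh multiplies these increments, whose sum is at most 1, and thus makes the ambiguity
    vanish. *)
Lemma posfun_unique f : blip f -> l1 f = l2 f.
Proof.
move=> bf; have [[L L0 fL] [M fM]] := bf.
have M0 : 0 <= M by exact: le_trans (fM 0).
(* Twice [(2 + 4 * M) * e] for replacing [f] by its interpolation, tails included, and [e] for
   [stair_diff]. *)
have key e : 0 < e -> `|l1 f - l2 f| <= (5 + 8 * M) * e.
  move=> e0.
  have [A hA] := FNy e0; have [B hB] := Fy e0.
  pose h := e / (L + 1).
  have h0 : 0 < h by rewrite divr_gt0// ltr_wpDl.
  have Lh : L * h <= e.
    rewrite /h mulrA ler_pdivrMr ?ltr_wpDl// mulrC; nra.
  pose x0 := A - h.
  have [N hN] : exists N : nat, B + h <= x0 + N%:R * h.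
    exists (Num.bound `|(B + h - x0) / h|).
    rewrite -lerBlDl -ler_pdivrMr//; apply: le_trans (ler_norm _) _.
    exact/ltW/archi_boundP/normr_ge0.
  pose g := stair f x0 h N.
  have bg : blip g by exact: stair_blip.
  have gd : `|l1 g - l2 g| <= L * h * (F (x0 + N%:R * h) - F (x0 + 0%:R * h)).
    exact: stair_diff.
  pose H y : R := 2 * L * h +
    (2 * M * ramp (x0 + 0%:R * h) h y + 2 * M * (1 - ramp (x0 + N%:R * h - h) h y)).
  have br x := blip_ramp x h0.
  have b1 x : blip (fun y => 1 - ramp x h y) by apply: blipB => //; exact: blip_cst.
  have bH1 : blip (fun y => 2 * M * ramp (x0 + 0%:R * h) h y) by exact: blipZ.
  have bH2 : blip (fun y => 2 * M * (1 - ramp (x0 + N%:R * h - h) h y)) by exact: blipZ.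
  have bH : blip H by apply: blipD; [exact: blip_cst|exact: blipD].
  have fgH y : `|f y - g y| <= H y by exact: stair_close.
  have bfg : blip (fun y => f y - g y) by exact: blipB.
  have lH l : posfun l ->
    (forall x e, 0 < e -> F x <= l (ramp x e) <= F (x + e)) -> l H <= (2 + 4 * M) * e.
    move=> pl Fl; rewrite /H (posfunD pl (blip_cst _) (blipD bH1 bH2)).
    rewrite (posfunD pl bH1 bH2) (posfunZ pl _ (br _)) (posfunZ pl _ (b1 _)).
    rewrite (posfunB pl (blip_cst 1) (br _)) !(posfun_cst pl).
    have /andP[_ h1] := Fl (x0 + 0%:R * h) _ h0.
    have /andP[h2 _] := Fl (x0 + N%:R * h - h) _ h0.
    have h3 : F (x0 + 0%:R * h + h) <= e by rewrite mul0r addr0 subrK.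
    have h4 : 1 - e <= F (x0 + N%:R * h - h).
      by apply: le_trans hB _; apply: Fnd; lra.
    nra.
  have e1 := posfun_norm_le pl1 bfg bH fgH.
  have e2 := posfun_norm_le pl2 bfg bH fgH.
  rewrite (posfunB pl1 bf bg) in e1; rewrite (posfunB pl2 bf bg) in e2.
  have := lH _ pl1 F1; have := lH _ pl2 F2.
  have F01 x : 0 <= F x <= 1.
    have h1 := F1 x ltr01; have h2 := F1 (x - 1) ltr01; rewrite subrK in h2.
    apply/andP; split.
      move: h2 => /andP[_]; apply: le_trans.
      rewrite -[leLHS](posfun_cst pl1); apply: (posfun_le pl1) => //.
        exact: blip_cst.
        exact: blip_ramp.
      by move=> y; have /andP[] := ramp_itv (x - 1) 1 y.
    move: h1 => /andP[+ _] => /le_trans; apply.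
    rewrite -[leRHS](posfun_cst pl1); apply: (posfun_le pl1) => //.
      exact: blip_ramp.
      exact: blip_cst.
    by move=> y; have /andP[] := ramp_itv x 1 y.
  have gd' : `|l1 g - l2 g| <= e.
    apply: le_trans gd _.
    have /andP[] := F01 (x0 + N%:R * h); have /andP[] := F01 (x0 + 0%:R * h).
    have := mulr_ge0 L0 (ltW h0); nra.
  move=> k1 k2.
  have -> : l1 f - l2 f = (l1 f - l1 g) + (l1 g - l2 g) - (l2 f - l2 g) by ring.
  apply: le_trans (ler_normB _ _) _.
  apply: (@le_trans _ _ (`|l1 f - l1 g| + `|l1 g - l2 g| + `|l2 f - l2 g|)).
    by rewrite lerD2r ler_normD.
  lra.
apply/eqP; rewrite -subr_eq0 -normr_le0; apply/ler_addgt0Pl => e e0.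
have p : 0 < 5 + 8 * M by lra.
by have := key _ (divr_gt0 e0 p); rewrite mulrCA divff ?gt_eqF// mulr1 => h; lra.
Qed.

End uniqueness.
End positive_functionals.

(** * Construction of the limit law *)

Section limit_law.
Context {R : realType} {d} {Omega : measurableType d} (P : probability Omega R).
Variables (Y : nat -> Omega -> R) (C : R).
Hypothesis mY : forall n, measurable_fun setT (Y n).
Hypothesis EY : \forall n \near \oo, L1 P (Y n) /\ Ex P (fun w => `|Y n w|) <= C.
Hypothesis cY : forall f, blip f -> cvgn (fun n => Ex P (f \o Y n)).

Let l (f : R -> R) : R := limn (fun n => Ex P (f \o Y n)).

Let l_cvg f : blip f -> Ex P (f \o Y n) @[n --> \oo] --> l f.
Proof. by move=> bf; exact: cY. Qed.

Let posl : posfun l.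
Proof.
split.
- move=> f g bf bg; apply: cvg_lim => //.
  have -> : (fun n => Ex P ((fun x => f x + g x) \o Y n)) =
    (fun n => Ex P (f \o Y n) + Ex P (g \o Y n)).
    by apply/funext => n; rewrite -ExD//; exact: L1_blip.
  by apply: cvgD; exact: l_cvg.
- move=> c f bf; apply: cvg_lim => //.
  have -> : (fun n => Ex P ((fun x => c * f x) \o Y n)) =
    (fun n => c * Ex P (f \o Y n)).
    by apply/funext => n; rewrite -ExZ//; exact: L1_blip.
  by apply: cvgMr; exact: l_cvg.
- move=> f g bf bg fg; apply: ler_lim; [exact: cY|exact: cY|].
  by apply: nearW => n; apply: Ex_le; [exact: L1_blip|exact: L1_blip|move=> w; exact: fg].
- move=> c; apply: cvg_lim => //.
  have -> : (fun n => Ex P ((fun=> c) \o Y n)) = fun=> c.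
    by apply/funext => n; rewrite -[RHS](Ex_cst P).
  exact: cvg_cst.
Qed.

(** The limit functional at the indicator of []-oo, x]], reached from above, which is what makes [F]
    right-continuous. *)
Let F (x : R) : R := inf [set l (ramp x e) | e in [set e | 0 < e]].

Let l_ramp0 x e : 0 < e -> 0 <= l (ramp x e).
Proof.
move=> e0; rewrite -[leLHS](posfun_cst posl); apply: (posfun_le posl) => //.
- exact: blip_cst.
- exact: blip_ramp.
- by move=> y; have /andP[] := ramp_itv x e y.
Qed.

Let F_le x e : 0 < e -> F x <= l (ramp x e).
Proof.
move=> e0; apply: ge_inf; last by exists e.
by exists 0 => _ [e' /= e'0 <-]; exact: l_ramp0.
Qed.

Let le_F x c : (forall e, 0 < e -> c <= l (ramp x e)) -> c <= F x.
Proof.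
move=> h; apply: lb_le_inf; first by exists (l (ramp x 1)); exists 1 => /=.
by move=> _ [e /= e0 <-]; exact: h.
Qed.

Let F_ramp x e : 0 < e -> F x <= l (ramp x e) <= F (x + e).
Proof.
move=> e0; rewrite F_le//=; apply: le_F => e' e'0.
apply: (posfun_le posl); [exact: blip_ramp|exact: blip_ramp|move=> y].
have /andP[h1 h2] := ramp_itv x e y; have /andP[h3 h4] := ramp_itv (x + e) e' y.
case: (leP y (x + e)) => h; first by rewrite (ramp_left e'0 h).
by rewrite (ramp_right e0 (ltW h)).
Qed.

Let Fnd : nondecreasing F.
Proof.
move=> x y xy; apply: le_F => e e0; apply: le_trans (F_le x e0) _.
apply: (posfun_le posl); [exact: blip_ramp|exact: blip_ramp|move=> z].
have /andP[h1 h2] := ramp_itv x e z; have /andP[h3 h4] := ramp_itv y e z.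
case: (leP z y) => h; first by rewrite (ramp_left e0 h).
rewrite /ramp; have : (z - y) / e <= (z - x) / e by rewrite ler_wpM2r ?invr_ge0 ?(ltW e0)//; lra.
rewrite /Num.max /Num.min; repeat case: ifP; move=> *; lra.
Qed.

Let F0 x : 0 <= F x. Proof. by apply: le_F => e e0; exact: l_ramp0. Qed.

Let F1 x : F x <= 1.
Proof.
apply: le_trans (F_le x ltr01) _; rewrite -[leRHS](posfun_cst posl).
apply: (posfun_le posl); [exact: blip_ramp|exact: blip_cst|move=> y].
by have /andP[] := ramp_itv x 1 y.
Qed.

Let Frc : right_continuous F.
Proof.
move=> x; apply/cvgrPdist_le => e e0.
have [_ [a /= a0 <-] ha] : exists2 z, [set l (ramp x e) | e in [set e | 0 < e]] z &
    z < F x + e / 2.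
  apply: inf_adherent; first by rewrite divr_gt0.
  split; first by exists (l (ramp x 1)); exists 1 => /=.
  by exists 0 => _ [e' /= e'0 <-]; exact: l_ramp0.
near=> y.
have xy : x <= y by near: y; exact: nbhs_right_ge.
have yx : y <= x + a * (e / 2).
  by near: y; apply: nbhs_right_le; rewrite ltrDl mulr_gt0// divr_gt0.
rewrite distrC ger0_norm ?subr_ge0; last exact: Fnd.
rewrite lerBlDr; apply: le_trans (F_le y a0) _.
have : l (ramp y a) <= l (fun z => ramp x a z + e / 2).
  have b := blip_ramp x a0.
  apply: (posfun_le posl); [exact: blip_ramp|by apply: blipD => //; exact: blip_cst|].
  move=> z; have := ramp_lip y x z z a0; rewrite subrr normr0 add0r (ger0_norm (x := y - x)) ?subr_ge0//.
  rewrite ler_norml => /andP[_ h1].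
  have : a^-1 * (y - x) <= e / 2 by rewrite ler_pdivrMl//; lra.
  lra.
rewrite (posfunD posl (blip_ramp x a0) (blip_cst _)) (posfun_cst posl).
move=> h; apply: (le_trans h); rewrite -lerBrDr; apply: ltW; apply: (lt_le_trans ha).
by rewrite lerBrDr -addrA -splitr addrC.
Unshelve. all: by end_near. Qed.

Let C0 : 0 <= C.
Proof.
have [n _ /(_ n (leqnn n)) [_ h]] := EY.
by apply: le_trans h; apply: Ex_ge0.
Qed.

(** Tightness: Markov's inequality with the uniform bound [C], passed to the limit. *)
Let l_tail (f : R -> R) A : 0 < A -> blip f -> (forall y, f y <= `|y| / A) ->
  l f <= C / A.
Proof.
move=> A0 bf fA; apply: limr_le; first exact: cY.
apply: filterS EY => n [iY eY].
apply: (@le_trans _ _ (Ex P (fun w => A^-1 * `|Y n w|))).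
  apply: Ex_le; [exact: L1_blip|by apply: L1Z; exact: L1_abs|].
  by move=> w; rewrite mulrC; exact: fA.
by rewrite (ExZ _ (L1_abs iY)) mulrC ler_wpM2r// invr_ge0 ltW.
Qed.

Let F_Ny A : 0 < A -> F (- A - 1) <= C / A.
Proof.
move=> A0; apply: le_trans (F_le _ ltr01) _; apply: l_tail => //.
  exact: blip_ramp.
move=> y; have /andP[h1 h2] := ramp_itv (- A - 1) 1 y.
case: (leP (- A) y) => h.
  by rewrite ramp_right// ?subrK// divr_ge0// ltW.
apply: (le_trans h2); rewrite ler_pdivlMr// mul1r ler0_norm; first by rewrite lerNr ltW.
by apply: (le_trans (ltW h)); rewrite oppr_le0 ltW.
Qed.

Let F_y A : 0 < A -> 1 - C / A <= F (A + 1).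
Proof.
move=> A0; have /andP[_ h] := F_ramp A ltr01; apply: le_trans h.
have b := blip_ramp A (@ltr01 R).
have : l (fun y => 1 - ramp A 1 y) <= C / A.
  apply: l_tail => //; first by apply: blipB => //; exact: blip_cst.
  move=> y; have /andP[h1 h2] := ramp_itv A 1 y.
  case: (leP y A) => h; first by rewrite ramp_left// subrr divr_ge0// ltW.
  apply: (@le_trans _ _ 1); first by rewrite gerBl.
  by rewrite ler_pdivlMr// mul1r (le_trans (ltW h))// ler_norm.
rewrite (posfunB posl (blip_cst 1) b) (posfun_cst posl); lra.
Qed.

Let A_of e : 0 < e -> C / ((C + 1) / e) <= e.
Proof.
by move=> e0; rewrite invf_div mulrA ler_pdivrMr ?ltr_wpDl// mulrC; have := C0; nra.
Qed.

Let Apos e : 0 < e -> 0 < (C + 1) / e.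
Proof. by move=> e0; rewrite divr_gt0// ltr_wpDl. Qed.

Let F_cvgNy : F @ -oo --> (0 : R).
Proof.
apply/cvgrPdist_le => e e0; near=> x.
rewrite sub0r normrN ger0_norm//; apply: le_trans (A_of e0).
apply: le_trans (F_Ny (Apos e0)); apply: Fnd.
by near: x; apply: nbhs_ninfty_le; exact: num_real.
Unshelve. all: by end_near. Qed.

Let F_cvgy : F @ +oo --> (1 : R).
Proof.
apply/cvgrPdist_le => e e0; near=> x.
rewrite ger0_norm ?subr_ge0//.
have : F ((C + 1) / e + 1) <= F x.
  by apply: Fnd; near: x; apply: nbhs_pinfty_ge; exact: num_real.
move=> h; rewrite lerBlDl -lerBlDr; apply: le_trans h; apply: le_trans (F_y (Apos e0)).
by rewrite lerD2l lerN2; exact: A_of.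
Unshelve. all: by end_near. Qed.

HB.instance Definition _ := isCumulative.Build R _ R F Fnd Frc.
HB.instance Definition _ := isCumulativeBounded.Build R 0 1 F F_cvgNy F_cvgy.

Let F' : cumulativeBounded (0:R) (1:R) := F.

(** The Stieltjes measure lives on [measurableTypeR R]; its image under the identity is a law on
    [R]. *)
Let idTR : measurableTypeR R -> R := idfun.

#[local] HB.instance Definition _ :=
  @isMeasurableFun.Build _ _ _ _ idTR (@measurable_id _ _ setT).

(** The Stieltjes measure of [F] and the limit functional are enclosed on ramps by the same bounds,
    so [posfun_unique] identifies them. *)
Lemma limit_law : exists L : probability R R,
  forall f, blip f -> Ex P (f \o Y n) @[n --> \oo] --> Ex L f.
Proof.
pose lsf : probability (measurableTypeR R) R := lebesgue_stieltjes_measure F'.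
pose L : probability R R := distribution lsf (idTR : {RV lsf >-> R}).
have LF x : L `]-oo, x]%classic = (F x)%:E by exact: (cdf_lebesgue_stieltjes_id F').
exists L => f bf; suff <- : l f = Ex L f by exact: l_cvg.
have L1L f' : blip f' -> L1 L f'.
  by move=> bf'; exact: (L1_blip L bf' (@measurable_id _ _ setT)).
have posL : posfun (Ex L).
  split.
  - by move=> f' g bf' bg; rewrite ExD//; exact: L1L.
  - by move=> c f' bf'; rewrite ExZ//; exact: L1L.
  - by move=> f' g bf' bg h; apply: Ex_le => //; exact: L1L.
  - by move=> c; rewrite Ex_cst.
apply: (posfun_unique posl posL F_ramp) => //.
- move=> x e e0.
  have mi y : measurable_fun setT (\1_`]-oo, y]%classic : R -> R).
    by apply: measurable_indic; exact: measurable_itv.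
  have iL y : L1 L (\1_`]-oo, y]%classic : R -> R).
    apply: (@L1_bounded _ _ _ _ _ 1) => // z.
    by rewrite indicE; case: (_ \in _); rewrite ?normr1 ?normr0.
  have FE y : F y = Ex L (\1_`]-oo, y]%classic : R -> R).
    rewrite /Ex /Rintegral integral_indic//; try exact: measurable_itv.
    by rewrite setIT; exact: (esym (congr1 fine (LF y))).
  rewrite !FE; apply/andP; split; apply: Ex_le => //; try exact/L1L/blip_ramp.
    move=> y; rewrite indicE; have /andP[r0 r1] := ramp_itv x e y.
    case: (boolP (_ \in _)) => // /set_mem /=; rewrite in_itv /= => h.
    by rewrite ramp_left.
  move=> y; rewrite indicE; have /andP[r0 r1] := ramp_itv x e y.
  case: (boolP (_ \in _)) => //; rewrite notin_setE /= in_itv /= => /negP.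
  by rewrite -ltNge => /ltW h; rewrite ramp_right.
- move=> e e0; exists (- ((C + 1) / e) - 1).
  by apply: le_trans (A_of e0); exact: F_Ny (Apos e0).
- move=> e e0; exists ((C + 1) / e + 1).
  by apply: le_trans (F_y (Apos e0)); rewrite lerD2l lerN2; exact: A_of.
Qed.

End limit_law.

(** * Smoothing by averaging *)

Section antiderivative.
Context {R : realType}.
Notation mu := (@lebesgue_measure R).
Variable g : R -> R.
Hypothesis gc : continuous g.

Let gi a b : mu.-integrable `[a, b] (EFin \o g).
Proof.
apply: continuous_compact_integrable; first exact: segment_compact.
by apply: continuous_subspaceT => x; exact: gc.
Qed.

Let I (N x : R) : R := \int[mu]_(t in `[- N, x]) g t - \int[mu]_(t in `[- N, 0]) g t.

Let I_indep M N x : 0 < N -> N <= M -> - N < x -> I M x = I N x.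
Proof.
move=> N0 NM Nx.
have H y : - N < y -> \int[mu]_(t in `[- M, y]) g t =
  \int[mu]_(t in `[- M, - N]) g t + \int[mu]_(t in `[- N, y]) g t.
  move=> Ny.
  have := @Rintegral_itvB R g (BLeft (- M)) (BRight y) (- N) (gi _ _).
  rewrite !bnd_simp lerN2 => /(_ NM (ltW Ny)).
  rewrite [X in _ = X]Rintegral_itv_obnd_cbnd; last first.
    apply: integrableS (gi (- N) y) => //.
    by apply: subset_itvr; rewrite bnd_simp.
  by move=> <-; ring.
by rewrite /I (H x)// (H 0) ?oppr_lt0//; ring.
Qed.

(** The oriented integral of [g] from 0 to [x]. The base point moves with [x] so as to stay on its
    left and on the left of 0; by [I_indep] it does not affect the value. *)
Definition antiderivative (x : R) : R := I (`|x| + 1) x.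

Lemma antiderivativeP (x : R) : is_derive x (1 : R) antiderivative (g x).
Proof.
(* A base point valid for all [y] within distance 1 of [x]. *)
pose M : R := `|x| + 2.
have Mx : - M < x.
  by rewrite ltrNl /M -normrN (le_lt_trans (ler_norm _))// ltrDl.
have [D1 D2] := @continuous_FTC1_closed R g (- M) x (x + 1) (ltr_pwDr ltr01 (lexx x))
  (gi _ _) Mx (@gc x).
have D : is_derive x (1 : R) (I M) (g x).
  rewrite -D2 derive1E -[X in is_derive _ _ _ X]subr0; apply: is_deriveB.
  exact/derivableP.
apply: near_eq_is_derive D; near=> y.
have yx : `|y - x| < 1.
  near: y; apply/nbhs_ballP; exists 1 => //= z; by rewrite /ball /= distrC.
rewrite /antiderivative; apply: I_indep.
- by rewrite ltr_wpDl.
- have -> : M = (`|x| + 1) + 1 by rewrite /M; ring.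
  rewrite lerD2r -[y](subrK x); apply: le_trans (ler_normD _ _) _.
  by rewrite addrC lerD2l ltW.
- by rewrite ltrNl -normrN (le_lt_trans (ler_norm _))// ltrDl.
Unshelve. all: by end_near. Qed.
End antiderivative.

Section smoothing.
Context {R : realType}.
Implicit Types f g : R -> R.

Lemma ler_distB (x y x' y' e : R) : `|x - y| <= e -> `|x' - y'| <= e ->
  `|x - x' - (y - y')| <= 2 * e.
Proof.
move=> h h'; rewrite (_ : x - x' - (y - y') = (x - y) - (x' - y')); last by ring.
by apply: (le_trans (ler_normB _ _)); rewrite (_ : 2 * e = e + e) ?lerD//; ring.
Qed.

Lemma derive_shift f (f' : R -> R) (a : R) (x : R) :
  is_derive (x + a) (1 : R) f (f' (x + a)) ->
  is_derive x (1 : R) (fun y => f (y + a)) (f' (x + a)).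
Proof.
move=> H; rewrite -[X in is_derive _ _ _ X]mulr1.
have H2 : is_derive x (1 : R) (fun y : R => y + a) 1.
  exact: is_derive_shift.
exact: (@is_derive1_comp _ f (fun y => y + a) x _ _ H H2).
Qed.

Lemma derive_continuous f (f' : R -> R) :
  (forall x : R, is_derive x (1 : R) f (f' x)) -> continuous f.
Proof.
move=> H x; apply/differentiable_continuous/derivable1_diffP.
by have [] := H x.
Qed.

Lemma mvt f (f' : R -> R) (x y : R) :
  (forall x : R, is_derive x (1 : R) f (f' x)) ->
  exists2 c, `|c - x| <= `|y| & f (x + y) - f x = f' c * y.
Proof.
move=> H; have fc := derive_continuous H.
case: (ltgtP 0 y) => [y0|y0|<-].
- have xy : x < x + y by rewrite ltrDl.
  have [c cI ->] := MVT xy (fun z _ => H z) (continuous_subspaceT fc).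
  move: cI; rewrite in_itv /= => /andP[h1 h2]; exists c; last by congr (_ * _); ring.
  by rewrite !ger0_norm ?subr_ge0 ?(ltW h1) ?(ltW y0)//; lra.
- have xy : x + y < x by rewrite gtrDl.
  have [c cI E] := MVT xy (fun z _ => H z) (continuous_subspaceT fc).
  move: cI; rewrite in_itv /= => /andP[h1 h2]; exists c.
    by rewrite !ler0_norm ?subr_le0 ?(ltW h2) ?(ltW y0)//; lra.
  by rewrite -opprB E; ring.
- by exists x; rewrite ?addr0 ?subrr ?mulr0// normr0.
Qed.

Definition lip1 (L : R) g := forall x y, `|g x - g y| <= L * `|x - y|.

Lemma lip1_continuous L g : lip1 L g -> continuous g.
Proof.
move=> gL x; apply/cvgrPdist_le => e e0.
have L1 : 0 < `|L| + 1 by rewrite ltr_wpDl.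
apply/nbhs_ballP; exists (e / (`|L| + 1)) => /=; first by rewrite divr_gt0.
move=> y; rewrite /ball /= ltr_pdivlMr// => h.
apply: le_trans (gL _ _) _; apply: le_trans (ltW h).
by rewrite mulrC ler_wpM2l// (le_trans (ler_norm L))// lerDl.
Qed.

Lemma lip1_cst c : lip1 0 (fun=> c).
Proof. by move=> x y; rewrite subrr normr0 mul0r. Qed.

(** The mean of [g] over [[x, x + a]], in a form whose derivative is immediate. *)
Definition avg (a : R) g (x : R) : R :=
  (antiderivative g (x + a) - antiderivative g x) / a.

Variable a : R.
Hypothesis a0 : 0 < a.

(** By the mean value theorem for the difference of the two antiderivatives, the difference of the
    means equals that of the functions at one common shift. *)
Lemma avg_cmp g g' x x' K : continuous g -> continuous g' ->
  (forall u, 0 <= u <= a -> `|g (x + u) - g' (x' + u)| <= K) ->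
  `|avg a g x - avg a g' x'| <= K.
Proof.
move=> gc g'c H.
pose D u := antiderivative g (u + x) - antiderivative g' (u + x').
have D' (u : R) : is_derive u (1 : R) D (g (u + x) - g' (u + x')).
  by apply: is_deriveB; apply: (derive_shift (f' := fun z => _)); exact: antiderivativeP.
have [c cI E] := MVT a0 (fun z _ => D' z) (continuous_subspaceT (derive_continuous D')).
have -> : avg a g x - avg a g' x' = g (c + x) - g' (c + x').
  apply: (mulIf (lt0r_neq0 a0)); rewrite /avg mulrBl !divfK ?gt_eqF//.
  by rewrite -[in RHS](subr0 a) -E /D !add0r (addrC a) (addrC a); ring.
rewrite (addrC c) (addrC c); apply: H.
by move: cI; rewrite in_itv /= => /andP[/ltW -> /ltW ->].
Qed.

Lemma avg_lip L g : lip1 L g -> lip1 L (avg a g).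
Proof.
move=> gL x y; have gc := lip1_continuous gL.
apply: avg_cmp => // u _; apply: le_trans (gL _ _) _.
by rewrite (_ : x + u - (y + u) = x - y)//; ring.
Qed.

Lemma avg_cst c x : avg a (fun=> c) x = c.
Proof.
have H := antiderivativeP (lip1_continuous (lip1_cst c)).
have [c' _ E] := mvt x a H.
by rewrite /avg E mulfK// gt_eqF.
Qed.

Lemma avg_close L g x : lip1 L g -> `|avg a g x - g x| <= L * a.
Proof.
move=> gL; rewrite -[X in _ - X](avg_cst (g x) x).
apply: avg_cmp; [exact: lip1_continuous gL|exact: lip1_continuous (lip1_cst _)|].
move=> u /andP[u0 ua]; apply: le_trans (gL _ _) _.
have L0 : 0 <= L.
  by have := gL 1 0; rewrite subr0 normr1 mulr1; exact: le_trans.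
by rewrite addrC addKr ger0_norm// ler_wpM2l.
Qed.

Lemma avg_derive g (x : R) : continuous g ->
  is_derive x (1 : R) (avg a g) ((g (x + a) - g x) / a).
Proof.
move=> gc; rewrite [X in is_derive _ _ _ X]mulrC.
have -> : avg a g = a^-1 \*: (fun y => antiderivative g (y + a) - antiderivative g y).
  by apply/funext => y; rewrite /avg mulrC.
apply: is_deriveZ; apply: is_deriveB; last exact: antiderivativeP.
by apply: (derive_shift (f' := g)); exact: antiderivativeP.
Qed.

(** Two uses of the mean value theorem; the constant [K] instead of [K / 6] is harmless. *)
Lemma taylor2 (G g1 g2 : R -> R) K x y : 0 <= K ->
  (forall x : R, is_derive x (1 : R) G (g1 x)) ->
  (forall x : R, is_derive x (1 : R) g1 (g2 x)) -> lip1 K g2 ->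
  `|G (x + y) - G x - y * g1 x - y ^+ 2 / 2 * g2 x| <= K * `|y| ^+ 3.
Proof.
move=> K0 dG dg1 g2K.
pose r z := G (z + x) - (z * g1 x + z ^+ 2 * (g2 x / 2)).
have dr (z : R) : is_derive z (1 : R) r (g1 (z + x) - (g1 x + z * g2 x)).
  rewrite /r; apply: is_deriveB; first exact: (derive_shift (f' := g1)).
  have h1 : is_derive z (1 : R) (fun z => z * g1 x) (g1 x).
    have -> : (fun z => z * g1 x) = g1 x \*: id by apply/funext => u /=; rewrite mulrC.
    by rewrite -[X in is_derive _ _ _ X]mulr1; exact: is_deriveZ.
  have h2 : is_derive z (1 : R) (fun z => z ^+ 2 * (g2 x / 2)) (z * g2 x).
    have -> : (fun z => z ^+ 2 * (g2 x / 2)) = (g2 x / 2) \*: ((id : R -> R) * (id : R -> R)).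
      by apply/funext => u /=; rewrite mulrC.
    have hM := is_deriveM (is_derive_id z (1 : R)) (is_derive_id z (1 : R)).
    have := is_deriveZ (g2 x / 2) hM.
    by move=> H; apply: (is_derive_eq H); rewrite /GRing.scale /=; field.
  exact: is_deriveD.
have [c ch E] := mvt 0 y dr.
have [c' ch' E'] := mvt x c dg1.
have -> : G (x + y) - G x - y * g1 x - y ^+ 2 / 2 * g2 x = r (0 + y) - r 0.
  by rewrite /r !add0r (addrC y); field.
rewrite E.
have -> : g1 (c + x) - (g1 x + c * g2 x) = (g2 c' - g2 x) * c.
  by rewrite mulrBl -E' (addrC c); ring.
rewrite subr0 in ch.
have h : `|g2 c' - g2 x| <= K * `|y|.
  by apply: le_trans (g2K _ _) _; rewrite ler_wpM2l// (le_trans ch').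
rewrite !normrM (_ : K * `|y| ^+ 3 = K * `|y| * `|y| * `|y|); last by ring.
by rewrite ler_wpM2r// ler_pM.
Qed.

Definition avg_d1 g x := (avg a g (x + a) - avg a g x) / a.
Definition avg_d2 g x :=
  ((g (x + a + a) - g (x + a)) / a - (g (x + a) - g x) / a) / a.

(** Each averaging gains one derivative. The second derivative is a second difference of [g], with
    coefficients 1, -2, 1, whence the factor 4. *)
Lemma smooth_avg L g : 0 <= L -> lip1 L g ->
  (lip1 (4 * L / a ^+ 2) (avg_d2 g)) /\
  (forall x y, `|avg a (avg a g) (x + y) - avg a (avg a g) x - y * avg_d1 g x
      - y ^+ 2 / 2 * avg_d2 g x| <= 4 * L / a ^+ 2 * `|y| ^+ 3).
Proof.
move=> L0 gL; set g1 := avg_d1 g; set g2 := avg_d2 g.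
have gc := lip1_continuous gL; have gc' := lip1_continuous (avg_lip gL).
have g2L : lip1 (4 * L / a ^+ 2) g2.
  move=> x y.
  have -> : g2 x - g2 y = ((g (x + a + a) - g (y + a + a)) - (g (x + a) - g (y + a)) -
     (g (x + a) - g (y + a)) + (g x - g y)) / a ^+ 2.
    by rewrite /g2 /avg_d2; field; rewrite gt_eqF.
  rewrite normrM (gtr0_norm (_ : 0 < (a ^+ 2)^-1)) ?invr_gt0 ?exprn_gt0//.
  rewrite [leRHS](_ : _ = 4 * L * `|x - y| / a ^+ 2); last by ring.
  apply: ler_wpM2r.
    by rewrite invr_ge0 exprn_ge0// ltW.
  have h1 := gL (x + a + a) (y + a + a); have h2 := gL (x + a) (y + a).
  have h3 := gL x y.
  rewrite (_ : x + a + a - (y + a + a) = x - y) in h1; last by ring.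
  rewrite (_ : x + a - (y + a) = x - y) in h2; last by ring.
  move: h1 h2 h3; rewrite !ler_norml => /andP[? ?] /andP[? ?] /andP[? ?].
  by apply/andP; split; lra.
split=> // x y; apply: taylor2 => //.
- by rewrite divr_ge0 ?exprn_ge0 ?(ltW a0)// mulr_ge0.
- by move=> z; exact: avg_derive.
- move=> z; rewrite /g1 /g2 /avg_d1 /avg_d2 [X in is_derive _ _ _ X]mulrC.
  have -> : (fun x => (avg a g (x + a) - avg a g x) / a) =
     a^-1 \*: (fun x => avg a g (x + a) - avg a g x).
    by apply/funext => u; rewrite /= mulrC.
  apply: is_deriveZ; apply: is_deriveB; last exact: avg_derive.
  by apply: (derive_shift (f' := fun z => (g (z + a) - g z) / a)); exact: avg_derive.
Qed.

End smoothing.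

(** * Rademacher averages and Lindeberg replacement *)

Section sequences_aux.
Context {R : realType}.

Lemma cauchy_seq_cvg (u : nat -> R) :
  (forall e, 0 < e -> exists N, forall n m, (N <= n)%N -> (N <= m)%N ->
     `|u n - u m| <= e) -> cvgn u.
Proof.
move=> H; apply/cauchy_cvgP; apply: cauchy_exP => e e0.
have [N HN] := H (e / 2) (divr_gt0 e0 (ltr0Sn _ 1)).
exists (u N); exists N => // n /= Nn; rewrite /ball /=.
apply: le_lt_trans (HN _ _ (leqnn N) Nn) _.
by rewrite ltr_pdivrMr// ltr_pMr// ltr1n.
Qed.

Lemma limn_dist_le (u : nat -> R) (l e : R) N : cvgn u ->
  (forall n, (N <= n)%N -> `|u n - l| <= e) -> `|limn u - l| <= e.
Proof.
move=> cu H; rewrite ler_norml; apply/andP; split.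
  rewrite lerBrDr; apply: limr_ge => //; exists N => // n /= Nn.
  by have := H n Nn; rewrite ler_norml => /andP[? _]; lra.
rewrite lerBlDr; apply: limr_le => //; exists N => // n /= Nn.
by have := H n Nn; rewrite ler_norml => /andP[_ ?]; lra.
Qed.

End sequences_aux.

Section rademacher_average.
Context {R : realType}.
Implicit Types g : R -> R.

(* The expectation of g after one fair step +h or -h. *)
Definition rop (h : R) g (x : R) : R := (g (x + h) + g (x - h)) / 2.

(** [g1] and [g2] play the first two derivatives. Keeping only the estimate makes the notion stable
    under [rop] by mere averaging. *)
Definition taylor (K : R) g g1 g2 : Prop := lip1 K g2 /\
  forall x y, `|g (x + y) - g x - y * g1 x - y ^+ 2 / 2 * g2 x| <= K * `|y| ^+ 3.

Lemma rop_dist h g g' e x x' : (forall u, `|g (x + u) - g' (x' + u)| <= e) ->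
  `|rop h g x - rop h g' x'| <= e.
Proof.
move=> H; rewrite /rop; have := H h; have := H (- h).
rewrite !ler_norml => /andP[? ?] /andP[? ?]; apply/andP; split; lra.
Qed.

Lemma iter_rop_dist h n g g' e : (forall x, `|g x - g' x| <= e) ->
  forall x, `|iter n (rop h) g x - iter n (rop h) g' x| <= e.
Proof.
by move=> H; elim: n => //= n IH x; apply: rop_dist => u; exact: IH.
Qed.

Lemma rop_lip h L g : lip1 L g -> lip1 L (rop h g).
Proof.
move=> gL x y; apply: rop_dist => u; apply: le_trans (gL _ _) _.
by rewrite (_ : x + u - (y + u) = x - y)//; ring.
Qed.

Lemma taylor_rop h K g g1 g2 : taylor K g g1 g2 ->
  taylor K (rop h g) (rop h g1) (rop h g2).
Proof.
move=> [g2K H]; split; first exact: rop_lip.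
move=> x y; rewrite /rop.
have h1 := H (x + h) y; have h2 := H (x - h) y.
rewrite (addrAC x h) in h1; rewrite (addrAC x (- h)) in h2.
set k := K * _ in h1 h2 *.
set a := g (x + y + h) in h1 *; set b := g (x + y - h) in h2 *.
set q := y ^+ 2 / 2 in h1 h2 *.
have -> : (a + b) / 2 - (g (x + h) + g (x - h)) / 2 - y * ((g1 (x + h) + g1 (x - h)) / 2) -
  q * ((g2 (x + h) + g2 (x - h)) / 2) =
  ((a - g (x + h) - y * g1 (x + h) - q * g2 (x + h)) +
   (b - g (x - h) - y * g1 (x - h) - q * g2 (x - h))) / 2 by ring.
move: h1 h2; rewrite !ler_norml => /andP[? ?] /andP[? ?]; apply/andP; split; lra.
Qed.

Lemma iter_taylor h n K g g1 g2 : taylor K g g1 g2 ->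
  taylor K (iter n (rop h) g) (iter n (rop h) g1) (iter n (rop h) g2).
Proof. by move=> H; elim: n => //= n; exact: taylor_rop. Qed.

Lemma rop_taylor h K g g1 g2 x : 0 < h -> taylor K g g1 g2 ->
  `|rop h g x - g x - h ^+ 2 / 2 * g2 x| <= K * h ^+ 3.
Proof.
move=> h0 [_ H]; have h1 := H x h; have h2 := H x (- h).
rewrite normrN sqrrN in h2; rewrite (gtr0_norm h0) in h1 h2.
rewrite /rop; set k := K * _ in h1 h2 *; set q := h ^+ 2 / 2 in h1 h2 *.
set qg := q * _ in h1 h2 *; rewrite mulNr in h2; set hg := h * _ in h1 h2.
move: h1 h2; rewrite !ler_norml => /andP[? ?] /andP[? ?]; apply/andP; split; lra.
Qed.

(** Each fair step adds [h ^+ 2] to the mean squared distance from [x0]. *)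
Lemma iter_rop_quadratic h n g c x0 u v : 0 <= u ->
  (forall y, `|g y - c| <= u * (y - x0) ^+ 2 + v) ->
  forall y, `|iter n (rop h) g y - c| <= u * ((y - x0) ^+ 2 + n%:R * h ^+ 2) + v.
Proof.
move=> u0 H; elim: n => [|n IH] y /=; first by rewrite mul0r addr0.
have h1 := IH (y + h); have h2 := IH (y - h); rewrite /rop.
have E : u * ((y - x0) ^+ 2 + n.+1%:R * h ^+ 2) + v =
  ((u * ((y + h - x0) ^+ 2 + n%:R * h ^+ 2) + v) +
   (u * ((y - h - x0) ^+ 2 + n%:R * h ^+ 2) + v)) / 2.
  by rewrite -(natr1 n); field.
move: h1 h2; rewrite E; set A := _ + v; set B := _ + v.
rewrite !ler_norml => /andP[? ?] /andP[? ?]; apply/andP; split; lra.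
Qed.

Lemma iter_rop_close h n L g a x : 0 <= L -> 0 < a -> n%:R * h ^+ 2 <= a ^+ 2 ->
  lip1 L g -> `|iter n (rop h) g x - g x| <= L * a.
Proof.
move=> L0 a0 na gL.
(* The distance is traded for its square by [2 a t <= t ^+ 2 + a ^+ 2], since only second moments of
   the walk are explicit. *)
have H y : `|g y - g x| <= L / (2 * a) * (y - x) ^+ 2 + L * a / 2.
  apply: le_trans (gL _ _) _.
  rewrite [leRHS](_ : _ = L * ((y - x) ^+ 2 / (2 * a) + a / 2)); last first.
    by field; rewrite gt_eqF.
  rewrite ler_wpM2l// -(real_normK (num_real (y - x))).
  set t := `|y - x|.
  rewrite [leRHS](_ : _ = (t ^+ 2 + a ^+ 2) / (2 * a)); last first.
    by field; rewrite gt_eqF.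
  rewrite ler_pdivlMr ?mulr_gt0//; have := sqr_ge0 (t - a); nra.
have Lu : 0 <= L / (2 * a) by rewrite divr_ge0// mulr_ge0// ltW.
apply: le_trans (iter_rop_quadratic h n Lu H x) _.
rewrite subrr expr0n add0r.
rewrite [leRHS](_ : _ = L / (2 * a) * a ^+ 2 + L * a / 2); last first.
  by field; rewrite gt_eqF.
by rewrite lerD2r ler_wpM2l.
Qed.

(** The [k] small steps have the variance of the large one, so the second-order terms of the two
    expansions coincide and only third-order errors remain. *)
Lemma rop_split h h' k K g g1 g2 x : 0 <= K -> 0 < h -> 0 < h' -> h' <= h ->
  k%:R * h' ^+ 2 = h ^+ 2 -> taylor K g g1 g2 ->
  `|rop h g x - iter k (rop h') g x| <= 3 * K * h ^+ 3.
Proof.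
move=> K0 h0 h'0 hh' kh T.
have key i : (i <= k)%N ->
  `|iter i (rop h') g x - g x - i%:R * (h' ^+ 2 / 2 * g2 x)| <=
  i%:R * h' ^+ 2 * (3 / 2 * K * h).
  elim: i => [|i IH] ik /=; first by rewrite !mul0r !subr0 subrr normr0.
  have h1 := rop_taylor x h'0 (iter_taylor h' i T).
  have h2 : `|iter i (rop h') g2 x - g2 x| <= K * h.
    apply: iter_rop_close => //; last by case: T.
    by rewrite -kh ler_wpM2r ?sqr_ge0// ler_nat ltnW.
  have h3 : `|h' ^+ 2 / 2 * iter i (rop h') g2 x - h' ^+ 2 / 2 * g2 x| <=
     h' ^+ 2 / 2 * (K * h).
    have p : 0 <= h' ^+ 2 / 2 by rewrite divr_ge0// sqr_ge0.
    by rewrite -mulrBr normrM ger0_norm// ler_wpM2l.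
  have h4 : K * h' ^+ 3 <= h' ^+ 2 * (K * h).
    by rewrite exprS mulrA mulrC ler_wpM2l ?sqr_ge0// ler_wpM2l.
  have := IH (ltnW ik); move: h1 h3.
  rewrite -(natr1 i); set A := rop _ _ _; set B := iter _ _ _ _; set D := _ / 2 * iter _ _ _ _.
  set E := _ * g2 x; set X := K * h' ^+ 3 in h4 *.
  rewrite !ler_norml => /andP[? ?] /andP[? ?] /andP[? ?]; apply/andP; split; lra.
have h1 := rop_taylor x h0 T; have h2 := key k (leqnn k).
rewrite [X in _ - X](_ : _ = h ^+ 2 / 2 * g2 x) in h2; last first.
  by rewrite -kh; ring.
rewrite kh in h2.
have h3 : h ^+ 2 * (3 / 2 * K * h) = 3 / 2 * (K * h ^+ 3) by ring.
rewrite h3 in h2.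
have p : 0 <= K * h ^+ 3 by rewrite mulr_ge0// exprn_ge0// ltW.
rewrite -mulrA; move: h1 h2.
rewrite !ler_norml => /andP[? ?] /andP[? ?]; apply/andP; split; lra.
Qed.

Lemma iter_split h h' k K b g g1 g2 x : 0 <= K -> 0 < h -> 0 < h' -> h' <= h ->
  k%:R * h' ^+ 2 = h ^+ 2 -> taylor K g g1 g2 ->
  `|iter b (rop h) g x - iter (b * k) (rop h') g x| <= b%:R * (3 * K * h ^+ 3).
Proof.
move=> K0 h0 h'0 hh' kh T; rewrite iterM; elim: b x => [|b IH] x /=.
  by rewrite subrr normr0 mul0r.
have h1 := rop_split x K0 h0 h'0 hh' kh (iter_taylor h b T).
have h2 := iter_rop_dist h' k IH x.
rewrite -(natr1 b) mulrDl mul1r; move: h1 h2.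
by rewrite !ler_norml => /andP[? ?] /andP[? ?]; apply/andP; split; lra.
Qed.

Lemma smoothing_exists a L g : 0 < a -> 0 <= L -> lip1 L g ->
  exists g0 g1 g2, taylor (4 * L / a ^+ 2) g0 g1 g2 /\
    forall x, `|g0 x - g x| <= 2 * L * a.
Proof.
move=> a0 L0 gL; have [h1 h2] := smooth_avg a0 L0 gL.
exists (avg a (avg a g)), (avg_d1 a g), (avg_d2 a g); split; first by split.
move=> x; have := avg_close a0 x gL; have := avg_close a0 x (avg_lip a0 gL).
by rewrite !ler_norml => /andP[? ?] /andP[? ?]; apply/andP; split; lra.
Qed.

(** The mean of [g] after [b] fair steps of total variance [s ^+ 2]. *)
Definition rwalk (s : R) b g x : R := iter b (rop (s / Num.sqrt b%:R)) g x.

(** Smoothing at scale [a] costs [4 * L * a]. For the smoothed function each of the [b] steps costs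
    O(b^(-3/2)), whatever the number [k] of its pieces. *)
Lemma rwalk_split s a L b k g x : 0 < s -> 0 < a -> 0 <= L -> (0 < b)%N -> (0 < k)%N ->
  lip1 L g ->
  `|rwalk s b g x - rwalk s (b * k) g x| <=
    4 * L * a + 12 * L / a ^+ 2 * s ^+ 3 / Num.sqrt b%:R.
Proof.
move=> s0 a0 L0 b0 k0 gL.
have [g0 [g1 [g2 [T gg0]]]] := smoothing_exists a0 L0 gL.
have sb : 0 < Num.sqrt b%:R :> R by rewrite sqrtr_gt0 ltr0n.
have sk : 0 < Num.sqrt k%:R :> R by rewrite sqrtr_gt0 ltr0n.
have sk1 : 1 <= Num.sqrt k%:R :> R by rewrite -[leLHS]sqrtr1 ler_sqrt ?ler1n// ltr0n.
have sbk : Num.sqrt (b * k)%:R = Num.sqrt b%:R * Num.sqrt k%:R :> R.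
  by rewrite natrM sqrtrM.
have b2 : Num.sqrt b%:R ^+ 2 = b%:R :> R by rewrite sqr_sqrtr.
have k2 : Num.sqrt k%:R ^+ 2 = k%:R :> R by rewrite sqr_sqrtr.
have K0 : 0 <= 4 * L / a ^+ 2 by rewrite divr_ge0 ?exprn_ge0 ?(ltW a0)// mulr_ge0.
have h1 := iter_rop_dist (s / Num.sqrt b%:R) b gg0 x.
have h2 := iter_rop_dist (s / Num.sqrt (b * k)%:R) (b * k) gg0 x.
have h3 : `|rwalk s b g0 x - rwalk s (b * k) g0 x| <=
    b%:R * (3 * (4 * L / a ^+ 2) * (s / Num.sqrt b%:R) ^+ 3).
  apply: (@iter_split _ _ _ _ _ g0 g1 g2) => //.
  - by rewrite divr_gt0.
  - by rewrite divr_gt0// sqrtr_gt0 ltr0n muln_gt0 b0.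
  - rewrite sbk ler_wpM2l ?(ltW s0)// lef_pV2 ?posrE ?mulr_gt0//.
    by rewrite ler_peMr// ltW.
  - rewrite sbk -[X in X * _]k2; field; apply/andP; split; exact: lt0r_neq0.
have E : b%:R * (3 * (4 * L / a ^+ 2) * (s / Num.sqrt b%:R) ^+ 3) =
   12 * L / a ^+ 2 * s ^+ 3 / Num.sqrt b%:R.
  by rewrite -[X in X * _]b2; field; rewrite !gt_eqF.
rewrite E in h3; rewrite /rwalk in h3 *.
move: h1 h2 h3; rewrite !ler_norml => /andP[? ?] /andP[? ?] /andP[? ?].
by apply/andP; split; lra.
Qed.

Lemma rwalk_cauchy s L e : 0 < s -> 0 <= L -> 0 < e -> exists B, forall b b' g x,
  (B <= b)%N -> (B <= b')%N -> lip1 L g -> `|rwalk s b g x - rwalk s b' g x| <= e.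
Proof.
move=> s0 L0 e0.
pose a := e / (16 * (L + 1)).
have L1 : 0 < L + 1 by rewrite ltr_wpDl.
have a0 : 0 < a by rewrite divr_gt0// mulr_gt0.
have La : 8 * L * a <= e / 2.
  have E : e = 16 * (L + 1) * a by rewrite /a; field; rewrite gt_eqF.
  by rewrite [X in _ <= X / 2]E; nra.
pose D := 12 * L / a ^+ 2 * s ^+ 3.
have D0 : 0 <= D.
  by rewrite /D !mulr_ge0 ?exprn_ge0 ?invr_ge0 ?exprn_ge0// ltW.
pose B := (Num.bound ((4 * D / e) ^+ 2)).+1.
have key b : (B <= b)%N -> D / Num.sqrt b%:R <= e / 4.
  move=> Bb; have b0 : (0 < b)%N by exact: leq_trans Bb.
  rewrite ler_pdivrMr ?sqrtr_gt0 ?ltr0n//.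
  have : 4 * D / e <= Num.sqrt b%:R.
    have p : 0 <= 4 * D / e by rewrite divr_ge0 ?(ltW e0)// mulr_ge0.
    rewrite -[leLHS](ger0_norm p) -sqrtr_sqr.
    rewrite ler_sqrt ?ltr0n//; apply: le_trans (ltW (archi_boundP (sqr_ge0 _))) _.
    by rewrite ler_nat; exact: ltnW.
  rewrite ler_pdivrMr//; lra.
exists B => b b' g x Bb Bb' gL.
have b0 : (0 < b)%N by exact: leq_trans Bb.
have b'0 : (0 < b')%N by exact: leq_trans Bb'.
(* Both walks are compared with their common refinement into [b * b'] steps. *)
have h1 := rwalk_split x s0 a0 L0 b0 b'0 gL.
have h2 := rwalk_split x s0 a0 L0 b'0 b0 gL.
have := key b Bb; have := key b' Bb'; rewrite -/D in h1 h2.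
move=> k1 k2; rewrite mulnC in h2.
move: h1 h2; rewrite !ler_norml => /andP[? ?] /andP[? ?]; apply/andP; split; lra.
Qed.

(* Plays the role of averaging g over a centered Gaussian of variance s^2. *)
Definition nlim (s : R) g x : R := limn (fun b => rwalk s b g x).

Lemma rwalk_cvg s L g x : 0 < s -> 0 <= L -> lip1 L g ->
  cvgn (fun b => rwalk s b g x).
Proof.
move=> s0 L0 gL; apply: cauchy_seq_cvg => e e0.
by have [B H] := rwalk_cauchy s0 L0 e0; exists B => n m Bn Bm; exact: H.
Qed.

Lemma rwalk_nlim s L e : 0 < s -> 0 <= L -> 0 < e -> exists B, forall b g x,
  (B <= b)%N -> lip1 L g -> `|nlim s g x - rwalk s b g x| <= e.
Proof.
move=> s0 L0 e0; have [B H] := rwalk_cauchy s0 L0 e0; exists B => b g x Bb gL.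
by apply: (limn_dist_le (N := B)) => [|n Bn]; [exact: rwalk_cvg gL|exact: H].
Qed.

Lemma nlim_dist s L g g' e x x' : 0 < s -> 0 <= L -> lip1 L g -> lip1 L g' ->
  (forall u, `|g (x + u) - g' (x' + u)| <= e) -> `|nlim s g x - nlim s g' x'| <= e.
Proof.
move=> s0 L0 gL g'L H.
have H' b : `|rwalk s b g x - rwalk s b g' x'| <= e.
  suff K n h y : (forall u, `|g (x + u) - g' (x' + u)| <= e) ->
      `|iter n (rop h) g (x + y) - iter n (rop h) g' (x' + y)| <= e.
    by have := K b (s / Num.sqrt b%:R) 0 H; rewrite !addr0.
  move=> {}H; elim: n y => [|n IH] y /=; first exact: H.
  by apply: rop_dist => u; rewrite -!addrA.
have c1 := @rwalk_cvg s L g x s0 L0 gL; have c2 := @rwalk_cvg s L g' x' s0 L0 g'L.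
rewrite -[nlim s g x - _]subr0 /nlim -limB//.
apply: (limn_dist_le (N := 0)) => [|n _]; first exact: is_cvgB.
by rewrite subr0; exact: H'.
Qed.

End rademacher_average.

(** * Lipschitz functionals of finitely many coordinates *)

Section lipschitz_functionals.
Context {R : realType}.
Implicit Types (p q : nat -> R) (F : (nat -> R) -> R) (m j : nat).

Definition dist1 m p q : R := \sum_(i < m) `|p i - q i|.

Definition lipm m (L : R) F := forall p q, `|F p - F q| <= L * dist1 m p q.

Definition incr j (h : R) p : nat -> R := fun i => if i == j then p i + h else p i.

Definition line F p j (y : R) : R := F (incr j y p).

Lemma dist1_ge0 m p q : 0 <= dist1 m p q.
Proof. exact: sumr_ge0. Qed.

Lemma incr0 j p : incr j 0 p = p.
Proof. by apply/funext => i; rewrite /incr; case: eqP; rewrite ?addr0. Qed.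

Lemma incrD j a b p : incr j a (incr j b p) = incr j (b + a) p.
Proof. by apply/funext => i; rewrite /incr; case: eqP; rewrite ?addrA. Qed.

Lemma dist1_incr m j h p q : dist1 m (incr j h p) (incr j h q) = dist1 m p q.
Proof.
apply: eq_bigr => i _; rewrite /incr; case: eqP => // _.
by rewrite opprD addrACA subrr addr0.
Qed.

Lemma dist1_incr2 m j a b p : dist1 m (incr j a p) (incr j b p) <= `|a - b|.
Proof.
case: (ltnP j m) => jm.
  rewrite /dist1 (bigD1 (Ordinal jm))//= big1 ?addr0.
    by rewrite /incr eqxx opprD addrACA subrr add0r.
  move=> i /eqP ij; rewrite /incr; case: eqP => [e|_]; last by rewrite subrr normr0.
  by case: ij; exact: val_inj.
rewrite /dist1 big1// => i _; rewrite /incr; case: eqP => [e|_]; last by rewrite subrr normr0.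
by have := ltn_ord i; rewrite e ltnNge jm.
Qed.

Lemma line_lip m L F p j : 0 <= L -> lipm m L F -> lip1 L (line F p j).
Proof.
move=> L0 FL x y; apply: le_trans (FL _ _) _; rewrite ler_wpM2l//.
exact: dist1_incr2.
Qed.

Lemma line_incr F p j z y : line F (incr j z p) j y = line F p j (z + y).
Proof. by rewrite /line incrD. Qed.

Lemma line0 F p j : line F p j 0 = F p.
Proof. by rewrite /line incr0. Qed.

Lemma line_dist m L F p q j u : lipm m L F ->
  `|line F p j u - line F q j u| <= L * dist1 m p q.
Proof. by move=> FL; apply: le_trans (FL _ _) _; rewrite dist1_incr. Qed.

(** [F] is the infimum, over a countable dense set of points [q], of the cones
    [F q + L * dist1 m p q]. The source is arbitrary so as to cover sigma-algebras of the past. *)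
Lemma lipm_measurable d (T : measurableType d) m L F (X : T -> nat -> R) :
  0 <= L -> lipm m L F ->
  (forall i, (i < m)%N -> measurable_fun setT (fun w => X w i)) ->
  measurable_fun setT (fun w => F (X w)).
Proof.
move=> L0 FL mX.
(* An enumeration of the points with rational coordinates, through the codes of finite sequences. *)
pose q n i : R := ratr (nth 0 (odflt [::] (unpickle n : option (seq rat))) i).
pose h n w := F (q n) + L * dist1 m (X w) (q n).
have lb w n : F (X w) <= h n w.
  have := FL (X w) (q n); rewrite /h ler_norml => /andP[_]; lra.
have hl w : has_lbound (range (h ^~ w)).
  by exists (F (X w)) => _ [n _ <-]; exact: lb.
have -> : (fun w => F (X w)) = (fun w => infs (h ^~ w) 0%N).
  apply/funext => w; apply/le_anti/andP; split.
    apply: lb_le_inf; first by exists (h 0%N w); exists 0%N.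
    by move=> _ [n _ <-]; exact: lb.
  apply/ler_addgt0Pl => e e0.
  pose eta := e / (2 * (L + 1) * m.+1%:R).
  have L1 : 0 < L + 1 by rewrite ltr_wpDl.
  have eta0 : 0 < eta by rewrite divr_gt0// !mulr_gt0.
  have hr i : exists r : rat, `|X w i - ratr r| <= eta.
    have [r] := @rat_in_itvoo R (X w i) (X w i + eta) (ltr_pwDr eta0 (lexx _)).
    rewrite in_itv /= => /andP[r1 r2]; exists r.
    by rewrite ler0_norm ?subr_le0 ?(ltW r1)//; lra.
  have [r rP] := choice hr.
  pose n := pickle (mkseq r m).
  have qE (i : 'I_m) : q n i = ratr (r i) by rewrite /q /n pickleK /= nth_mkseq.
  have d1 : dist1 m (X w) (q n) <= m%:R * eta.
    rewrite /dist1 -[X in X%:R]card_ord mulr_natl -sumr_const.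
    by apply: ler_sum => i _; rewrite qE.
  apply: (@le_trans _ _ (h n w)).
    by apply: ge_inf; [case: (hl w) => x hx; exists x => _ [k _ <-]; apply: hx; exists k|exists n].
  have h1 := FL (X w) (q n); move: h1; rewrite /h ler_norml => /andP[h1 _].
  have h2 : L * dist1 m (X w) (q n) <= e / 2.
    apply: (@le_trans _ _ ((L + 1) * (m.+1%:R * eta))).
      apply: ler_pM => //; [exact: dist1_ge0|by rewrite lerDl|].
      by apply: le_trans d1 _; rewrite ler_wpM2r ?(ltW eta0)// ler_nat.
    rewrite le_eqVlt; apply/orP; left; apply/eqP; rewrite /eta.
    have : 0 < m.+1%:R :> R by []; set M := m.+1%:R => M0.
    by field; rewrite !gt_eqF.
  lra.
apply: measurable_fun_infs; first by move=> w _; exact: hl.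
move=> n; apply: measurable_funD => //; apply: measurable_funM => //.
apply: measurable_sum => i; apply: measurableT_comp => //.
by apply: measurable_funB => //; exact: mX.
Qed.

Definition Rop j (h : R) F p : R := rop h (line F p j) 0.

Lemma line_Rop j h F p : line (Rop j h F) p j = rop h (line F p j).
Proof.
apply/funext => y; rewrite /line /Rop /rop !line_incr.
by rewrite add0r sub0r.
Qed.

Lemma Rop_lip m L j h F : lipm m L F -> lipm m L (Rop j h F).
Proof. by move=> FL p q; apply: rop_dist => u; rewrite !add0r; exact: line_dist. Qed.

Lemma iter_Rop j h n F p : iter n (Rop j h) F p = iter n (rop h) (line F p j) 0.
Proof.
suff H : line (iter n (Rop j h) F) p j = iter n (rop h) (line F p j).
  by rewrite -H line0.
by elim: n => //= n IH; rewrite line_Rop IH.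
Qed.

Definition Nop j (s : R) F p : R := nlim s (line F p j) 0.

Lemma Nop_lip m L j s F : 0 < s -> 0 <= L -> lipm m L F -> lipm m L (Nop j s F).
Proof.
move=> s0 L0 FL p q; apply: (nlim_dist s0 L0).
- exact: line_lip FL.
- exact: line_lip FL.
- by move=> u; rewrite !add0r; exact: line_dist.
Qed.

(** [F1] and [F2] play the derivatives along coordinate [j]. They are Lipschitz in all coordinates,
    hence measurable and integrable at arguments known from the past. *)
Definition smoothm m j K F F1 F2 : Prop :=
  [/\ exists2 L, 0 <= L & lipm m L F, exists2 L, 0 <= L & lipm m L F1,
      exists2 L, 0 <= L & lipm m L F2 &
      forall p y, `|F (incr j y p) - F p - y * F1 p - y ^+ 2 / 2 * F2 p|
         <= K * `|y| ^+ 3].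

Lemma smoothm_Rop m j h K F F1 F2 : smoothm m j K F F1 F2 ->
  smoothm m j K (Rop j h F) (Rop j h F1) (Rop j h F2).
Proof.
move=> [[L L0 HL] [L1 L10 HL1] [L2 L20 HL2] H]; split.
- by exists L => //; exact: Rop_lip.
- by exists L1 => //; exact: Rop_lip.
- by exists L2 => //; exact: Rop_lip.
move=> p y; rewrite /Rop /rop !line_incr !add0r /line (addrC y h).
rewrite (addrC y (- h)) -!incrD.
have h1 := H (incr j h p) y; have h2 := H (incr j (- h) p) y.
set k := K * _ in h1 h2 *; set q := y ^+ 2 / 2 in h1 h2 *.
move: h1 h2; set a := F (incr j y (incr j h p)); set b := F (incr j y (incr j (- h) p)).
set a1 := F1 (incr j h p); set b1 := F1 (incr j (- h) p).
set a2 := F2 (incr j h p); set b2 := F2 (incr j (- h) p).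
set c1 := F (incr j h p); set c2 := F (incr j (- h) p).
have -> : (a + b) / 2 - (c1 + c2) / 2 - y * ((a1 + b1) / 2) - q * ((a2 + b2) / 2) =
  ((a - c1 - y * a1 - q * a2) + (b - c2 - y * b1 - q * b2)) / 2 by ring.
rewrite !ler_norml => /andP[? ?] /andP[? ?]; apply/andP; split; lra.
Qed.

Lemma avg_shift (a : R) (g : R -> R) y x L : 0 < a -> lip1 L g ->
  avg a (fun u => g (y + u)) x = avg a g (y + x).
Proof.
move=> a0 gL; apply/eqP; rewrite -subr_eq0 -normr_le0.
apply: avg_cmp => //.
- apply: (@lip1_continuous _ L) => u v; apply: le_trans (gL _ _) _.
  by rewrite (_ : y + u - (y + v) = u - v)//; ring.
- exact: lip1_continuous gL.
- by move=> u _; rewrite addrA subrr normr0.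
Qed.

(** Averaging acts along coordinate [j] only and, being a mean, preserves the Lipschitz bound in the
    other ones. *)
Lemma smoothm_exists m j L F a : 0 < a -> 0 <= L -> lipm m L F ->
  exists F0 F1 F2, smoothm m j (4 * L / a ^+ 2) F0 F1 F2 /\
    forall p, `|F0 p - F p| <= 2 * L * a.
Proof.
move=> a0 L0 FL.
have lL p : lip1 L (line F p j) by exact: line_lip FL.
have aL p : lip1 L (avg a (line F p j)) by exact: avg_lip.
have d0 p q x : `|avg a (line F p j) x - avg a (line F q j) x| <= L * dist1 m p q.
  apply: avg_cmp => //; [exact: lip1_continuous (lL p)|exact: lip1_continuous (lL q)|].
  by move=> u _; exact: line_dist.
have d2 : 0 <= 2 * L / a by rewrite divr_ge0 ?(ltW a0)// mulr_ge0.
exists (fun p => avg a (avg a (line F p j)) 0), (fun p => avg_d1 a (line F p j) 0),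
  (fun p => avg_d2 a (line F p j) 0); split; last first.
  move=> p; have := avg_close a0 0 (lL p); have := avg_close a0 0 (aL p).
  rewrite line0 !ler_norml => /andP[? ?] /andP[? ?]; apply/andP; split; lra.
split.
- exists L => // p q; apply: avg_cmp => //.
  + exact: lip1_continuous (aL p).
  + exact: lip1_continuous (aL q).
- exists (2 * L / a) => // p q; rewrite /avg_d1 -mulrBl normrM.
  rewrite (gtr0_norm (_ : 0 < a^-1)) ?invr_gt0//.
  rewrite [leRHS](_ : _ = 2 * (L * dist1 m p q) / a); last by ring.
  rewrite ler_wpM2r ?invr_ge0 ?(ltW a0)//.
  exact: (ler_distB (d0 p q (0 + a)) (d0 p q 0)).
- exists (4 * L / a ^+ 2).
    by rewrite divr_ge0 ?exprn_ge0 ?(ltW a0)// mulr_ge0.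
  move=> p q.
  set g := line F p j; set g' := line F q j.
  have -> : avg_d2 a g 0 - avg_d2 a g' 0 = ((g (0 + a + a) - g' (0 + a + a))
    - 2 * (g (0 + a) - g' (0 + a)) + (g 0 - g' 0)) / a ^+ 2.
    by rewrite /avg_d2; field; rewrite gt_eqF.
  rewrite normrM (gtr0_norm (_ : 0 < (a ^+ 2)^-1)) ?invr_gt0 ?exprn_gt0//.
  rewrite [leRHS](_ : _ = 4 * (L * dist1 m p q) / a ^+ 2); last by ring.
  rewrite ler_wpM2r ?invr_ge0 ?exprn_ge0 ?(ltW a0)//.
  have := line_dist p q j (0 + a + a) FL; have := line_dist p q j (0 + a) FL.
  have := line_dist p q j 0 FL; rewrite -/g -/g'.
  rewrite !ler_norml => /andP[? ?] /andP[? ?] /andP[? ?]; apply/andP; split; lra.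
- move=> p y.
  have E : avg a (avg a (line F (incr j y p) j)) 0 = avg a (avg a (line F p j)) (0 + y).
    rewrite (funext (fun u => line_incr F p j y u)).
    rewrite (funext (fun x => avg_shift y x a0 (lL p))).
    by rewrite (avg_shift y 0 a0 (aL p)) addrC.
  by rewrite E; have [_] := smooth_avg a0 L0 (lL p); exact.
Qed.

End lipschitz_functionals.

(** * Replacement of the innovations by fair signs *)

Section lindeberg.
Context {d : measure_display} {Omega : measurableType d} {R : realType}.
Variable P : probability Omega R.
Variables (I : finType) (n : nat) (z : I -> nat -> Omega -> R).
Variables (Fil : nat -> set (set Omega)) (K : R).
Hypothesis Z : iseq P n z Fil K.
Variable i0 : I.
Let zeta := z i0.

Definition past m t (X : Omega -> nat -> R) := forall i, (i < m)%N ->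
  adapted (Fil t) (X^~ i) /\ L1 P (X^~ i).

Lemma L1_lipm m L F X : 0 <= L -> lipm m L F ->
  (forall i, (i < m)%N -> L1 P (X^~ i)) -> L1 P (fun w => F (X w)).
Proof.
move=> L0 FL iX.
apply: (@L1_le _ _ _ _ _ (fun w => `|F (fun=> 0)| + L * dist1 m (X w) (fun=> 0))).
- by apply: (lipm_measurable L0 FL) => i im; exact: L1_meas (iX i im).
- apply: L1D; first exact: L1_cst.
  by apply: L1Z; apply: L1_sum => i _; apply: L1_abs; apply: L1B; [exact: iX|exact: L1_cst].
- move=> w; rewrite -[F (X w)](subrK (F (fun=> 0))) addrC.
  by apply: le_trans (ler_normD _ _) _; rewrite lerD2l; exact: FL.
Qed.

Lemma adapted_lipm m t L F X : 0 <= L -> lipm m L F -> past m t X ->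
  adapted (Fil t) (fun w => F (X w)).
Proof.
move=> L0 FL pX.
by apply: (@lipm_measurable _ _ (g_sigma_algebraType (Fil t)) m L F X L0 FL) => i im;
  exact: (pX i im).1.
Qed.

Lemma past_incr m t j c X : (t < n)%N -> past m t X ->
  past m t.+1 (fun w => incr j (c * zeta t w) (X w)).
Proof.
move=> tn pX i im; have [aX iX] := pX i im.
have aX' := adaptedS (is_fil Z tn) aX.
rewrite /incr; case: eqP => _; last by split.
split.
  apply: (measurable_funD aX'); apply: measurable_funM => //.
  exact: (is_adapted Z i0 tn).
by apply: L1D => //; apply: L1Z; exact: L2_L1 (iseq_L2 Z i0 tn).
Qed.

(** An innovation and a fair sign share mean 0 and variance 1, also when weighted by functions of
    the past, so the Taylor terms up to order two have equal expectations. *)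
Lemma lindeberg_step m j K' F F1 F2 t c X : (t < n)%N -> 0 <= K' ->
  smoothm m j K' F F1 F2 -> past m t X ->
  `|Ex P (fun w => F (incr j (c * zeta t w) (X w))) - Ex P (fun w => Rop j c F (X w))|
  <= K' * (2 + K) * `|c| ^+ 3.
Proof.
move=> tn K'0 sm pX; have [[L L0 FL] [L' L'0 F1L] [L'' L''0 F2L] H] := sm.
have iX i : (i < m)%N -> L1 P (X^~ i) by move=> im; exact: (pX i im).2.
have iX' i : (i < m)%N -> L1 P ((fun w => incr j (c * zeta t w) (X w))^~ i).
  by move=> im; exact: (past_incr j c tn pX im).2.
have j1 : L1 P (fun w => F (incr j (c * zeta t w) (X w))) by exact: (L1_lipm L0 FL iX').
have j2 : L1 P (fun w => Rop j c F (X w)) by exact: (L1_lipm L0 (Rop_lip j c FL) iX).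
have j3 : L1 P (fun w => F (X w)) by exact: (L1_lipm L0 FL iX).
have j4 : L1 P (fun w => F1 (X w)) by exact: (L1_lipm L'0 F1L iX).
have j5 : L1 P (fun w => F2 (X w)) by exact: (L1_lipm L''0 F2L iX).
have [j6 e6] := is_ind1 Z i0 tn (adapted_lipm L'0 F1L pX) j4.
have [j7 e7] := is_ind2 Z i0 i0 tn (adapted_lipm L''0 F2L pX) j5.
rewrite eqxx mulr1 in e7.
pose A w := F (incr j (c * zeta t w) (X w)) - F (X w) - (c * zeta t w) * F1 (X w)
   - (c * zeta t w) ^+ 2 / 2 * F2 (X w).
pose B w := Rop j c F (X w) - F (X w) - c ^+ 2 / 2 * F2 (X w).
have EA : A = fun w => ((F (incr j (c * zeta t w) (X w)) - F (X w))
   - c * (F1 (X w) * zeta t w)) - c ^+ 2 / 2 * (F2 (X w) * (zeta t w * zeta t w)).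
  by apply/funext => w; rewrite /A; ring.
have jA1 : L1 P (fun w => F (incr j (c * zeta t w) (X w)) - F (X w)) by exact: L1B.
have jA2 : L1 P (fun w => (F (incr j (c * zeta t w) (X w)) - F (X w))
   - c * (F1 (X w) * zeta t w)) by apply: L1B => //; exact: L1Z.
have jA : L1 P A by rewrite EA; apply: L1B => //; exact: L1Z.
have jB1 : L1 P (fun w => Rop j c F (X w) - F (X w)) by exact: L1B.
have jB : L1 P B by apply: L1B => //; exact: L1Z.
have E : Ex P (fun w => F (incr j (c * zeta t w) (X w))) - Ex P (fun w => Rop j c F (X w))
   = Ex P A - Ex P B.
  rewrite EA (ExB jA2 (L1Z _ j7)) (ExB jA1 (L1Z _ j6)) (ExB j1 j3) (ExZ _ j6) (ExZ _ j7).
  rewrite /B (ExB jB1 (L1Z _ j5)) (ExB j2 j3) (ExZ _ j5) e6 e7; ring.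
have z4 : L1 P (fun w => zeta t w ^+ 4).
  by have := (is_L4 Z i0 tn).2.2; under eq_fun do rewrite -exprM.
(* The third absolute moment is bounded through [x ^+ 3 <= 1 + x ^+ 4] for nonnegative [x]. *)
have A1 : `|Ex P A| <= K' * `|c| ^+ 3 * (1 + K).
  apply: (@le_trans _ _ (Ex P (fun w => K' * `|c| ^+ 3 * (1 + zeta t w ^+ 4)))).
    apply: Ex_abs_le => //; first by apply: L1Z; apply: L1D => //; exact: L1_cst.
    move=> w; apply: le_trans (H _ _) _; rewrite normrM exprMn mulrA.
    rewrite ler_wpM2l ?mulr_ge0 ?exprn_ge0//.
    have -> : zeta t w ^+ 4 = `|zeta t w| ^+ 4 by rewrite -normrX ger0_norm// exprn_even_ge0.
    have x0 : 0 <= `|zeta t w| by [].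
    move: x0; set x := `|_|; move=> x0.
    case: (leP x 1) => x1.
      apply: (@le_trans _ _ 1); first by rewrite exprn_ile1.
      by rewrite lerDl exprn_ge0.
    by apply: (@le_trans _ _ (x ^+ 4)); rewrite ?lerDr// ler_eXn2l.
  rewrite (ExZ _ (L1D (L1_cst P 1) z4)) (ExD (L1_cst P 1) z4) Ex_cst.
  rewrite ler_wpM2l ?mulr_ge0 ?exprn_ge0// lerD2l.
  exact: (is_m4 Z i0 tn).
have B1 : `|Ex P B| <= K' * `|c| ^+ 3.
  apply: (@le_trans _ _ (Ex P (fun=> K' * `|c| ^+ 3))); last by rewrite Ex_cst.
  apply: Ex_abs_le => //; first exact: L1_cst.
  move=> w; have h1 := H (X w) c; have h2 := H (X w) (- c).
  rewrite /B /Rop /rop /line add0r sub0r; rewrite normrN sqrrN mulNr in h2.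
  set q := c ^+ 2 / 2 * _ in h1 h2 *; set k := K' * _ in h1 h2 *.
  move: h1 h2; rewrite !ler_norml => /andP[? ?] /andP[? ?]; apply/andP; split; lra.
rewrite E; apply: le_trans (ler_normB _ _) _.
apply: le_trans (lerD A1 B1) _.
by rewrite le_eqVlt; apply/orP; left; apply/eqP; ring.
Qed.

Fixpoint wsum (cs : seq R) t (w : Omega) : R :=
  if cs is c :: cs' then c * zeta t w + wsum cs' t.+1 w else 0.

Definition Rops j (cs : seq R) F := foldr (Rop j) F cs.

Lemma smoothm_Rops m j cs K' F F1 F2 : smoothm m j K' F F1 F2 ->
  smoothm m j K' (Rops j cs F) (Rops j cs F1) (Rops j cs F2).
Proof. by move=> H; elim: cs => //= c cs; exact: smoothm_Rop. Qed.

Lemma Rops_lip m L j cs F : lipm m L F -> lipm m L (Rops j cs F).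
Proof. by move=> H; elim: cs => //= c cs; exact: Rop_lip. Qed.

Lemma Rops_dist j cs F G e : (forall p, `|F p - G p| <= e) ->
  forall p, `|Rops j cs F p - Rops j cs G p| <= e.
Proof. by move=> H; elim: cs => //= c cs IH p; apply: rop_dist => u; exact: IH. Qed.

(** The later innovations are replaced first, the earliest being counted in the past meanwhile; when
    its turn comes, the functional has already been averaged over the later signs. *)
Lemma lindeberg_smooth m j K' cs F F1 F2 t X : (t + size cs <= n)%N -> 0 <= K' ->
  smoothm m j K' F F1 F2 -> past m t X ->
  `|Ex P (fun w => F (incr j (wsum cs t w) (X w))) - Ex P (fun w => Rops j cs F (X w))|
  <= K' * (2 + K) * \sum_(c <- cs) `|c| ^+ 3.
Proof.
move=> + K'0 sm; elim: cs t X => [|c cs IH] t X /= tn pX.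
  rewrite big_nil mulr0 (_ : (fun w => F (incr j 0 (X w))) = (fun w => F (X w))).
    by rewrite subrr normr0.
  by apply/funext => w; rewrite incr0.
rewrite big_cons mulrDr.
have tn1 : (t < n)%N by rewrite (leq_trans _ tn)// -addSnnS leq_addr.
have h1 := lindeberg_step c tn1 K'0 (smoothm_Rops cs sm) pX.
have tn2 : (t.+1 + size cs <= n)%N by rewrite addSnnS.
have := IH t.+1 _ tn2 (past_incr j c tn1 pX).
under eq_fun do rewrite incrD.
move: h1; rewrite !ler_norml => /andP[? ?] /andP[? ?]; apply/andP; split; lra.
Qed.

Lemma wsum_L1 cs t : (t + size cs <= n)%N -> L1 P (wsum cs t).
Proof.
elim: cs t => [|c cs IH] t /= tn; first exact: L1_cst.
have tn1 : (t < n)%N by rewrite (leq_trans _ tn)// -addSnnS leq_addr.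
apply: L1D; last by apply: IH; rewrite addSnnS.
by apply: L1Z; exact: L2_L1 (iseq_L2 Z i0 tn1).
Qed.

Lemma lindeberg_lip m j L a cs F t X : (t + size cs <= n)%N -> 0 <= L -> 0 < a ->
  lipm m L F -> past m t X ->
  `|Ex P (fun w => F (incr j (wsum cs t w) (X w))) - Ex P (fun w => Rops j cs F (X w))|
  <= 4 * L * a + 4 * L / a ^+ 2 * (2 + K) * \sum_(c <- cs) `|c| ^+ 3.
Proof.
move=> tn L0 a0 FL pX.
have [F0 [F1 [F2 [sm F0F]]]] := smoothm_exists j a0 L0 FL.
have K'0 : 0 <= 4 * L / a ^+ 2.
  by rewrite divr_ge0 ?exprn_ge0 ?(ltW a0)// mulr_ge0.
have h := lindeberg_smooth tn K'0 sm pX.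
have [[L1' L10 F0L] _ _ _] := sm.
have iX i : (i < m)%N -> L1 P (X^~ i) by move=> im; exact: (pX i im).2.
have iX' i : (i < m)%N -> L1 P ((fun w => incr j (wsum cs t w) (X w))^~ i).
  move=> im; rewrite /incr; case: eqP => _; last exact: iX.
  by apply: L1D; [exact: iX|exact: wsum_L1].
have i1 := L1_lipm L0 FL iX'; have i2 := L1_lipm L10 F0L iX'.
have i3 := L1_lipm L0 (Rops_lip j cs FL) iX.
have i4 := L1_lipm L10 (Rops_lip j cs F0L) iX.
have h1 : `|Ex P (fun w => F0 (incr j (wsum cs t w) (X w))) -
   Ex P (fun w => F (incr j (wsum cs t w) (X w)))| <= 2 * L * a.
  rewrite -ExB// -[leRHS](Ex_cst P); apply: Ex_abs_le; [exact: L1B|exact: L1_cst|].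
  by move=> w; exact: F0F.
have h2 : `|Ex P (fun w => Rops j cs F0 (X w)) -
   Ex P (fun w => Rops j cs F (X w))| <= 2 * L * a.
  rewrite -ExB// -[leRHS](Ex_cst P); apply: Ex_abs_le; [exact: L1B|exact: L1_cst|].
  by move=> w; apply: Rops_dist.
move: h h1 h2; rewrite !ler_norml => /andP[? ?] /andP[? ?] /andP[? ?].
by apply/andP; split; lra.
Qed.

End lindeberg.

(** * Central limit theorem for block increments, uniform in the sample size *)

Section block_limit.
Context {R : realType}.
Implicit Types F : (nat -> R) -> R.

(** Averages out the coordinates from [k] on, as if they were independent Gaussians of variance
    [s ^+ 2]. *)
Definition Nops (s : R) F k m := foldr (fun j => Nop j s) F (iota k (m - k)).

Lemma Nops_lip m L s F k : 0 < s -> 0 <= L -> lipm m L F -> lipm m L (Nops s F k m).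
Proof.
by move=> s0 L0 FL; rewrite /Nops; elim: (iota _ _) => //= j r; exact: Nop_lip.
Qed.

Lemma NopsS s F k m : (k < m)%N -> Nops s F k m = Nop k s (Nops s F k.+1 m).
Proof. by move=> km; rewrite /Nops; have -> : (m - k = (m - k.+1).+1)%N by lia. Qed.

Lemma Nopsm s F m : Nops s F m m = F.
Proof. by rewrite /Nops subnn. Qed.

Lemma Rops_nseq j b h F : Rops j (nseq b h) F = iter b (Rop j h) F.
Proof. by elim: b => //= b ->. Qed.

Context {d : measure_display} {Omega : measurableType d} (P : probability Omega R).

Section walk.
Variables (I : finType) (n : nat) (z : I -> nat -> Omega -> R).
Variables (Fil : nat -> set (set Omega)) (K : R).
Hypothesis Z : iseq P n z Fil K.
Variable i0 : I.

Lemma wsum_nseq b h t w :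
  wsum z i0 (nseq b h) t w = h * (psum (z i0) (t + b) w - psum (z i0) t w).
Proof.
elim: b t => [|b IH] t /=; first by rewrite addn0 subrr mulr0.
by rewrite IH addSnnS /psum (big_ord_recr t) /=; ring.
Qed.

Lemma fil_mono j k : (j <= k)%N -> (k <= n)%N -> Fil j `<=` <<s Fil k >>.
Proof.
elim: k => [|k IH]; first by rewrite leqn0 => /eqP -> _; exact: sub_sigma_algebra.
rewrite leq_eqVlt => /orP[/eqP -> _|jk kn]; first exact: sub_sigma_algebra.
apply: subset_trans (IH jk (ltnW kn)) _.
apply: smallest_sub; first exact: smallest_sigma_algebra.
exact: (is_fil Z kn).
Qed.

(** Coordinates from [k] on are left at 0, for [Nops] to fill. *)
Definition blocks b h k (w : Omega) (i : nat) : R :=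
  if (i < k)%N then wsum z i0 (nseq b h) (i * b) w else 0.

Lemma past_blocks m b h k : (k * b <= n)%N -> past P Fil m (k * b) (blocks b h k).
Proof.
move=> kbn i im; rewrite /blocks; case: ltnP => ik; last first.
  by split; [exact: measurable_cst|exact: L1_cst].
have ib : (i * b + b <= k * b)%N by rewrite -mulSnr leq_mul2r ik orbT.
split.
  rewrite (funext (wsum_nseq b h (i * b))).
  have a1 := adaptedS (fil_mono ib kbn) (iseq_adapted_psum Z i0 (leq_trans ib kbn)).
  have ib' : (i * b <= k * b)%N by rewrite (leq_trans _ ib)// leq_addr.
  have a2 := adaptedS (fil_mono ib' kbn) (iseq_adapted_psum Z i0 (leq_trans ib' kbn)).
  by apply: measurable_funM => //; exact: (measurable_funB a1 a2).
by apply: (wsum_L1 Z); rewrite size_nseq (leq_trans ib).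
Qed.

Lemma blocksS b h k w : blocks b h k.+1 w =
  incr k (wsum z i0 (nseq b h) (k * b) w) (blocks b h k w).
Proof.
apply/funext => i; rewrite /blocks /incr ltnS leq_eqVlt.
by case: eqP => [->|_]; rewrite ?ltnn ?add0r.
Qed.

End walk.

(** [B] precedes the innovations and [F], and the limit value contains neither the sample size nor
    the innovations; this is what yields the Cauchy property in T. *)
Lemma block_clt (m : nat) (L K0 e : R) : (0 < m)%N -> 0 <= L -> 0 < e ->
  exists B, forall b (I : finType) n (z : I -> nat -> Omega -> R) Fil K (i0 : I) F,
    (B <= b)%N -> (m * b <= n)%N -> K <= K0 -> iseq P n z Fil K -> lipm m L F ->
    `|Ex P (fun w => F (blocks z i0 b ((Num.sqrt m%:R)^-1 / Num.sqrt b%:R) m w)) -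
      Nops (Num.sqrt m%:R)^-1 F 0 m (fun=> 0)| <= e.
Proof.
move=> m0 L0 e0; set s := (Num.sqrt m%:R)^-1.
have s0 : 0 < s by rewrite invr_gt0 sqrtr_gt0 ltr0n.
have M0 : 0 < m%:R :> R by rewrite ltr0n.
pose e1 := e / m%:R.
have e10 : 0 < e1 by rewrite divr_gt0.
have [B1 HB1] := rwalk_nlim s0 L0 (divr_gt0 e10 (ltr0Sn R 1)).
pose a := e1 / (16 * (L + 1)).
have Lp1 : 0 < L + 1 by rewrite ltr_wpDl.
have a0 : 0 < a by rewrite divr_gt0// mulr_gt0.
have La : 4 * L * a <= e1 / 4.
  have E : e1 = 16 * (L + 1) * a by rewrite /a; field; rewrite gt_eqF.
  by rewrite [X in _ <= X / _]E; nra.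
pose D := 4 * L / a ^+ 2 * (2 + `|K0|) * s ^+ 3.
have D0 : 0 <= D.
  apply: mulr_ge0; last by rewrite exprn_ge0// ltW.
  apply: mulr_ge0; last by rewrite addr_ge0.
  by rewrite divr_ge0 ?exprn_ge0 ?(ltW a0)// mulr_ge0.
pose B2 := (Num.bound ((4 * D / e1) ^+ 2)).+1.
have key b : (B2 <= b)%N -> D / Num.sqrt b%:R <= e1 / 4.
  move=> Bb; have b0 : (0 < b)%N by exact: leq_trans Bb.
  rewrite ler_pdivrMr ?sqrtr_gt0 ?ltr0n//.
  have : 4 * D / e1 <= Num.sqrt b%:R.
    have p : 0 <= 4 * D / e1 by rewrite divr_ge0 ?(ltW e10)// mulr_ge0.
    rewrite -[leLHS](ger0_norm p) -sqrtr_sqr.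
    rewrite ler_sqrt ?ltr0n//; apply: le_trans (ltW (archi_boundP (sqr_ge0 _))) _.
    by rewrite ler_nat; exact: ltnW.
  rewrite ler_pdivrMr//; lra.
exists (maxn B1 B2) => b I n z Fil K i0 F; rewrite geq_max => /andP[B1b B2b] mbn KK0 Z FL.
have b0 : (0 < b)%N by exact: leq_trans B2b.
have sb : 0 < Num.sqrt b%:R :> R by rewrite sqrtr_gt0 ltr0n.
have b2 : Num.sqrt b%:R ^+ 2 = b%:R :> R by rewrite sqr_sqrtr.
set h := s / Num.sqrt b%:R.
have h0 : 0 < h by rewrite divr_gt0.
have hcs : \sum_(c <- nseq b h) `|c| ^+ 3 = s ^+ 3 / Num.sqrt b%:R.
  rewrite big_nseq iter_addr addr0 (gtr0_norm h0) /h.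
  move: b2 sb; set r := Num.sqrt b%:R => b2 sb.
  by rewrite -[X in X = _]mulr_natl -b2; field; rewrite gt_eqF.
have L1b k G : (k <= m)%N -> lipm m L G -> L1 P (fun w => G (blocks z i0 b h k w)).
  move=> km GL; apply: (L1_lipm L0 GL) => i im.
  have kn : (k * b <= n)%N by rewrite (leq_trans _ mbn)// leq_mul2r km orbT.
  exact: (past_blocks Z i0 h kn im).2.
(* Hybrid argument: the first [k] blocks are true increments, the others are averaged out. Each
   passage costs [e1], half for Lindeberg's replacement and half for the limit of the fair walk. *)
suff H k : (k <= m)%N ->
  `|Ex P (fun w => Nops s F k m (blocks z i0 b h k w)) - Nops s F 0 m (fun=> 0)|
    <= k%:R * e1.
  by have := H m (leqnn m); rewrite Nopsm mulrC divfK// gt_eqF.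
elim: k => [|k IH] km.
  rewrite mul0r (_ : (fun w => _) = fun=> Nops s F 0 m (fun=> 0)).
    by rewrite Ex_cst subrr normr0.
  by apply/funext => w; congr (Nops _ _ _ _ _); apply/funext => i; rewrite /blocks ltn0.
rewrite -(natr1 k) mulrDl mul1r.
set G := Nops s F k.+1 m.
have GL : lipm m L G by exact: Nops_lip.
have kb : (k * b + size (nseq b h) <= n)%N.
  by rewrite size_nseq -mulSnr (leq_trans _ mbn)// leq_mul2r km orbT.
have kbn : (k * b <= n)%N by rewrite (leq_trans _ kb)// leq_addr.
have h1 := lindeberg_lip Z i0 k kb L0 a0 GL (past_blocks Z i0 h kbn).
have h2 : `|Ex P (fun w => Rops k (nseq b h) G (blocks z i0 b h k w)) -
    Ex P (fun w => Nop k s G (blocks z i0 b h k w))| <= e1 / 2.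
  have NL : lipm m L (Nop k s G) by exact: Nop_lip.
  have RL : lipm m L (Rops k (nseq b h) G) by elim: (nseq b h) => //= c cs; exact: Rop_lip.
  have iA := L1b k _ (ltnW km) RL; have iB := L1b k _ (ltnW km) NL.
  rewrite -(ExB iA iB) -[leRHS](Ex_cst P).
  apply: Ex_abs_le; [exact: (L1B iA iB)|exact: L1_cst|].
  move=> w; rewrite Rops_nseq iter_Rop distrC; apply: HB1 => //.
  exact: line_lip GL.
have h3 : 4 * L / a ^+ 2 * (2 + K) * \sum_(c <- nseq b h) `|c| ^+ 3 <= e1 / 4.
  apply: le_trans (key b B2b); rewrite hcs /D -!mulrA.
  apply: ler_wpM2l => //; apply: ler_wpM2l => //; apply: ler_wpM2l.
    by rewrite invr_ge0 exprn_ge0// ltW.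
  apply: ler_wpM2r; first by rewrite !mulr_ge0 ?invr_ge0 ?sqrtr_ge0 ?(ltW s0).
  by rewrite lerD2l (le_trans KK0)// ler_norm.
rewrite (funext (fun w => congr1 G (blocksS z i0 b h k w))).
have := IH (ltnW km); rewrite NopsS// -/G; move: h1 h2.
rewrite !ler_norml => /andP[? ?] /andP[? ?] /andP[? ?].
by apply/andP; split; lra.
Qed.

End block_limit.

(** * Functionals of the bridge *)

Section functionals.
Context {R : realType}.
Implicit Types (u v : nat -> R).

(* The maximum over [0, N] and the mean over [0, N[ are treated together. *)
Definition Psi (bm : bool) (N : nat) u : R :=
  if bm then rmax u N else (\sum_(k < N) u k) / N%:R.

Lemma Psi_close bm N u v c : (0 < N)%N ->
  (forall k, (k <= N)%N -> `|u k - v k| <= c) -> `|Psi bm N u - Psi bm N v| <= c.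
Proof.
move=> N0 H; case: bm => /=.
  have K u' v' : (forall k, (k <= N)%N -> `|u' k - v' k| <= c) ->
      rmax u' N - rmax v' N <= c.
    move=> H'; have [k kN ->] := rmax_ex u' N.
    have := H' k kN; have := rmax_ge v' kN; rewrite ler_norml => ? /andP[_ ?]; lra.
  rewrite ler_norml lerNl opprB !K// => k kN; rewrite distrC; exact: H.
rewrite -mulrBl -sumrB normrM normfV normr_nat ler_pdivrMr ?ltr0n//.
apply: le_trans (ler_norm_sum _ _ _) _.
apply: (@le_trans _ _ (\sum_(k < N) c)).
  by apply: ler_sum => k _; apply: H; exact: ltnW.
by rewrite sumr_const card_ord mulr_natr.
Qed.

(** Repeating each index [M] times changes neither maximum nor mean; two grids can thus be refined
    to a common one and compared pointwise. *)
Lemma Psi_refine bm N M u : (0 < M)%N -> (0 < N)%N ->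
  Psi bm N u = Psi bm (M * N) (fun y => u (y %/ M)%N).
Proof.
move=> M0 N0; case: bm => /=.
  apply/le_anti/andP; split; apply: rmax_le => k kN.
    have := @rmax_ge R (fun y => u (y %/ M)%N) (M * N) (M * k).
    by rewrite /= mulKn// leq_mul2l kN orbT => /(_ isT).
  by apply: rmax_ge; rewrite -(mulKn N M0) leq_div2r.
have H : \sum_(y < M * N) u (y %/ M)%N = M%:R * \sum_(k < N) u k.
  elim: N {N0} => [|N IH]; first by rewrite muln0 !big_ord0 mulr0.
  rewrite mulnSr big_split_ord /= IH big_ord_recr /= mulrDr; congr (_ + _).
  rewrite mulr_natl -[X in _ *+ X]card_ord -sumr_const; apply: eq_bigr => i _.
  by rewrite mulnC divnMDl// divn_small ?ltn_ord// addn0.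
rewrite H natrM; field; rewrite !pnatr_eq0 -!lt0n; exact/andP.
Qed.

Lemma Psi_mean_le_max N u : (0 < N)%N -> Psi false N u <= Psi true N u.
Proof.
move=> N0; rewrite /= ler_pdivrMr ?ltr0n//.
rewrite mulr_natr -[X in _ *+ X]card_ord -sumr_const.
by apply: ler_sum => k _; apply: rmax_ge; exact: ltnW.
Qed.

Lemma Psi_norm_le bm N u c : (0 < N)%N -> (forall k, (k <= N)%N -> `|u k| <= c) ->
  `|Psi bm N u| <= c.
Proof.
move=> N0 H; have := @Psi_close bm N u (fun=> 0) c N0.
have -> : Psi bm N (fun=> 0) = 0.
  case: bm => /=; last by rewrite big1 ?mul0r.
  by apply/le_anti/andP; split; [exact: rmax_le|exact: rmax_ge0].
by rewrite subr0; apply => k kN; rewrite subr0; exact: H.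
Qed.

Lemma Psi_measurable d (T : measurableType d) bm N (u : nat -> T -> R) :
  (forall k, (k <= N)%N -> measurable_fun setT (u k)) ->
  measurable_fun setT (fun w => Psi bm N (u^~ w)).
Proof.
move=> mu; case: bm => /=; first exact: measurable_rmax.
apply: measurable_funM => //.
have -> : (fun w => \sum_(k < N) u k w) = (fun w => \sum_(k < N) u (minn k N) w).
  by apply/funext => w; apply: eq_bigr => k _; rewrite (minn_idPl _)// ltnW.
by apply: measurable_sum => k; apply: mu; exact: geq_minr.
Qed.

Definition bridge (T : nat) (S : nat -> R) (k : nat) : R :=
  (Num.sqrt T%:R)^-1 * (S k - k%:R / T%:R * S T).

Definition vbridge (T k : nat) : R := k%:R * (T%:R - k%:R) / T%:R ^+ 2.

Definition hbridge T S k : R := bridge T S k ^+ 2 - vbridge T k.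

Definition clip (r x : R) : R := Num.max (- r) (Num.min r x).

Lemma clip_id r x : `|x| <= r -> clip r x = x.
Proof.
rewrite ler_norml => /andP[h1 h2]; rewrite /clip min_r// max_r//.
Qed.

Lemma clip_norm r x : 0 <= r -> `|clip r x| <= r.
Proof.
move=> r0; rewrite ler_norml /clip /Num.max /Num.min.
by repeat case: ifP; move=> *; apply/andP; split; lra.
Qed.

Lemma clip_lip r x y : 0 <= r -> `|clip r x - clip r y| <= `|x - y|.
Proof.
move=> r0; have := ler_norm (x - y); have := ler_norm (y - x); rewrite (distrC y).
set t := `|x - y| => h1 h2.
rewrite ler_norml /clip /Num.max /Num.min.
by repeat case: ifP; move=> *; apply/andP; split; lra.
Qed.

Lemma clip_sq r x y : 0 <= r ->
  `|clip r x ^+ 2 - clip r y ^+ 2| <= 2 * r * `|x - y|.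
Proof.
move=> r0; rewrite subr_sqr mulrC normrM; apply: ler_pM => //; last exact: clip_lip.
apply: le_trans (ler_normD _ _) _.
have := clip_norm x r0; have := clip_norm y r0; lra.
Qed.

(* [hbridge] as a function of the increments p over m blocks, the bridge being
   truncated at r to make it Lipschitz in p. *)
Definition hskel (r : R) (m : nat) (p : nat -> R) (j : nat) : R :=
  clip r (\sum_(i < j) p i - j%:R / m%:R * \sum_(i < m) p i) ^+ 2 - vbridge m j.

Lemma hskel_lip r m p q j : (0 < m)%N -> (j <= m)%N -> 0 <= r ->
  `|hskel r m p j - hskel r m q j| <= 4 * r * dist1 m p q.
Proof.
move=> m0 jm r0; rewrite /hskel opprB addrA subrK.
apply: le_trans (clip_sq _ _ r0) _.
rewrite [leRHS](_ : _ = 2 * r * (2 * dist1 m p q)); last by ring.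
rewrite ler_wpM2l ?mulr_ge0//.
have h k : (k <= m)%N -> `|\sum_(i < k) p i - \sum_(i < k) q i| <= dist1 m p q.
  move=> km; rewrite -sumrB; apply: le_trans (ler_norm_sum _ _ _) _.
  rewrite /dist1 (big_ord_widen m (fun i => `|p i - q i|) km).
  by rewrite [leRHS](bigID (fun i : 'I_m => (i < k)%N)) /= lerDl sumr_ge0.
have h1 := h j jm; have h2 := h m (leqnn m).
have jm1 : 0 <= (j%:R / m%:R : R) <= 1.
  by rewrite divr_ge0//= ler_pdivrMr ?ltr0n// mul1r ler_nat.
have h3 : `|j%:R / m%:R * (\sum_(i < m) p i - \sum_(i < m) q i)| <= dist1 m p q.
  rewrite normrM -[leRHS]mul1r; apply: ler_pM => //.
  by rewrite ger0_norm; move: jm1 => /andP[].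
rewrite mulrBr in h3.
move: h1 h3; rewrite !ler_norml => /andP[? ?] /andP[? ?].
by apply/andP; split; lra.
Qed.

(** * Deterministic comparison of the bridge with its block skeleton *)

Section comparison.
Variables (T m b : nat) (S : nat -> R) (W D r : R).
Hypothesis m0 : (0 < m)%N.
Hypothesis b0 : (0 < b)%N.
Hypothesis bE : b = (T %/ m)%N.
Hypothesis S0 : S 0%N = 0.
Hypothesis SW : forall k, (k <= T)%N -> `|S k| <= Num.sqrt T%:R * W.
(** The window is [b + m] rather than [b]: the [m] blocks of length [b] leave a rest shorter than
    [m], which also shifts the blocks against the exact fractions of [T]. *)
Hypothesis SD : forall j k, (j <= m)%N -> (j * b <= k)%N -> (k <= j * b + (b + m))%N ->
  (k <= T)%N -> `|S k - S (j * b)%N| <= Num.sqrt T%:R * D.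

Let h : R := (Num.sqrt m%:R)^-1 / Num.sqrt b%:R.
Let p (i : nat) : R := h * (S (i * b + b)%N - S (i * b)%N).

Let T0 : (0 < T)%N.
Proof. by case: T bE => // e; move: b0; rewrite e div0n. Qed.

Let sT : 0 < Num.sqrt T%:R :> R. Proof. by rewrite sqrtr_gt0 ltr0n. Qed.

Let W0 : 0 <= W.
Proof.
by have := SW (leq0n T); rewrite S0 normr0 pmulr_rge0.
Qed.

Let mbT : (m * b <= T)%N. Proof. by rewrite bE mulnC leq_trunc_div. Qed.

Let Tmb : (T < m * b + m)%N.
Proof. by have := ltn_ceil T m0; rewrite -bE mulSn addnC mulnC. Qed.

Let psumE j : \sum_(i < j) p i = h * S (j * b)%N.
Proof.
elim: j => [|j IH]; first by rewrite big_ord0 mul0n S0 mulr0.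
by rewrite big_ord_recr /= IH /p mulSnr; ring.
Qed.

(** [h] normalises by [m * b] instead of [T]; these differ by less than [m], a relative error of at
    most [1 / b]. *)
Let hT : 0 <= h - (Num.sqrt T%:R)^-1 <= (Num.sqrt T%:R)^-1 / b%:R.
Proof.
have hE : h = (Num.sqrt (m * b)%:R)^-1 by rewrite /h natrM sqrtrM// invfM.
have smb : 0 < Num.sqrt (m * b)%:R :> R by rewrite sqrtr_gt0 ltr0n muln_gt0 m0.
have sle : Num.sqrt (m * b)%:R <= Num.sqrt T%:R :> R by rewrite ler_sqrt ?ltr0n// ler_nat.
have B0 : 0 < b%:R :> R by rewrite ltr0n.
rewrite hE subr_ge0 lef_pV2 ?posrE// sle /=.
set x := Num.sqrt (m * b)%:R in smb sle *; have sT' := sT; set y := Num.sqrt T%:R in sT' sle *.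
have x2 : x ^+ 2 = m%:R * b%:R by rewrite sqr_sqrtr// natrM.
have y2 : y ^+ 2 = T%:R by rewrite sqr_sqrtr.
have mE : m%:R = x ^+ 2 / b%:R by rewrite x2 mulfK// gt_eqF.
have y2le : y ^+ 2 <= x ^+ 2 + x ^+ 2 / b%:R.
  by rewrite -mE y2 x2 -natrM -natrD ler_nat ltnW.
have Bi0 : 0 <= (b%:R)^-1 :> R by rewrite invr_ge0 ltW.
have yx : y <= x * (1 + b%:R^-1).
  have p0 : 0 <= x * (1 + b%:R^-1) by rewrite mulr_ge0 ?addr_ge0 ?(ltW smb).
  rewrite -(@ler_sqr _ y) ?nnegrE ?(ltW sT')//; apply: le_trans y2le _.
  by rewrite exprMn; have := sqr_ge0 x; nra.
have : x^-1 <= y^-1 * (1 + b%:R^-1).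
  by rewrite ler_pdivlMl// ler_pdivrMr// mulrC.
by move=> H; lra.
Qed.

Let JB j : (j <= m)%N -> (j * b <= T)%N.
Proof. by move=> jm; apply: leq_trans mbT; rewrite leq_mul2r jm orbT. Qed.

Let diffS j k : (j <= m)%N -> (j * b <= k)%N -> (k <= j * b + (b + m))%N -> (k <= T)%N ->
  `|(Num.sqrt T%:R)^-1 * S k - h * S (j * b)%N| <= D + W / b%:R.
Proof.
move=> jm jk kj kT.
have -> : (Num.sqrt T%:R)^-1 * S k - h * S (j * b)%N =
  (Num.sqrt T%:R)^-1 * (S k - S (j * b)%N) - (h - (Num.sqrt T%:R)^-1) * S (j * b)%N by ring.
apply: le_trans (ler_normB _ _) _; apply: lerD.
  rewrite normrM gtr0_norm ?invr_gt0// ler_pdivrMl//; exact: SD.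
have /andP[h1 h2] := hT; rewrite normrM ger0_norm//.
apply: (@le_trans _ _ ((Num.sqrt T%:R)^-1 / b%:R * (Num.sqrt T%:R * W))).
  by apply: ler_pM => //; apply: SW; exact: JB.
by rewrite le_eqVlt; apply/orP; left; apply/eqP; field; rewrite !gt_eqF// ltr0n.
Qed.

(** A point [y] of the common grid lies in cell [y %/ m] of the grid of times and in block
    [y %/ T]. *)
Let indices y : (y <= m * T)%N ->
  [/\ (y %/ T <= m)%N, (y %/ m <= T)%N, (y %/ T * b <= y %/ m)%N &
      (y %/ m <= y %/ T * b + (b + m))%N].
Proof.
move=> yT.
have jm : (y %/ T <= m)%N by rewrite -(mulnK m T0) leq_div2r.
have h1 : (y %/ T * T <= y)%N by exact: leq_trunc_div.
have h2 := ltn_ceil y T0; have h3 := ltn_ceil y m0.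
have h4 : (y %/ m * m <= y)%N by exact: leq_trunc_div.
split=> //; first by rewrite -(mulKn T m0) leq_div2r.
  rewrite leq_divRL//; apply: leq_trans h1; rewrite -mulnA leq_mul2l (mulnC b) mbT.
  by rewrite orbT.
have : (y %/ m * m < (y %/ T).+1 * (m * b + m))%N.
  apply: leq_ltn_trans h4 _; apply: leq_trans h2 _.
  by rewrite leq_mul2l ltnW// orbT.
have -> : ((y %/ T).+1 * (m * b + m) = ((y %/ T).+1 * b.+1) * m)%N by rewrite -mulnA; congr (_ * _)%N; rewrite mulSn (mulnC m b) addnC.
rewrite ltn_pmul2r// mulnS mulSn.
by move: jm; set a := (y %/ T)%N; set c := (y %/ m)%N; set e := (a * b)%N; lia.
Qed.

Let fracs y : (y <= m * T)%N ->
  `|(y %/ m)%:R / T%:R - (y %/ T)%:R / m%:R| <= (m%:R)^-1 :> R.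
Proof.
move=> yT.
have M0 : 0 < m%:R :> R by rewrite ltr0n.
have TT0 : 0 < T%:R :> R by rewrite ltr0n.
have mT : (m <= T)%N by apply: leq_trans mbT; rewrite leq_pmulr.
have h1 : (y %/ T)%:R * T%:R <= y%:R :> R by rewrite -natrM ler_nat leq_trunc_div.
have h4 : (y %/ m)%:R * m%:R <= y%:R :> R by rewrite -natrM ler_nat leq_trunc_div.
have h2 : y%:R <= ((y %/ T)%:R + 1) * T%:R :> R.
  by rewrite natr1 -natrM ler_nat ltnW// ltn_ceil.
have h3 : y%:R <= ((y %/ m)%:R + 1) * m%:R :> R.
  by rewrite natr1 -natrM ler_nat ltnW// ltn_ceil.
have mT' : m%:R <= T%:R :> R by rewrite ler_nat.
set a := (y %/ m)%:R in h4 h3 *; set c := (y %/ T)%:R in h1 h2 *.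
have -> : a / T%:R - c / m%:R = (a * m%:R - c * T%:R) / (m%:R * T%:R).
  by field; rewrite !gt_eqF.
rewrite normrM (gtr0_norm (_ : 0 < (m%:R * T%:R)^-1)) ?invr_gt0 ?mulr_gt0//.
rewrite ler_pdivrMr ?mulr_gt0// mulKf ?gt_eqF//.
by rewrite ler_norml; apply/andP; split; lra.
Qed.

Let bridge_diff y : (y <= m * T)%N ->
  `|bridge T S (y %/ m) - (\sum_(i < y %/ T) p i - (y %/ T)%:R / m%:R * \sum_(i < m) p i)|
  <= 2 * D + 2 * W / b%:R + W / m%:R.
Proof.
move=> yT; have [jm kT jk kj] := indices yT; have hf := fracs yT.
rewrite !psumE /bridge.
set k := (y %/ m)%N in kT jk kj hf *; set j := (y %/ T)%N in jm jk kj hf *.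
have h1 := diffS jm jk kj kT.
have h2 : `|(Num.sqrt T%:R)^-1 * S T - h * S (m * b)%N| <= D + W / b%:R.
  by apply: diffS => //; lia.
set X := (Num.sqrt T%:R)^-1 * S T in h2 *; set Y := h * S (m * b)%N in h2 *.
have XW : `|X| <= W.
  by rewrite /X normrM gtr0_norm ?invr_gt0// ler_pdivrMl//; exact: SW.
have -> : (Num.sqrt T%:R)^-1 * (S k - k%:R / T%:R * S T) - (h * S (j * b)%N - j%:R / m%:R * Y)
  = ((Num.sqrt T%:R)^-1 * S k - h * S (j * b)%N) - (k%:R / T%:R - j%:R / m%:R) * X
    - j%:R / m%:R * (X - Y) by rewrite /X; ring.
have h3 : `|(k%:R / T%:R - j%:R / m%:R) * X| <= W / m%:R.
  by rewrite normrM mulrC ler_pM.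
have h4 : `|j%:R / m%:R * (X - Y)| <= D + W / b%:R.
  rewrite normrM -[leRHS]mul1r; apply: ler_pM => //.
  by rewrite ger0_norm ?divr_ge0// ler_pdivrMr ?ltr0n// mul1r ler_nat.
move: h1 h3 h4; rewrite !ler_norml => /andP[? ?] /andP[? ?] /andP[? ?].
by apply/andP; split; lra.
Qed.

Let vbridge_diff y : (y <= m * T)%N ->
  `|vbridge T (y %/ m) - vbridge m (y %/ T)| <= (m%:R)^-1.
Proof.
move=> yT; have [jm kT _ _] := indices yT; have := fracs yT.
have vE N k : (0 < N)%N -> vbridge N k = (k%:R / N%:R) * (1 - k%:R / N%:R).
  by move=> N0; rewrite /vbridge; field; rewrite pnatr_eq0 -lt0n.
rewrite !vE//.
have i1 : 0 <= ((y %/ m)%:R / T%:R : R) <= 1.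
  by rewrite divr_ge0//= ler_pdivrMr ?ltr0n// mul1r ler_nat.
have i2 : 0 <= ((y %/ T)%:R / m%:R : R) <= 1.
  by rewrite divr_ge0//= ler_pdivrMr ?ltr0n// mul1r ler_nat.
move: i1 i2; set u := _ / _; set v := _ / _ => /andP[? ?] /andP[? ?] h1.
have -> : u * (1 - u) - v * (1 - v) = (u - v) * (1 - (u + v)) by ring.
rewrite normrM -[leRHS]mulr1; apply: ler_pM => //.
by rewrite ler_norml; apply/andP; split; lra.
Qed.

Lemma Psi_compare bm : 2 * W <= r ->
  `|Psi bm T (hbridge T S) - Psi bm m (hskel r m p)| <=
  2 * r * (2 * D + 2 * W / b%:R + W / m%:R) + (m%:R)^-1.
Proof.
move=> Wr.
have r0 : 0 <= r by apply: le_trans Wr; rewrite mulr_ge0.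
rewrite (Psi_refine bm _ m0 T0) (Psi_refine bm _ T0 m0) (mulnC T m).
apply: Psi_close; first by rewrite muln_gt0 m0.
move=> y yT; have [jm kT jk kj] := indices yT.
rewrite /hbridge /hskel.
have BW : `|bridge T S (y %/ m)| <= r.
  apply: le_trans Wr; rewrite /bridge normrM gtr0_norm ?invr_gt0// ler_pdivrMl//.
  apply: le_trans (ler_normB _ _) _.
  have h1 := SW kT; have h2 := SW (leqnn T).
  have h3 : `|(y %/ m)%:R / T%:R * S T| <= Num.sqrt T%:R * W.
    rewrite normrM -[leRHS]mul1r; apply: ler_pM => //.
    by rewrite ger0_norm ?divr_ge0// ler_pdivrMr ?ltr0n// mul1r ler_nat.
  lra.
rewrite -{1}(clip_id BW).
have h1 := clip_sq (bridge T S (y %/ m))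
  (\sum_(i < y %/ T) p i - (y %/ T)%:R / m%:R * \sum_(i < m) p i) r0.
have h2 := ler_wpM2l (mulr_ge0 (ler0n R 2) r0) (bridge_diff yT).
have h3 := vbridge_diff yT.
move: (le_trans h1 h2) h3; rewrite !ler_norml => /andP[? ?] /andP[? ?].
by apply/andP; split; lra.
Qed.

End comparison.
End functionals.

(** * Convergence for the common factor *)

Section donsker.
Context {d : measure_display} {Omega : measurableType d} {R : realType}.
Variable P : probability Omega R.
Variables (zeta : nat -> nat -> Omega -> R) (K : R).
(** All windows of a row are needed: the oscillation over a block is the maximum of a walk restarted
    at its left end. *)
Hypothesis Hz : forall T k0 len, (0 < T)%N -> (k0 + len <= T)%N -> exists Fil,
  iseq P len (fun (_ : unit) j => zeta T (k0 + j)%N) Fil K.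

Let C4 : R := 16 * (8 + 2 * K) + 2.

Lemma zeta_measurable T j : (j < T)%N -> measurable_fun setT (zeta T j).
Proof.
move=> jT; have T0 : (0 < T)%N by exact: leq_ltn_trans jT.
have [Fil Z] := @Hz T 0 T T0 (leqnn T); exact: L4_meas (is_L4 Z tt jT).
Qed.

Lemma psum_measurable T k : (k <= T)%N -> measurable_fun setT (psum (zeta T) k).
Proof.
by move=> kT; apply: measurable_sum => j; apply: zeta_measurable; exact: leq_trans kT.
Qed.

Lemma psum_shift T k0 l w : psum (fun i => zeta T (k0 + i)%N) l w =
  psum (zeta T) (k0 + l) w - psum (zeta T) k0 w.
Proof.
rewrite /psum; elim: l => [|l IH]; first by rewrite big_ord0 addn0 subrr.
by rewrite big_ord_recr /= IH addnS big_ord_recr /=; ring.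
Qed.

Let K1 : 1 <= K.
Proof.
have [Fil Z] := @Hz 1 0 1 isT isT; exact: (iseq_K_ge1 Z tt).
Qed.

Let C40 : 0 <= C4. Proof. rewrite /C4; have := K1; lra. Qed.

Definition wmax T (w : Omega) : R := maxabs (zeta T) T w / Num.sqrt T%:R.

Lemma wmax_ge0 T w : 0 <= wmax T w.
Proof. by rewrite divr_ge0//; exact: rmax_ge0. Qed.

Let sq4 T : (0 < T)%N -> Num.sqrt T%:R ^+ 4 = T%:R ^+ 2 :> R.
Proof. by move=> T0; rewrite (_ : 4 = 2 * 2)%N// exprM sqr_sqrtr. Qed.

Let max4_norm n' T (u : Omega -> R) (c : R) : (0 < T)%N ->
  L4 P u /\ Ex P (fun w => u w ^+ 4) <= C4 * n'%:R ^+ 2 -> n'%:R <= c * T%:R -> 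
  L4 P (fun w => u w / Num.sqrt T%:R) /\
  Ex P (fun w => (u w / Num.sqrt T%:R) ^+ 4) <= C4 * c ^+ 2.
Proof.
move=> T0 [i4 e4] nc.
have T0' : 0 < T%:R :> R by rewrite ltr0n.
split; first by under eq_fun do rewrite mulrC; exact: L4Z.
have j4 : L1 P (fun w => u w ^+ 4) by have := i4.2.2; under eq_fun do rewrite -exprM.
have -> : (fun w => (u w / Num.sqrt T%:R) ^+ 4) = (fun w => (T%:R ^+ 2)^-1 * u w ^+ 4).
  by apply/funext => w; rewrite exprMn exprVn sq4// mulrC.
rewrite (ExZ _ j4) ler_pdivrMl ?exprn_gt0//; apply: le_trans e4 _.
rewrite [leRHS]mulrCA ler_wpM2l// mulrC -exprMn ler_sqr ?nnegrE//.
exact: le_trans nc.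
Qed.

Lemma wmax_L4 T : (0 < T)%N ->
  L4 P (wmax T) /\ Ex P (fun w => wmax T w ^+ 4) <= C4.
Proof.
move=> T0; have [Fil Z] := @Hz T 0 T T0 (leqnn T).
have h : T%:R <= 1 * T%:R :> R by rewrite mul1r.
by have := max4_norm T0 (walk_max4 Z tt) h; rewrite expr1n mulr1.
Qed.

Lemma wmax_ge T k w : (0 < T)%N -> (k <= T)%N ->
  `|psum (zeta T) k w| <= Num.sqrt T%:R * wmax T w.
Proof.
move=> T0 kT; rewrite mulrC divfK ?gt_eqF ?sqrtr_gt0 ?ltr0n//.
exact: (@rmax_ge _ (fun k => `|psum (zeta T) k w|)).
Qed.

Let blen T m b j : nat := minn (b + m) (T - j * b).

Let bmax T m b j w : R :=
  maxabs (fun i => zeta T (j * b + i)%N) (blen T m b j) w / Num.sqrt T%:R.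

Let dmax T m b w : R := rmax (fun j => bmax T m b j w) m.

Let dmax_ge T m b j k w : (0 < T)%N -> (j <= m)%N -> (j * b <= k)%N ->
  (k <= j * b + (b + m))%N -> (k <= T)%N ->
  `|psum (zeta T) k w - psum (zeta T) (j * b) w| <= Num.sqrt T%:R * dmax T m b w.
Proof.
move=> T0 jm jk kj kT.
apply: (@le_trans _ _ (Num.sqrt T%:R * bmax T m b j w)); last first.
  by rewrite ler_wpM2l// /dmax; exact: (@rmax_ge _ (fun j => bmax T m b j w)).
rewrite mulrC divfK ?gt_eqF ?sqrtr_gt0 ?ltr0n//.
rewrite -{1}(subnKC jk) -psum_shift.
have kl : (k - j * b <= blen T m b j)%N.
  by rewrite /blen leq_min; apply/andP; split; [rewrite leq_subLR|exact: leq_sub2r].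
exact: (@rmax_ge _ (fun l => `|psum (fun i => zeta T (j * b + i)%N) l w|) _ _ kl).
Qed.

Let bmax_L4 T m b j : (0 < T)%N -> (0 < m)%N -> (m <= b)%N -> b = (T %/ m)%N ->
  (j <= m)%N ->
  L4 P (bmax T m b j) /\ Ex P (fun w => bmax T m b j w ^+ 4) <= C4 * (2 / m%:R) ^+ 2.
Proof.
move=> T0 m0 mb bE jm.
have mbT : (m * b <= T)%N by rewrite bE mulnC leq_trunc_div.
have jbT : (j * b <= T)%N by apply: leq_trans mbT; rewrite leq_mul2r jm orbT.
have hl : (j * b + blen T m b j <= T)%N.
  by rewrite -{2}(subnKC jbT) leq_add2l geq_minr.
have [Fil Z] := @Hz T (j * b)%N (blen T m b j) T0 hl.
apply: (max4_norm T0 (walk_max4 Z tt)).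
rewrite mulrAC ler_pdivlMr ?ltr0n// -!natrM ler_nat.
apply: (@leq_trans ((b + m) * m)); first by rewrite leq_mul2r geq_minl orbT.
apply: (@leq_trans (2 * (m * b))); last by rewrite leq_mul2l.
by rewrite mulnDl mul2n -addnn (mulnC m b) leq_add2l leq_mul2r mb orbT.
Qed.

Let bmax_ge0 T m b j w : 0 <= bmax T m b j w.
Proof. by rewrite divr_ge0//; exact: rmax_ge0. Qed.

Let dmax_ge0 T m b w : 0 <= dmax T m b w.
Proof. by apply: rmax_ge0; exact: bmax_ge0. Qed.

(** From [x <= lam + x ^+ 4 / lam ^+ 3] and a sum over [m.+1] blocks of fourth moments of order
    m^(-2). *)
Let dmax_E T m b : (0 < T)%N -> (0 < m)%N -> (m <= b)%N -> b = (T %/ m)%N ->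
  L1 P (dmax T m b) /\ forall lam, 0 < lam ->
  Ex P (dmax T m b) <= lam + 8 * C4 / m%:R / lam ^+ 3.
Proof.
move=> T0 m0 mb bE.
have H j : (j < m.+1)%N -> L4 P (bmax T m b j) /\
    Ex P (fun w => bmax T m b j w ^+ 4) <= C4 * (2 / m%:R) ^+ 2.
  by rewrite ltnS; exact: bmax_L4.
have M0 : 0 < m%:R :> R by rewrite ltr0n.
have M1 : 1 <= m%:R :> R by rewrite ler1n.
have md : measurable_fun setT (dmax T m b).
  by apply: measurable_rmax => j jm; exact: L4_meas (H j _).1.
have j4 (j : 'I_m.+1) : L1 P (fun w => bmax T m b j w ^+ 4).
  by have := (H j (ltn_ord j)).1.2.2; under eq_fun do rewrite -exprM.
have js : L1 P (fun w => \sum_(j < m.+1) bmax T m b j w ^+ 4) by apply: L1_sum.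
have d4 w : dmax T m b w ^+ 4 <= \sum_(j < m.+1) bmax T m b j w ^+ 4.
  have [j jm E] := rmax_ex (fun j => bmax T m b j w) m; rewrite /dmax E.
  rewrite (bigD1 (Ordinal (jm : (j < m.+1)%N)))//= lerDl.
  by apply: sumr_ge0 => k _; rewrite exprn_even_ge0.
have dle lam w : 0 < lam -> dmax T m b w <= lam + (lam ^+ 3)^-1 *
    \sum_(j < m.+1) bmax T m b j w ^+ 4.
  move=> l0; have l3 : 0 < lam ^+ 3 by rewrite exprn_gt0.
  apply: (@le_trans _ _ (lam + (lam ^+ 3)^-1 * dmax T m b w ^+ 4)); last first.
    by rewrite lerD2l ler_wpM2l ?invr_ge0 ?(ltW l3).
  have := dmax_ge0 T m b w; set x := dmax _ _ _ _ => x0.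
  have p : 0 <= (lam ^+ 3)^-1 * x ^+ 4 by rewrite mulr_ge0 ?invr_ge0 ?exprn_ge0// ltW.
  case: (leP x lam) => xl; first by rewrite (le_trans xl)// lerDl.
  apply: (@le_trans _ _ ((lam ^+ 3)^-1 * x ^+ 4)); last by rewrite lerDr ltW.
  rewrite ler_pdivlMl// [x ^+ 4]exprSr ler_wpM2r//.
  by rewrite lerXn2r ?nnegrE// ltW.
have jd : L1 P (dmax T m b).
  apply: (L1_le md (L1D (L1_cst P 1) (L1Z (1 ^+ 3)^-1 js))) => w.
  by rewrite ger0_norm//; exact: dle.
split=> // lam l0; have l3 : 0 < lam ^+ 3 by rewrite exprn_gt0.
have j5 := L1Z (lam ^+ 3)^-1 js.
apply: (le_trans (Ex_le jd (L1D (L1_cst P lam) j5) (fun w => dle lam w l0))).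
rewrite (ExD (L1_cst P lam) j5) Ex_cst lerD2l (ExZ _ js) mulrC.
rewrite ler_wpM2r ?invr_ge0 ?(ltW l3)// Ex_sum//.
apply: (@le_trans _ _ (\sum_(j < m.+1) C4 * (2 / m%:R) ^+ 2)).
  by apply: ler_sum => j _; exact: (H j _).2.
rewrite sumr_const card_ord -[leLHS]mulr_natl.
rewrite [leLHS](_ : _ = 4 * C4 / m%:R * (m.+1%:R / m%:R)); last first.
  by field; rewrite gt_eqF.
rewrite [leRHS](_ : _ = 4 * C4 / m%:R * 2); last by field; rewrite gt_eqF.
rewrite ler_wpM2l ?divr_ge0 ?mulr_ge0//.
by rewrite ler_pdivrMr// -(natr1 m); lra.
Qed.

Definition walk_stat bm T (w : Omega) : R :=
  Psi bm T (hbridge T (fun k => psum (zeta T) k w)).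

Lemma bridge_wmax T k w : (0 < T)%N -> (k <= T)%N ->
  `|bridge T (fun k => psum (zeta T) k w) k| <= 2 * wmax T w.
Proof.
move=> T0 kT; have sT : 0 < Num.sqrt T%:R :> R by rewrite sqrtr_gt0 ltr0n.
rewrite /bridge normrM gtr0_norm ?invr_gt0// ler_pdivrMl//.
apply: le_trans (ler_normB _ _) _.
have h1 := wmax_ge w T0 kT; have h2 := wmax_ge w T0 (leqnn T).
have h3 : `|k%:R / T%:R * psum (zeta T) T w| <= Num.sqrt T%:R * wmax T w.
  rewrite normrM -[leRHS]mul1r; apply: ler_pM => //.
  by rewrite ger0_norm ?divr_ge0// ler_pdivrMr ?ltr0n// mul1r ler_nat.
lra.
Qed.

Lemma walk_stat_measurable bm T : measurable_fun setT (walk_stat bm T).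
Proof.
apply: Psi_measurable => k kT; apply: measurable_funB => //.
apply: measurable_funX; apply: measurable_funM => //.
apply: measurable_funB; first exact: psum_measurable.
by apply: measurable_funM => //; exact: psum_measurable.
Qed.

Let Ew T : (0 < T)%N -> [/\ L1 P (wmax T), L1 P (fun w => wmax T w ^+ 2),
  Ex P (wmax T) <= 1 + C4 & Ex P (fun w => wmax T w ^+ 2) <= 1 + C4].
Proof.
move=> T0; have [i4 e4] := wmax_L4 T0.
have j4 : L1 P (fun w => wmax T w ^+ 4) by have := i4.2.2; under eq_fun do rewrite -exprM.
have j1 := L2_L1 (L4_L2 i4); have j2 := (L4_L2 i4).2.
have js : L1 P (fun w => 1 + wmax T w ^+ 4) by apply: L1D => //; exact: L1_cst.
have b : Ex P (fun w => 1 + wmax T w ^+ 4) <= 1 + C4.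
  by rewrite (ExD (L1_cst P 1) j4) Ex_cst lerD2l.
have q w : wmax T w ^+ 4 = (wmax T w ^+ 2) ^+ 2 by rewrite -exprM.
split=> //; apply: le_trans b; apply: Ex_le => // w; rewrite q.
  have := sqr_ge0 (wmax T w ^+ 2 - 2^-1); have := sqr_ge0 (wmax T w - 2^-1); nra.
have := sqr_ge0 (wmax T w ^+ 2 - 2^-1); nra.
Qed.

Lemma walk_stat_L1 bm T : (0 < T)%N -> L1 P (walk_stat bm T) /\
  Ex P (fun w => `|walk_stat bm T w|) <= 4 * (1 + C4) + 1.
Proof.
move=> T0; have [_ j2 _ e2] := Ew T0.
have js : L1 P (fun w => 4 * wmax T w ^+ 2 + 1).
  by apply: L1D; [exact: L1Z|exact: L1_cst].
have le w : `|walk_stat bm T w| <= 4 * wmax T w ^+ 2 + 1.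
  apply: Psi_norm_le => // k kT; rewrite /hbridge.
  apply: le_trans (ler_normB _ _) _; apply: lerD.
    rewrite ger0_norm ?sqr_ge0//; have := bridge_wmax w T0 kT.
    by have := wmax_ge0 T w; rewrite ler_norml => ? /andP[? ?]; nra.
  have kT' : k%:R <= T%:R :> R by rewrite ler_nat.
  have T0' : 0 < T%:R :> R by rewrite ltr0n.
  have k0 : 0 <= k%:R :> R by [].
  rewrite /vbridge ger0_norm; last first.
    by rewrite divr_ge0 ?sqr_ge0// mulr_ge0// subr_ge0.
  by rewrite ler_pdivrMr ?exprn_gt0// mul1r; nra.
have j := L1_le (walk_stat_measurable bm T) js le.
split=> //; apply: (le_trans (Ex_le (L1_abs j) js le)).
by rewrite (ExD (L1Z 4 j2) (L1_cst P 1)) (ExZ _ j2) Ex_cst; lra.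
Qed.

(** Where [2 * wmax <= r] the truncation in [hskel] is inactive and the deterministic comparison
    applies; elsewhere [f] is merely bounded, and the event is rare. *)
Let skel_close bm (f : R -> R) (Lf M r lam : R) T m b :
  0 <= Lf -> (forall x y, `|f x - f y| <= Lf * `|x - y|) -> (forall x, `|f x| <= M) ->
  0 < r -> 0 < lam -> (0 < T)%N -> (0 < m)%N -> (m <= b)%N -> b = (T %/ m)%N ->
  `|Ex P (f \o walk_stat bm T) - Ex P (fun w => f (Psi bm m (hskel r m
     (blocks (fun _ : unit => zeta T) tt b ((Num.sqrt m%:R)^-1 / Num.sqrt b%:R) m w))))|
  <= 8 * M * (1 + C4) / r ^+ 2 + 4 * Lf * r * lam +
     Lf * (2 * r * (16 * C4 / lam ^+ 3 + 3 * (1 + C4)) + 1) / m%:R.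
Proof.
move=> Lf0 fL fM r0 l0 T0 m0 mb bE.
have M0 : 0 <= M by exact: le_trans (fM 0).
have b0 : (0 < b)%N by exact: leq_trans mb.
have Mm0 : 0 < m%:R :> R by rewrite ltr0n.
have B0 : 0 < b%:R :> R by rewrite ltr0n.
have bf : blip f by split; [exists Lf|exists M].
set h := _ / Num.sqrt b%:R.
set X := blocks _ _ _ _ _.
have [Fil Z] := @Hz T 0 T T0 (leqnn T).
have mbT : (m * b <= T)%N by rewrite bE mulnC leq_trunc_div.
(* The two sequences agree only below [m]; that [hskel] ignores the rest follows from its Lipschitz
   bound. *)
have mX w : forall j, (j <= m)%N -> hskel r m (X w) j = hskel r m (fun i =>
    h * (psum (zeta T) (i * b + b) w - psum (zeta T) (i * b) w)) j.
  move=> j jm; apply/eqP; rewrite -subr_eq0 -normr_le0.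
  apply: le_trans (hskel_lip _ _ m0 jm (ltW r0)) _.
  rewrite /dist1 big1 ?mulr0// => i _.
  by rewrite /X /blocks ltn_ord wsum_nseq subrr normr0.
have mXm : measurable_fun setT (fun w => Psi bm m (hskel r m (X w))).
  apply: (@lipm_measurable _ _ _ m (4 * r) (fun p => Psi bm m (hskel r m p))).
  - by rewrite mulr_ge0// ltW.
  - by move=> p q; apply: Psi_close => // k km; exact: hskel_lip (ltW r0).
  - move=> i im; have := past_blocks Z tt h mbT im; case=> _; exact: L1_meas.
have i1 : L1 P (f \o walk_stat bm T) by exact: L1_blip (walk_stat_measurable bm T).
have i2 : L1 P (f \o (fun w => Psi bm m (hskel r m (X w)))) by exact: L1_blip.
have [jw jw2 ew ew2] := Ew T0.
have [jd ed] := dmax_E T0 m0 mb bE.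
rewrite -(ExB i1 i2).
(* If [r < 2 * wmax], the trivial bound [2 * M] is at most [c1 * wmax ^+ 2]. *)
pose c1 := 8 * M / r ^+ 2.
pose U w := c1 * wmax T w ^+ 2 +
  Lf * ((4 * r) * dmax T m b w + (4 * r / b%:R + 2 * r / m%:R) * wmax T w + m%:R^-1).
have jU1 : L1 P (fun w => (4 * r) * dmax T m b w + (4 * r / b%:R + 2 * r / m%:R) * wmax T w).
  by apply: L1D; exact: L1Z.
have jU2 : L1 P (fun w => (4 * r) * dmax T m b w + (4 * r / b%:R + 2 * r / m%:R) * wmax T w
   + m%:R^-1) by apply: L1D => //; exact: L1_cst.
have jU : L1 P U by apply: L1D; exact: L1Z.
have le w : `|(f \o walk_stat bm T) w - (f \o (fun w => Psi bm m (hskel r m (X w)))) w| <= U w.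
  have w0 := wmax_ge0 T w; have d0 := dmax_ge0 T m b w.
  have p1 : 0 <= c1 * wmax T w ^+ 2.
    by rewrite mulr_ge0 ?sqr_ge0// divr_ge0 ?sqr_ge0// mulr_ge0.
  have p2 : 0 <= (4 * r / b%:R + 2 * r / m%:R) * wmax T w.
    by rewrite mulr_ge0// addr_ge0// divr_ge0 ?ltW// mulr_gt0.
  have p3 : 0 <= Lf * ((4 * r) * dmax T m b w + (4 * r / b%:R + 2 * r / m%:R) * wmax T w + m%:R^-1).
    by rewrite mulr_ge0// !addr_ge0 ?invr_ge0 ?(ltW Mm0)// !mulr_ge0// ltW.
  case: (leP (2 * wmax T w) r) => wr.
    apply: (@le_trans _ _ (Lf * ((4 * r) * dmax T m b w + (4 * r / b%:R + 2 * r / m%:R) * wmax T w + m%:R^-1))); last by rewrite /U lerDr.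
    apply: le_trans (fL _ _) _; rewrite ler_wpM2l//.
    have S0 : psum (zeta T) 0 w = 0 by rewrite /psum big_ord0.
    have := @Psi_compare R T m b (fun k => psum (zeta T) k w) (wmax T w) (dmax T m b w) r
      m0 b0 bE S0 (fun k kT => wmax_ge w T0 kT) (fun j k jm jk kj kT => dmax_ge w T0 jm jk kj kT) bm wr.
    rewrite -/h.
    have -> : Psi bm m (hskel r m (fun i => h * (psum (zeta T) (i * b + b) w -
        psum (zeta T) (i * b) w))) = Psi bm m (hskel r m (X w)).
      apply/eqP; rewrite -subr_eq0 -normr_le0; apply: Psi_close => // k km.
      by rewrite mX// subrr normr0.
    move=> /le_trans; apply; rewrite le_eqVlt; apply/orP; left; apply/eqP.
    by field; rewrite !gt_eqF.
  apply: (@le_trans _ _ (c1 * wmax T w ^+ 2)); last by rewrite /U lerDl.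
  apply: (@le_trans _ _ (2 * M)).
    apply: le_trans (ler_normB _ _) _.
    by have := fM (walk_stat bm T w); have := fM (Psi bm m (hskel r m (X w))); rewrite /=; lra.
  rewrite /c1 mulrAC ler_pdivlMr ?exprn_gt0//.
  have : r ^+ 2 <= 4 * wmax T w ^+ 2.
    by nra.
  by nra.
apply: (le_trans (Ex_abs_le (L1B i1 i2) jU le)).
rewrite /U (ExD (L1Z _ jw2) (L1Z _ jU2)) (ExZ _ jw2) (ExZ _ jU2).
rewrite (ExD jU1 (L1_cst P _)) Ex_cst (ExD (L1Z _ jd) (L1Z _ jw)) (ExZ _ jd) (ExZ _ jw).
have c10 : 0 <= c1 by rewrite divr_ge0 ?sqr_ge0// mulr_ge0.
have h1 : c1 * Ex P (fun w => wmax T w ^+ 2) <= c1 * (1 + C4) by rewrite ler_wpM2l.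
have h2 : (4 * r) * Ex P (dmax T m b) <= (4 * r) * (lam + 8 * C4 / m%:R / lam ^+ 3).
  by rewrite ler_wpM2l ?mulr_ge0 ?(ltW r0)//; exact: ed.
have h3 : (4 * r / b%:R + 2 * r / m%:R) * Ex P (wmax T) <= 6 * r / m%:R * (1 + C4).
  apply: ler_pM => //.
  - by rewrite addr_ge0// divr_ge0 ?ltW// mulr_gt0.
  - by apply: Ex_ge0 => w; exact: wmax_ge0.
  - have : b%:R^-1 <= m%:R^-1 :> R by rewrite lef_pV2 ?posrE// ler_nat.
    by have := r0; nra.
have h4 := ler_wpM2l Lf0 (lerD (lerD h2 h3) (lexx m%:R^-1)).
apply: le_trans (lerD h1 h4) _.
rewrite le_eqVlt; apply/orP; left; apply/eqP; rewrite /c1; field.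
by rewrite !gt_eqF.
Qed.

Theorem donsker bm f : blip f -> cvgn (fun T => Ex P (f \o walk_stat bm T)).
Proof.
move=> [[Lf Lf0 fL] [M fM]]; apply: cauchy_seq_cvg => e e0.
suff [l [N H]] : exists l N, forall T, (N <= T)%N ->
    `|Ex P (f \o walk_stat bm T) - l| <= e / 2.
  exists N => n k Nn Nk; have := H n Nn; have := H k Nk.
  by rewrite !ler_norml => /andP[? ?] /andP[? ?]; apply/andP; split; lra.
have M0 : 0 <= M by exact: le_trans (fM 0).
pose Q1 := 8 * M * (1 + C4).
have Cp : 0 <= 1 + C4 by have := C40; lra.
have Q10 : 0 <= Q1 by rewrite /Q1 !mulr_ge0.
(* The truncation level [r] comes first, then [lam], then the number [m] of blocks, each keeping its
   error below [e / 8]; the fourth [e / 8] is that of [block_clt], for large T. *)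
pose r := 1 + 8 * Q1 / e.
have Qe : 0 <= 8 * Q1 / e by rewrite divr_ge0 ?(ltW e0)// mulr_ge0.
have r1 : 1 <= r by rewrite lerDl.
have r0 : 0 < r by lra.
have hr : Q1 / r ^+ 2 <= e / 8.
  rewrite ler_pdivrMr ?exprn_gt0//.
  have E : Q1 = (r - 1) * (e / 8) by rewrite /r; field; rewrite gt_eqF.
  rewrite E mulrC; apply: ler_wpM2l; first by rewrite divr_ge0// ltW.
  nra.
pose lam := e / (32 * (Lf + 1) * r).
have Lf1 : 0 < Lf + 1 by lra.
have l0 : 0 < lam by rewrite divr_gt0// !mulr_gt0.
have hl : 4 * Lf * r * lam <= e / 8.
  rewrite [leLHS](_ : _ = (Lf / (Lf + 1)) * (e / 8)); last first.
    by rewrite /lam; field; rewrite !gt_eqF.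
  rewrite -[leRHS]mul1r ler_wpM2r ?divr_ge0 ?(ltW e0)//.
  by rewrite ler_pdivrMr// mul1r lerDl.
pose Q := Lf * (2 * r * (16 * C4 / lam ^+ 3 + 3 * (1 + C4)) + 1).
pose m := (Num.bound (8 * Q / e)).+1.
have Q0 : 0 <= Q.
  have a1 : 0 <= 16 * C4 / lam ^+ 3.
    by apply: divr_ge0; [rewrite mulr_ge0// C40|rewrite exprn_ge0// ltW].
  have a2 : 0 <= 16 * C4 / lam ^+ 3 + 3 * (1 + C4) by lra.
  by rewrite /Q; apply: mulr_ge0 => //; nra.
have m0 : (0 < m)%N by [].
have hm : Q / m%:R <= e / 8.
  rewrite ler_pdivrMr ?ltr0n//.
  have h1 : 8 * Q / e <= m%:R.
    apply: le_trans (ltW (archi_boundP _)) _.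
      by rewrite divr_ge0 ?(ltW e0)// mulr_ge0.
    by rewrite ler_nat; exact: leqnSn.
  move: h1; rewrite ler_pdivrMr//; lra.
have [B HB] := @block_clt R d Omega P m (Lf * (4 * r)) K (e / 8) m0
  (mulr_ge0 Lf0 (mulr_ge0 (ler0n R 4) (ltW r0))) (divr_gt0 e0 (ltr0Sn R 7)).
exists (Nops (Num.sqrt m%:R)^-1 (fun p => f (Psi bm m (hskel r m p))) 0 m (fun=> 0)).
exists (m * (maxn B m))%N => T mT.
set b := (T %/ m)%N.
have hb : (maxn B m <= b)%N by rewrite leq_divRL// mulnC.
have Bb : (B <= b)%N by apply: leq_trans hb; exact: leq_maxl.
have mb : (m <= b)%N by apply: leq_trans hb; exact: leq_maxr.
have T0 : (0 < T)%N.
  by apply: leq_trans mT; rewrite muln_gt0 m0 /= leq_max m0 orbT.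
have mbT : (m * b <= T)%N by rewrite mulnC leq_trunc_div.
have [Fil Z] := @Hz T 0 T T0 (leqnn T).
have FL : lipm m (Lf * (4 * r)) (fun p => f (Psi bm m (hskel r m p))).
  move=> p q; apply: le_trans (fL _ _) _; rewrite -mulrA ler_wpM2l//.
  by apply: Psi_close => // k km; exact: hskel_lip (ltW r0).
have h1 := HB b _ T (fun _ : unit => zeta T) Fil K tt _ Bb mbT (lexx K) Z FL.
have h2 := skel_close bm Lf0 fL fM r0 l0 T0 m0 mb erefl.
rewrite -/b -/Q1 -/Q in h1 h2.
move: h1 h2; rewrite !ler_norml => /andP[? ?] /andP[? ?].
by apply/andP; split; lra.
Qed.

End donsker.

(** * Non-degeneracy of the limit *)

Section rademacher_tail.
Context {R : realType}.
Implicit Types (x th c : R) (g : R -> R) (cs : seq R).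

(** The hyperbolic cosine, exponential moment of a fair sign. *)
Definition ch x : R := (expR x + expR (- x)) / 2.

Let eN x : expR x * expR (- x) = 1.
Proof. by rewrite -expRD subrr expR0. Qed.

Lemma ch_gt0 x : 0 < ch x.
Proof. by rewrite divr_gt0// addr_gt0// expR_gt0. Qed.

Lemma ch_ge x : x ^+ 2 <= 8 -> expR (x ^+ 2 / 16) <= ch x.
Proof.
move=> x8.
(* With u and v the exponentials of x/2 and -x/2, the cosine is 1 + (u - v)^2 / 2, and u - v is at
   least x/2 in absolute value. *)
have h1 : 1 + x ^+ 2 / 8 <= ch x.
  pose u := expR (x / 2); pose v := expR (- (x / 2)).
  have uv : u * v = 1 by exact: eN.
  have eu : expR x = u ^+ 2 by rewrite -expRM_natl; congr expR; field.
  have ev : expR (- x) = v ^+ 2 by rewrite -expRM_natl; congr expR; field.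
  have u1 : 1 + x / 2 <= u by exact: expR_ge1Dx.
  have v1 : 1 - x / 2 <= v by exact: expR_ge1Dx.
  have u0 : 0 < u by exact: expR_gt0.
  have v0 : 0 < v by exact: expR_gt0.
  have key : (x / 2) ^+ 2 <= (u - v) ^+ 2.
    case: (leP 0 x) => x0.
      have : x / 2 <= u - v.
        have : (1 + x / 2) * v <= 1 by rewrite -[leRHS]uv ler_wpM2r// ltW.
        nra.
      by nra.
    have : - (x / 2) <= v - u.
      have : (1 - x / 2) * u <= 1 by rewrite -[leRHS]uv mulrC ler_wpM2l// ltW.
      nra.
    by nra.
  rewrite /ch eu ev; nra.
apply: le_trans h1.
have p : 0 <= x ^+ 2 := sqr_ge0 x.
have h2 : 1 - x ^+ 2 / 16 <= expR (- (x ^+ 2 / 16)) by exact: expR_ge1Dx.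
have h3 := eN (x ^+ 2 / 16); have h4 := expR_gt0 (x ^+ 2 / 16).
set e := expR (x ^+ 2 / 16) in h3 h4 *; set e' := expR (- _) in h2 h3.
have h5 : e * (1 - x ^+ 2 / 16) <= 1 by rewrite -[leRHS]h3 ler_wpM2l// ltW.
nra.
Qed.

Lemma ch_le x : x ^+ 2 <= 4^-1 -> ch x <= expR (2 * x ^+ 2).
Proof.
move=> x4; apply: le_trans (expR_ge1Dx _); rewrite /ch.
have h1 : 1 - x <= expR (- x) by exact: expR_ge1Dx.
have h2 : 1 + x <= expR x by exact: expR_ge1Dx.
have h3 := eN x; have h4 := expR_gt0 x; have h5 := expR_gt0 (- x).
set e := expR x in h2 h3 h4 *; set e' := expR (- x) in h1 h3 h5 *.
have x1 : -1 < x by nra.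
have x2 : x < 1 by nra.
have k1 : e * (1 - x) <= 1 by rewrite -[leRHS]h3 ler_wpM2l// ltW.
have k2 : e' * (1 + x) <= 1 by rewrite -[leRHS]h3 mulrC ler_wpM2r// ltW.
have k3 : e * ((1 - x) * (1 + x)) <= 1 + x by nra.
have k4 : e' * ((1 - x) * (1 + x)) <= 1 - x by nra.
have k5 : (e + e') * (1 - x ^+ 2) <= 2 by nra.
have p : 0 < 1 - x ^+ 2 by nra.
have k6 : (e + e') * (1 - x ^+ 2) <= 2 * ((1 + 2 * x ^+ 2) * (1 - x ^+ 2)).
  by apply: le_trans k5 _; have := sqr_ge0 x; nra.
have := k6; rewrite mulrA ler_pM2r// => k7; lra.
Qed.

Definition rops cs g := foldr rop g cs.

Lemma rops_le cs g g' : (forall x, g x <= g' x) -> forall x, rops cs g x <= rops cs g' x.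
Proof.
move=> H; elim: cs => //= c cs IH x; rewrite /rop ler_wpM2r ?invr_ge0//.
exact: lerD.
Qed.

Lemma rops_lin cs g1 g2 a b e x :
  rops cs (fun y => a + b * g1 y + e * g2 y) x = a + b * rops cs g1 x + e * rops cs g2 x.
Proof. by elim: cs x => //= c cs IH x; rewrite /rop !IH; field. Qed.

Lemma rops_exp cs th x : rops cs (fun y => expR (th * y)) x =
  expR (th * x) * \prod_(c <- cs) ch (th * c).
Proof.
elim: cs x => /= [|c cs IH] x; first by rewrite big_nil mulr1.
by rewrite /rop !IH big_cons /ch !mulrDr mulrN !expRD; field.
Qed.

Lemma prod_expR (r : seq R) (f : R -> R) :
  \prod_(c <- r) expR (f c) = expR (\sum_(c <- r) f c).
Proof.
elim: r => [|c r IH]; first by rewrite !big_nil expR0.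
by rewrite !big_cons expRD IH.
Qed.

(* With theta large, the part of E exp(theta S) where S <= A + 1 or S >= 2 theta
   is too small, so S > A has positive probability. *)
Lemma rops_tail (A : R) : 0 <= A -> exists p del : R, [/\ 0 < p, 0 < del &
  forall cs, 16^-1 <= \sum_(c <- cs) c ^+ 2 <= 4^-1 ->
    (forall c, c \in cs -> c ^+ 2 <= del) ->
    p <= rops cs (fun y => 1 - ramp A 1 y) 0].
Proof.
(* 256 is the product of the 16 of [ch_ge] and the 16 of the variance bound, so that
   [th ^+ 2 / 256 = th * (A + 1) + 2 * th]. *)
move=> A0; have [th [th1 thE]] : exists th, 1 <= th /\ th = 256 * (A + 3).
  by exists (256 * (A + 3)); split=> //; lra.
have th0 : 0 < th by lra.
(* With this [del] the estimates [ch_ge] at [th * c] and [ch_le] at [2 * th * c] are both in their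
   range. *)
exists (expR (- (2 * th ^+ 2))), (16 * th ^+ 2)^-1; split.
- exact: expR_gt0.
- by rewrite invr_gt0 mulr_gt0// exprn_gt0.
move=> cs /andP[V1 V2] small.
have sm c : c \in cs -> (th * c) ^+ 2 <= 16^-1.
  move=> /small; rewrite -[leRHS]mul1r ler_pdivlMr ?mulr_gt0 ?exprn_gt0//.
  by rewrite exprMn => h; lra.
have e2 : 3 <= expR 2 :> R by have := @expR_ge1Dx R 2; lra.
have lower : expR (th * (A + 1)) + 2 <= \prod_(c <- cs) ch (th * c).
  apply: (@le_trans _ _ (expR (th ^+ 2 / 256))).
    have -> : th ^+ 2 / 256 = th * (A + 1) + 2 * th by rewrite expr2 {2}thE; field.
    have : expR (th * (A + 1) + 2) <= expR (th * (A + 1) + 2 * th).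
      by rewrite ler_expR lerD2l; lra.
    apply: le_trans; rewrite expRD.
    have : 1 <= expR (th * (A + 1)) by rewrite -[leLHS]expR0 ler_expR mulr_ge0 ?(ltW th0)//; lra.
    by nra.
  apply: (@le_trans _ _ (\prod_(c <- cs) expR ((th * c) ^+ 2 / 16))).
    rewrite prod_expR ler_expR.
    rewrite (eq_bigr (fun c => th ^+ 2 / 16 * c ^+ 2)); last by move=> c _; field.
    rewrite -mulr_sumr.
    have : 0 <= th ^+ 2 by exact: sqr_ge0.
    by nra.
  rewrite big_seq [leRHS]big_seq; apply: ler_prod => c ccs.
  by rewrite expR_ge0 ch_ge//; apply: le_trans (sm c ccs) _; lra.
have upper : \prod_(c <- cs) ch (2 * th * c) <= expR (2 * th ^+ 2).
  apply: (@le_trans _ _ (\prod_(c <- cs) expR (2 * (2 * th * c) ^+ 2))).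
    rewrite big_seq [leRHS]big_seq; apply: ler_prod => c ccs.
    rewrite (ltW (ch_gt0 _)) /=; apply: ch_le.
    by have := sm c ccs; rewrite !exprMn; lra.
  rewrite prod_expR ler_expR.
  rewrite (eq_bigr (fun c => 8 * th ^+ 2 * c ^+ 2)); last by move=> c _; ring.
  rewrite -mulr_sumr.
  have : 0 <= th ^+ 2 by exact: sqr_ge0.
  by nra.
pose G y : R := 1 - ramp A 1 y.
(* Pointwise, the exponential is bounded by the first term up to [A + 1], by the second up to
   [2 * th] and by the third beyond. *)
have key : \prod_(c <- cs) ch (th * c) <= expR (th * (A + 1)) +
    expR (2 * th ^+ 2) * rops cs G 0 +
    expR (- (2 * th ^+ 2)) * \prod_(c <- cs) ch (2 * th * c).
  have := rops_exp cs (2 * th) 0; rewrite mulr0 expR0 mul1r => <-.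
  have := rops_exp cs th 0; rewrite mulr0 expR0 mul1r => <-.
  rewrite -rops_lin; apply: rops_le => y.
  have /andP[r0 r1] := ramp_itv A 1 y.
  have p1 := expR_gt0 (th * (A + 1)); have p2 := expR_gt0 (2 * th ^+ 2).
  have p3 := expR_gt0 (- (2 * th ^+ 2)); have p4 := expR_gt0 (2 * th * y).
  have p5 : 0 <= expR (2 * th ^+ 2) * G y by rewrite mulr_ge0 ?expR_ge0// subr_ge0.
  have p6 : 0 <= expR (- (2 * th ^+ 2)) * expR (2 * th * y) by rewrite mulr_ge0 ?expR_ge0.
  case: (leP y (A + 1)) => h1.
    have : expR (th * y) <= expR (th * (A + 1)) by rewrite ler_expR ler_wpM2l// ltW.
    by lra.
  case: (leP y (2 * th)) => h2.
    have : expR (th * y) <= expR (2 * th ^+ 2) * G y.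
      rewrite /G ramp_right ?ltr01 ?(ltW h1)// subr0 mulr1 ler_expR.
      by rewrite expr2 mulrCA ler_wpM2l// ltW.
    by lra.
  have : expR (th * y) <= expR (- (2 * th ^+ 2)) * expR (2 * th * y).
    rewrite -expRD ler_expR; nra.
  by lra.
have b3 : expR (- (2 * th ^+ 2)) * \prod_(c <- cs) ch (2 * th * c) <= 1.
  rewrite -[leRHS](eN (2 * th ^+ 2)) mulrC ler_wpM2r ?expR_ge0//.
have b4 : 1 <= expR (2 * th ^+ 2) * rops cs G 0 by lra.
rewrite -[leLHS]mulr1; apply: le_trans (ler_wpM2l (expR_ge0 _) b4) _.
by rewrite mulrA [X in X * _]mulrC eN mul1r.
Qed.

Lemma line_Rops j cs (F : (nat -> R) -> R) p :
  line (Rops j cs F) p j = rops cs (line F p j).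
Proof. by elim: cs => //= c cs IH; rewrite line_Rop IH. Qed.

End rademacher_tail.

Section nondegenerate.
Context {d : measure_display} {Omega : measurableType d} {R : realType}.
Variable P : probability Omega R.
Variables (zeta : nat -> nat -> Omega -> R) (K : R).
Hypothesis Hz : forall T k0 len, (0 < T)%N -> (k0 + len <= T)%N -> exists Fil,
  iseq P len (fun (_ : unit) j => zeta T (k0 + j)%N) Fil K.

(** The weight of innovation [t] in the time average of the bridge. *)
Let coef (T t : nat) : R := (Num.sqrt T%:R)^-1 * ((T%:R - 1) / 2 - t%:R) / T%:R.

Let sum_psum (x : nat -> Omega -> R) n w :
  \sum_(k < n) psum x k w = \sum_(t < n) (n%:R - 1 - t%:R) * x t w.
Proof.
elim: n => [|n IH]; first by rewrite !big_ord0.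
rewrite !big_ord_recr /= IH /psum -(natr1 n) addrK subrr mul0r addr0 -big_split /=.
by apply: eq_bigr => t _; ring.
Qed.

Let sum_id n : \sum_(k < n) (k%:R : R) = n%:R * (n%:R - 1) / 2.
Proof.
elim: n => [|n IH]; first by rewrite big_ord0 !mul0r.
by rewrite big_ord_recr /= IH -(natr1 n); field.
Qed.

Let sum_sq (a : R) n : \sum_(t < n) (a - t%:R) ^+ 2 =
  n%:R * a ^+ 2 - a * (n%:R * (n%:R - 1)) + n%:R * (n%:R - 1) * (2 * n%:R - 1) / 6.
Proof.
elim: n => [|n IH]; first by rewrite big_ord0; ring.
by rewrite big_ord_recr /= IH -(natr1 n); field.
Qed.

Let mean_bridge T w : (0 < T)%N ->
  (\sum_(k < T) bridge T (fun k => psum (zeta T) k w) k) / T%:R =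
  \sum_(t < T) coef T t * zeta T t w.
Proof.
move=> T0; have T0' : T%:R != 0 :> R by rewrite pnatr_eq0 -lt0n.
rewrite /bridge -mulr_sumr sumrB sum_psum -mulr_suml.
have -> : \sum_(k < T) (k%:R / T%:R : R) = (T%:R - 1) / 2.
  by rewrite -mulr_suml sum_id; field.
rewrite /psum mulr_sumr -sumrB mulr_sumr mulr_suml.
by apply: eq_bigr => t _; rewrite /coef; field; rewrite T0' gt_eqF// sqrtr_gt0 ltr0n.
Qed.

(** The maximum dominates the mean, the mean of squares dominates the square of the mean, and
    [vbridge] is at most 1/4. *)
Let walk_stat_ge bm T w : (0 < T)%N ->
  (\sum_(t < T) coef T t * zeta T t w) ^+ 2 - 4^-1 <= walk_stat zeta bm T w.
Proof.
move=> T0; rewrite -mean_bridge//.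
suff h : ((\sum_(k < T) bridge T (fun k => psum (zeta T) k w) k) / T%:R) ^+ 2 - 4^-1
    <= walk_stat zeta false T w.
  by case: bm => //; exact: le_trans (Psi_mean_le_max _ T0).
rewrite /walk_stat /=; set B := bridge T _; set mb := _ / T%:R.
have T0' : 0 < T%:R :> R by rewrite ltr0n.
rewrite ler_pdivlMr//.
apply: (@le_trans _ _ (\sum_(k < T) (2 * mb * B k - mb ^+ 2 - 4^-1))).
  rewrite !sumrB -mulr_sumr !sumr_const card_ord.
  have -> : \sum_(k < T) B k = mb * T%:R by rewrite divfK// gt_eqF.
  rewrite -(mulr_natr (mb ^+ 2) T) -(mulr_natr 4^-1 T).
  by rewrite le_eqVlt; apply/orP; left; apply/eqP; ring.
apply: ler_sum => k _; rewrite /hbridge -/B.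
have : vbridge T k <= 4^-1 :> R.
  rewrite /vbridge ler_pdivrMr ?exprn_gt0//.
  by have := sqr_ge0 (T%:R - 2 * k%:R : R); lra.
by have := sqr_ge0 (B k - mb); lra.
Qed.

Let cs T := map (coef T) (iota 0 T).

Let wsum_map T n s w (Z := fun _ : unit => zeta T) :
  wsum Z tt (map (coef T) (iota s n)) s w =
  \sum_(t < n) coef T (s + t) * zeta T (s + t)%N w.
Proof.
elim: n s => [|n IH] s /=; first by rewrite big_ord0.
rewrite IH big_ord_recl addn0; congr (_ + _).
by apply: eq_bigr => t _; rewrite /= /bump add1n addSnnS.
Qed.

Let cs_sum (f : R -> R) T : \sum_(c <- cs T) f c = \sum_(t < T) f (coef T t).
Proof.
by rewrite big_map -[RHS](big_mkord xpredT (fun t => f (coef T t))) /index_iota subn0.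
Qed.

Let coef_sq T t : (1 < T)%N -> (t < T)%N -> coef T t ^+ 2 <= (T%:R)^-1.
Proof.
move=> T1 tT; have T0 : (0 < T)%N by exact: ltnW.
have T0' : 0 < T%:R :> R by rewrite ltr0n.
rewrite /coef !exprMn !exprVn sqr_sqrtr//.
rewrite -mulrA -[leRHS]mulr1 ler_wpM2l ?invr_ge0// ler_pdivrMr ?exprn_gt0// mul1r.
have h : t%:R + 1 <= T%:R :> R by rewrite natr1 ler_nat.
have : 0 <= t%:R :> R by [].
by move=> t0; nra.
Qed.

(** The sum is (T^2 - 1) / (12 T^2), which increases from 1/16 at T = 2 to 1/12. *)
Let coef_V T : (1 < T)%N -> 16^-1 <= \sum_(c <- cs T) c ^+ 2 <= 4^-1.
Proof.
move=> T1; have T0 : (0 < T)%N by exact: ltnW.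
have T2 : 2 <= T%:R :> R by rewrite ler_nat.
have T0' : 0 < T%:R :> R by rewrite ltr0n.
rewrite (cs_sum (fun c => c ^+ 2)).
have -> : \sum_(t < T) coef T t ^+ 2 = (T%:R ^+ 2 - 1) / (12 * T%:R ^+ 2).
  rewrite (eq_bigr (fun t : 'I_T => (T%:R ^+ 3)^-1 * ((T%:R - 1) / 2 - t%:R) ^+ 2)).
    by rewrite -mulr_sumr sum_sq; field; rewrite gt_eqF.
  move=> t _; rewrite /coef !exprMn !exprVn sqr_sqrtr//.
  by field; rewrite gt_eqF.
rewrite ler_pdivrMr ?ler_pdivlMr ?mulr_gt0 ?exprn_gt0//.
by apply/andP; split; nra.
Qed.

Lemma walk_stat_tail bm (A : R) : exists p : R, 0 < p /\ exists N, forall T, (N <= T)%N ->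
  p <= Ex P ((fun x => 1 - ramp A 1 x) \o walk_stat zeta bm T).
Proof.
(* A time average above [B] makes the statistic exceed [A + 1]. *)
pose B := `|A| + 3.
have B0 : 0 <= B by rewrite addr_ge0.
have [p [del [p0 del0 H]]] := @rops_tail R B B0.
exists (p / 2); split; first by rewrite divr_gt0.
have K1 : 1 <= K.
  have [Fil Z] := @Hz 1 0 1 isT isT; exact: (iseq_K_ge1 Z tt).
pose G y : R := 1 - ramp B 1 y.
have GL : lip1 1 G.
  move=> x y; rewrite /G opprB addrCA [X in `|X|](_ : _ = ramp B 1 y - ramp B 1 x); last by ring.
  have := ramp_lip B B y x (@ltr01 R); rewrite subrr normr0 addr0 invr1 distrC.
  by rewrite (distrC y) distrC.
(* A single coordinate suffices: the time average is one weighted sum of innovations, replaced as a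
   whole by fair signs. *)
pose F (q : nat -> R) := G (q 0%N).
have FL : lipm 1 1 F.
  by move=> q q'; rewrite mul1r /dist1 big_ord1; have := GL (q 0%N) (q' 0%N); rewrite mul1r.
pose a := p / 16.
have a0 : 0 < a by rewrite divr_gt0.
pose Q := 4 * 1 / a ^+ 2 * (2 + K).
have Q0 : 0 <= Q.
  by rewrite /Q mulr_ge0 ?divr_ge0 ?exprn_ge0 ?(ltW a0)//; lra.
pose N := (maxn 2 (maxn (Num.bound (del^-1)) (Num.bound ((4 * Q / p) ^+ 2)).+1))%N.
exists N => T; rewrite !geq_max => /andP[T1 /andP[T2 T3]].
have T0 : (0 < T)%N by exact: ltnW.
have T0' : 0 < T%:R :> R by rewrite ltr0n.
have sT : 0 < Num.sqrt T%:R :> R by rewrite sqrtr_gt0.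
have small c : c \in cs T -> c ^+ 2 <= (T%:R)^-1.
  by move=> /mapP[t]; rewrite mem_iota => /andP[_ tT] ->; exact: coef_sq.
have hdel : (T%:R)^-1 <= del.
  rewrite -(invrK del) lef_pV2 ?posrE ?invr_gt0//.
  apply: le_trans (ltW (archi_boundP _)) _; first by rewrite invr_ge0 ltW.
  by rewrite ler_nat.
have hp := H (cs T) (coef_V T1) (fun c cc => le_trans (small c cc) hdel).
have [Fil Z] := @Hz T 0 T T0 (leqnn T).
have tn : (0 + size (cs T) <= T)%N by rewrite size_map size_iota.
have pX : past P Fil 1 0 (fun _ _ => 0).
  by move=> i _; split; [exact: measurable_cst|exact: L1_cst].
have h1 := lindeberg_lip Z tt 0 tn ler01 a0 FL pX.
have h2 : \sum_(c <- cs T) `|c| ^+ 3 <= (Num.sqrt T%:R)^-1.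
  apply: (@le_trans _ _ ((Num.sqrt T%:R)^-1 * \sum_(c <- cs T) c ^+ 2)).
    rewrite mulr_sumr big_seq [leRHS]big_seq; apply: ler_sum => c ccs.
    rewrite exprS real_normK ?num_real// ler_wpM2r ?sqr_ge0//.
    rewrite -(@ler_sqr _ `|c|) ?nnegrE ?invr_ge0 ?(ltW sT)//.
    by rewrite real_normK ?num_real// exprVn sqr_sqrtr//; exact: small.
  rewrite -[leRHS]mulr1 ler_wpM2l ?invr_ge0 ?(ltW sT)//.
  by have /andP[_ h] := coef_V T1; apply: le_trans h _; lra.
have h3 : Q * \sum_(c <- cs T) `|c| ^+ 3 <= p / 4.
  apply: le_trans (ler_wpM2l Q0 h2) _; rewrite ler_pdivrMr//.
  have : 4 * Q / p <= Num.sqrt T%:R.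
    have q : 0 <= 4 * Q / p by rewrite divr_ge0 ?(ltW p0)// mulr_ge0.
    rewrite -[leLHS](ger0_norm q) -sqrtr_sqr.
    rewrite ler_sqrt//; apply: le_trans (ltW (archi_boundP (sqr_ge0 _))) _.
    by rewrite ler_nat; exact: ltnW.
  rewrite ler_pdivrMr//; lra.
have E1 : Ex P (fun w => Rops 0 (cs T) F (fun=> 0)) = rops (cs T) G 0.
  rewrite Ex_cst -[LHS](line0 _ _ 0) line_Rops.
  by congr (rops _ _ _); apply/funext => y; rewrite /line /F /incr /= add0r.
have E2 w : F (incr 0 (wsum (fun _ : unit => zeta T) tt (cs T) 0 w) (fun=> 0)) =
   G (\sum_(t < T) coef T t * zeta T t w).
  by rewrite /F /incr /= add0r wsum_map.
rewrite E1 (funext E2) -/Q in h1.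
have mG : measurable_fun setT (fun w => \sum_(t < T) coef T t * zeta T t w).
  apply: measurable_sum => t; apply: measurable_funM => //.
  exact: (zeta_measurable Hz (ltn_ord t)).
have bG x : blip (fun y : R => 1 - ramp x 1 y).
  by apply: blipB; [exact: blip_cst|exact: blip_ramp].
have h4 : Ex P (fun w => G (\sum_(t < T) coef T t * zeta T t w)) <=
   Ex P ((fun x => 1 - ramp A 1 x) \o walk_stat zeta bm T).
  apply: Ex_le.
  - exact: (L1_blip P (bG B) mG).
  - exact: (L1_blip P (bG A) (walk_stat_measurable Hz bm T)).
  move=> w; have := walk_stat_ge bm w T0; set mu := \sum_(t < T) _ => hmu /=.
  have /andP[r0 r1] := ramp_itv A 1 (walk_stat zeta bm T w).
  have /andP[r2 r3] := ramp_itv B 1 mu.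
  case: (leP mu B) => hB; first by rewrite /G ramp_left// subrr subr_ge0.
  have hA : A + 1 <= walk_stat zeta bm T w.
    apply: le_trans hmu; have := ler_norm A; have := normr_ge0 A.
    by move: hB; rewrite /B; nra.
  by rewrite [X in _ <= 1 - X]ramp_right// subr0 /G gerBl.
have a16 : p = 16 * a by rewrite /a; field.
move: h1; rewrite ler_norml => /andP[h1 _]; apply: le_trans h4; lra.
Qed.

Lemma walk_law_nondegenerate bm (L : probability R R) :
  (forall f, blip f -> Ex P (f \o walk_stat zeta bm n) @[n --> \oo] --> Ex L f) ->
  non_degenerate L.
Proof.
move=> H [c Lc].
have [p [p0 [N HN]]] := walk_stat_tail bm c.
have bG : blip (fun y : R => 1 - ramp c 1 y).
  by apply: blipB; [exact: blip_cst|exact: blip_ramp].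
have mC : measurable (~` [set c] : set R) by apply: measurableC; exact: measurable_set1.
(* This function vanishes at [c], where a point mass would put everything, yet its limit mean is at
   least [p]. *)
have L0 : Ex L (fun y : R => 1 - ramp c 1 y) <= 0.
  have iI : L1 L (\1_(~` [set c]) : R -> R).
    apply: (@L1_bounded _ _ _ _ _ 1); first exact: measurable_indic.
    by move=> w; rewrite indicE; case: (_ \in _); rewrite ?normr1 ?normr0.
  apply: (@le_trans _ _ (Ex L (\1_(~` [set c]) : R -> R))).
    apply: Ex_le => //; first exact: (L1_blip L (Y := idfun) bG (@measurable_id _ _ _)).
    move=> y; rewrite indicE; have /andP[r0 r1] := ramp_itv c 1 y.
    case: (boolP (_ \in _)) => [_|]; first by rewrite gerBl.
    by rewrite notin_setE /= => /contrapT ->; rewrite ramp_left// subrr.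
  rewrite /Ex /Rintegral integral_indic// setIT.
  have e : (L (~` [set c]) = 0)%E.
    by have := probability_setC L (measurable_set1 c); rewrite Lc subee// => ->.
  rewrite (_ : fine _ = 0)//; rewrite -[RHS]/(fine 0%E); congr fine; exact: e.
have h := H _ bG.
have : p <= Ex L (fun y : R => 1 - ramp c 1 y).
  rewrite -(cvg_lim (@Rhausdorff R) h); apply: limr_ge; first exact: cvgP h.
  by exists N => // n; exact: HN.
by move=> h1; have := lt_le_trans p0 (le_trans h1 L0); rewrite ltxx.
Qed.

End nondegenerate.

(** * CUSUM of the change function *)

Section riemann_sums.
Context {R : realType}.
Variable g : R -> R.
Hypothesis gi : riemann_integrable g 0 1.

Definition ulin (a b : R) (n k : nat) : R := a + k%:R / n%:R * (b - a).

Lemma ulinS a b n k : (0 < n)%N -> ulin a b n k.+1 - ulin a b n k = (b - a) / n%:R.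
Proof. by move=> n0; rewrite /ulin -(natr1 k); field; rewrite pnatr_eq0 -lt0n. Qed.

Lemma ulin_partition a b n (xi : nat -> R) : a <= b -> (0 < n)%N ->
  (forall k, (k < n)%N -> ulin a b n k <= xi k <= ulin a b n k.+1) ->
  tagged_partition a b n (ulin a b n) xi.
Proof.
move=> ab n0 H; split => //; first by rewrite /ulin mul0r mul0r addr0.
by rewrite /ulin divff ?pnatr_eq0 -?lt0n// mul1r addrC subrK.
Qed.

(** Partitions differing in one tag have Riemann sums less than 2 apart, which bounds the variation
    of [g] over a cell; there are finitely many cells. *)
Lemma riemann_integrable_bounded : exists M, forall y, 0 <= y <= 1 -> `|g y| <= M.
Proof.
have [I HI] := gi; have [del del0 H] := HI 1 ltr01.
pose n := (Num.bound del^-1).+1.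
have n0 : 0 < n%:R :> R by rewrite ltr0n.
have nd : (n%:R)^-1 < del.
  rewrite -(invrK del) ltf_pV2 ?posrE ?invr_gt0//.
  apply: lt_le_trans (archi_boundP _) _; first by rewrite invr_ge0 ltW.
  by rewrite ler_nat leqnSn.
have mesh k : (k < n)%N -> ulin 0 1 n k.+1 - ulin 0 1 n k < del.
  by move=> _; rewrite ulinS// subr0 mul1r.
have uE k : ulin 0 1 n k = k%:R / n%:R by rewrite /ulin subr0 mulr1 add0r.
have ule k : ulin 0 1 n k <= ulin 0 1 n k.+1.
  by rewrite -subr_ge0 ulinS// subr0 divr_ge0.
exists (2 * n%:R + rmax (fun k => `|g (ulin 0 1 n k)|) n) => y /andP[y0 y1].
have [k kn /andP[ky yk]] : exists2 k, (k < n)%N & ulin 0 1 n k <= y <= ulin 0 1 n k.+1.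
  case: (leP 1 y) => h.
    exists n.-1 => //; rewrite prednK// !uE divff ?gt_eqF//.
    rewrite y1 andbT (le_trans _ h)// ler_pdivrMr// mul1r ler_nat.
    exact: leq_pred.
  exists (Num.truncn (n%:R * y)).
    by rewrite truncn_lt_nat ?mulr_ge0// gtr_pMr.
  have := truncn_itv (mulr_ge0 (ltW n0) y0); rewrite !uE => /andP[h1 h2].
  by rewrite ler_pdivrMr// ler_pdivlMr// (mulrC y) h1 ltW.
pose xi1 j := ulin 0 1 n j.
pose xi2 j := if j == k then y else ulin 0 1 n j.
have p1 : tagged_partition 0 1 n (ulin 0 1 n) xi1.
  by apply: ulin_partition => // j _; rewrite lexx ule.
have p2 : tagged_partition 0 1 n (ulin 0 1 n) xi2.
  apply: ulin_partition => // j _; rewrite /xi2; case: eqP => [->|_].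
    by rewrite ky yk.
  by rewrite lexx ule.
have h1 := H _ _ _ p1 mesh; have h2 := H _ _ _ p2 mesh.
have E : riemann_sum g n (ulin 0 1 n) xi2 - riemann_sum g n (ulin 0 1 n) xi1 =
   (g y - g (ulin 0 1 n k)) / n%:R.
  rewrite /riemann_sum -sumrB (bigD1 (Ordinal kn))//= big1 ?addr0.
    by rewrite /xi2 /xi1 eqxx ulinS// subr0 mul1r mulrBl.
  move=> j /eqP jk; rewrite /xi2; case: eqP => [e|_]; last by rewrite subrr.
  by case: jk; exact: val_inj.
have h3 : `|(g y - g (ulin 0 1 n k)) / n%:R| <= 2.
  rewrite -E; move: h1 h2; set s1 := riemann_sum _ _ _ _; set s2 := riemann_sum _ _ _ _.
  by rewrite !ltr_norml ler_norml => /andP[? ?] /andP[? ?]; apply/andP; split; lra.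
rewrite normrM normfV (gtr0_norm n0) ler_pdivrMr// in h3.
rewrite -[g y](subrK (g (ulin 0 1 n k))); apply: le_trans (ler_normD _ _) _.
by apply: lerD => //; exact: (@rmax_ge _ (fun k => `|g (ulin 0 1 n k)|) _ _ (ltnW kn)).
Qed.

(** Partitions of [[0, x]] are completed by one and the same partition of [[x, 1]], whose
    contribution [s] cancels in the difference. *)
Let riemann_cauchy x e : 0 <= x <= 1 -> 0 < e -> exists2 del, 0 < del &
  forall n p xi n' p' xi',
    tagged_partition 0 x n p xi -> (forall k, (k < n)%N -> p k.+1 - p k < del) ->
    tagged_partition 0 x n' p' xi' -> (forall k, (k < n')%N -> p' k.+1 - p' k < del) ->
    `|riemann_sum g n p xi - riemann_sum g n' p' xi'| <= e.
Proof.
move=> /andP[x0 x1] e0; have [I HI] := gi.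
have [del del0 H] := HI (e / 2) (divr_gt0 e0 (ltr0Sn R 1)).
exists del => //.
pose N := (Num.bound del^-1).+1.
have N0 : 0 < N%:R :> R by rewrite ltr0n.
have Nd : (1 - x) / N%:R < del.
  apply: (@le_lt_trans _ _ (N%:R^-1)).
    by rewrite -[leRHS]mul1r ler_wpM2r ?invr_ge0// gerBl.
  rewrite -(invrK del) ltf_pV2 ?posrE ?invr_gt0//.
  apply: lt_le_trans (archi_boundP _) _; first by rewrite invr_ge0 ltW.
  by rewrite ler_nat leqnSn.
pose q := ulin x 1 N.
have [q0 qN qq] : tagged_partition x 1 N q q.
  apply: ulin_partition => // k _; rewrite lexx /= -subr_ge0 ulinS//.
  by rewrite divr_ge0// subr_ge0.
pose s := \sum_(k < N) g (q k) * (q k.+1 - q k).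
have key n p xi : tagged_partition 0 x n p xi ->
   (forall k, (k < n)%N -> p k.+1 - p k < del) ->
   `|riemann_sum g n p xi + s - I| <= e / 2.
  move=> [p0 pn pxi] mp.
  pose P k := if (k <= n)%N then p k else q (k - n)%N.
  pose X k := if (k < n)%N then xi k else q (k - n)%N.
  have PS k : (n <= k)%N -> P k = q (k - n)%N.
    move=> nk; rewrite /P; case: leqP => // kn.
    have -> : k = n by apply/eqP; rewrite eqn_leq kn nk.
    by rewrite subnn pn q0.
  have part : tagged_partition 0 1 (n + N) P X.
    split; first by rewrite /P leq0n.
      by rewrite PS ?leq_addr// addKn qN.
    move=> k kn; rewrite /X; case: ltnP => h.
      by rewrite /P (ltnW h) h; exact: pxi.
    rewrite !PS// ?(leqW h)// subSn//; apply: qq.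
    by rewrite ltn_subLR.
  have mesh k : (k < n + N)%N -> P k.+1 - P k < del.
    move=> kn; case: (ltnP k n) => h.
      by rewrite /P (ltnW h) h; exact: mp.
    by rewrite !PS// ?(leqW h)// subSn// ulinS.
  have := H _ _ _ part mesh; rewrite /riemann_sum big_split_ord /= => h.
  apply: ltW; apply: le_lt_trans h; rewrite le_eqVlt; apply/orP; left; apply/eqP.
  congr (`|_ + _ - _|); apply: eq_bigr => k _.
    by rewrite /X /P ltn_ord (ltnW (ltn_ord k)).
  rewrite /X ltnNge leq_addr /= !PS ?leq_addr//; last by rewrite leqW ?leq_addr.
  by rewrite subSn ?leq_addr// addKn.
move=> n p xi n' p' xi' H1 H2 H3 H4; have := key _ _ _ H1 H2; have := key _ _ _ H3 H4.
by rewrite !ler_norml => /andP[? ?] /andP[? ?]; apply/andP; split; lra.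
Qed.

Let uright (x : R) n k := ulin 0 x n k.+1.

Let uright_part x n : 0 <= x -> (0 < n)%N -> tagged_partition 0 x n (ulin 0 x n) (uright x n).
Proof.
move=> x0 n0; apply: ulin_partition => // k _; rewrite lexx andbT -subr_ge0 ulinS//.
by rewrite subr0 divr_ge0.
Qed.

Lemma riemann_integrable_sub x : 0 <= x <= 1 -> riemann_integrable g 0 x.
Proof.
move=> x01; have /andP[x0 x1] := x01.
pose a n := riemann_sum g n.+1 (ulin 0 x n.+1) (uright x n.+1).
have mesh del : 0 < del -> exists N, forall n k, (N <= n)%N ->
    ulin 0 x n.+1 k.+1 - ulin 0 x n.+1 k < del.
  move=> del0; exists (Num.bound del^-1) => n k Nn; rewrite ulinS// subr0.
  apply: (@le_lt_trans _ _ (n.+1%:R^-1)).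
    by rewrite -[leRHS]mul1r ler_wpM2r ?invr_ge0.
  rewrite -(invrK del) ltf_pV2 ?posrE ?invr_gt0 ?ltr0n//.
  apply: lt_le_trans (archi_boundP _) _; first by rewrite invr_ge0 ltW.
  by rewrite ler_nat (leq_trans Nn).
have ca : cvgn a.
  apply: cauchy_seq_cvg => e e0; have [del del0 H] := riemann_cauchy x01 e0.
  have [N HN] := mesh _ del0; exists N => n m Nn Nm; apply: H.
  - exact: uright_part.
  - by move=> k _; exact: HN.
  - exact: uright_part.
  - by move=> k _; exact: HN.
exists (limn a) => e e0; have [del del0 H] := riemann_cauchy x01 (divr_gt0 e0 (ltr0Sn R 1)).
have [N HN] := mesh _ del0; exists del => // n p xi H1 H2.
apply: (@le_lt_trans _ _ (e / 2)); last by rewrite ltr_pdivrMr// ltr_pMr// ltr1n.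
rewrite distrC; apply: (limn_dist_le (N := N)) => // m Nm; rewrite distrC.
by apply: H => //; [exact: uright_part|move=> k _; exact: HN].
Qed.

Lemma riemann_intP x : 0 <= x <= 1 -> is_riemann_int g 0 x (riemann_int g 0 x).
Proof.
move=> /riemann_integrable_sub [I HI].
exact: (@getPex _ [set I | is_riemann_int g 0 x I] (ex_intro _ I HI)).
Qed.

Definition gsum (T k : nat) : R := (\sum_(1 <= t < k.+1) g (t%:R / T%:R)) / T%:R.

Lemma gsum_cvg x e : 0 <= x <= 1 -> 0 < e -> exists N, forall T, (N <= T)%N ->
  `|gsum T (Num.truncn (T%:R * x)) - riemann_int g 0 x| <= e.
Proof.
move=> x01 e0; have /andP[x0 x1] := x01.
have [M HM] := riemann_integrable_bounded.
have [del del0 H] := riemann_intP x01 (divr_gt0 e0 (ltr0Sn R 1)).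
pose N := (maxn (Num.bound del^-1).+1 (Num.bound `|2 * M / e|).+1)%N.
exists N => T; rewrite geq_max => /andP[T1 T2].
have T0 : (0 < T)%N by exact: leq_trans T1.
have T0' : 0 < T%:R :> R by rewrite ltr0n.
have Td : T%:R^-1 < del.
  rewrite -(invrK del) ltf_pV2 ?posrE ?invr_gt0//.
  apply: lt_le_trans (archi_boundP _) _; first by rewrite invr_ge0 ltW.
  by rewrite ler_nat ltnW.
set n := Num.truncn (T%:R * x).
have /andP[n1 n2] := truncn_itv (mulr_ge0 (ltW T0') x0); rewrite -/n in n1 n2.
(* The points t/T up to [x], then a last cell ending at [x], tagged on the right to match [gsum];
   the last cell is negligible because [g] is bounded. *)
pose p k : R := if (k <= n)%N then k%:R / T%:R else x.
pose xi k : R := if (k < n)%N then k.+1%:R / T%:R else x.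
have nx : n%:R / T%:R <= x by rewrite ler_pdivrMr// mulrC.
have xn : x <= n%:R / T%:R + T%:R^-1.
  by rewrite -[X in _ + X]mul1r -mulrDl natr1 ler_pdivlMr// mulrC ltW.
have part : tagged_partition 0 x n.+1 p xi.
  split; [by rewrite /p leq0n mul0r|by rewrite /p ltnn|].
  move=> k; rewrite ltnS /p /xi => kn; rewrite kn; case: ltnP => h.
    by rewrite lexx andbT ler_wpM2r ?invr_ge0// ler_nat.
  by rewrite lexx andbT (_ : k = n)//; apply/eqP; rewrite eqn_leq kn h.
have mesh k : (k < n.+1)%N -> p k.+1 - p k < del.
  rewrite ltnS /p => kn; rewrite kn; case: ltnP => h.
    by rewrite -mulrBl -(natr1 k) addrAC subrr add0r mul1r.
  have -> : k = n by apply/eqP; rewrite eqn_leq kn h.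
  by apply: le_lt_trans Td; lra.
have := H _ _ _ part mesh; rewrite /riemann_sum big_ord_recr /= => h.
have E : \sum_(i < n) g (xi i) * (p i.+1 - p i) = gsum T n.
  rewrite /gsum big_add1 /= big_mkord mulr_suml; apply: eq_bigr => k _.
  rewrite /xi /p ltn_ord (ltnW (ltn_ord k)) -mulrBl -[in X in X - _](natr1 k).
  by rewrite addrAC subrr add0r mul1r.
have E2 : `|g (xi n) * (p n.+1 - p n)| <= e / 2.
  have d0 : 0 <= x - n%:R / T%:R by rewrite subr_ge0.
  rewrite /xi /p !ltnn leqnn normrM (ger0_norm d0).
  apply: (@le_trans _ _ (M * T%:R^-1)).
    by apply: ler_pM => //; [exact: HM|rewrite lerBlDl].
  rewrite ler_pdivrMr//; have : 2 * M / e <= T%:R.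
    apply: le_trans (ler_norm _) _; apply: le_trans (ltW (archi_boundP (normr_ge0 _))) _.
    by rewrite ler_nat ltnW.
  by rewrite ler_pdivrMr//; lra.
rewrite E in h; move: h E2; set s := g _ * _.
by rewrite ltr_norml !ler_norml => /andP[? ?] /andP[? ?]; apply/andP; split; lra.
Qed.

Definition gam (T k : nat) : R := gsum T k - k%:R / T%:R * gsum T T.

Lemma gsum_le M T k l : (forall y, 0 <= y <= 1 -> `|g y| <= M) -> (0 < T)%N ->
  (k <= l)%N -> (l <= T)%N -> `|gsum T l - gsum T k| <= (l%:R - k%:R) / T%:R * M.
Proof.
move=> HM T0 kl lT; have T0' : 0 < T%:R :> R by rewrite ltr0n.
rewrite /gsum -mulrBl (@big_cat_nat _ _ _ k.+1 1 l.+1)//= addrAC subrr add0r.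
rewrite normrM normfV (gtr0_norm T0') mulrAC ler_wpM2r ?invr_ge0//.
apply: le_trans (ler_norm_sum _ _ _) _.
apply: (@le_trans _ _ (\sum_(k.+1 <= t < l.+1) M)).
  rewrite big_nat_cond [leRHS]big_nat_cond; apply: ler_sum => t; rewrite andbT => /andP[_ tl].
  apply: HM; rewrite divr_ge0//= ler_pdivrMr// mul1r ler_nat.
  by rewrite (leq_trans _ lT).
by rewrite sumr_const_nat subSS -(mulr_natl M) natrB.
Qed.

Lemma gam_bound M T k : (forall y, 0 <= y <= 1 -> `|g y| <= M) -> (0 < T)%N ->
  (k <= T)%N -> `|gam T k| <= 2 * M.
Proof.
move=> HM T0 kT; have T0' : 0 < T%:R :> R by rewrite ltr0n.
have M0 : 0 <= M by apply: le_trans (HM 0 _) => //; rewrite lexx ler01.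
have g0 : gsum T 0 = 0 by rewrite /gsum big_geq// mul0r.
have h1 := gsum_le HM T0 (leq0n k) kT; have h2 := gsum_le HM T0 (leq0n T) (leqnn T).
rewrite g0 !subr0 in h1 h2; rewrite divff ?gt_eqF// mul1r in h2.
have k1 : 0 <= (k%:R / T%:R : R) <= 1.
  by rewrite divr_ge0//= ler_pdivrMr// mul1r ler_nat.
have k0 : 0 <= (k%:R / T%:R : R) by case/andP: k1.
apply: le_trans (ler_normB _ _) _; rewrite (normrM (k%:R / T%:R)) (ger0_norm k0).
have b0 : 0 <= `|gsum T T| by exact: normr_ge0.
move: k1 h1 h2 b0; set u := k%:R / T%:R; set a := `|gsum T k|; set b := `|gsum T T|.
by move=> /andP[? ?] ? ? ?; nra.
Qed.

Lemma gam_lip M T k l : (forall y, 0 <= y <= 1 -> `|g y| <= M) -> (0 < T)%N ->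
  (k <= l)%N -> (l <= T)%N -> `|gam T l - gam T k| <= 2 * M * ((l%:R - k%:R) / T%:R).
Proof.
move=> HM T0 kl lT; have T0' : 0 < T%:R :> R by rewrite ltr0n.
have M0 : 0 <= M by apply: le_trans (HM 0 _) => //; rewrite lexx ler01.
have g0 : gsum T 0 = 0 by rewrite /gsum big_geq// mul0r.
have h1 := gsum_le HM T0 kl lT; have h2 := gsum_le HM T0 (leq0n T) (leqnn T).
rewrite g0 !subr0 in h2; rewrite divff ?gt_eqF// mul1r in h2.
have u0 : 0 <= (l%:R - k%:R) / T%:R :> R by rewrite divr_ge0// subr_ge0 ler_nat.
have -> : gam T l - gam T k = (gsum T l - gsum T k) - (l%:R - k%:R) / T%:R * gsum T T.
  by rewrite /gam; ring.
apply: le_trans (ler_normB _ _) _; rewrite (normrM (_ / _) (gsum T T)) (ger0_norm u0).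
have : (l%:R - k%:R) / T%:R * `|gsum T T| <= (l%:R - k%:R) / T%:R * M by rewrite ler_wpM2l.
lra.
Qed.

(** [gam] is Lipschitz in [k / T] and at least [D / 2] in absolute value near the point [x], hence
    at least [D / 4] over a fraction [eta / 2] of the times. *)
Lemma gam_mean_square :
  (exists2 x : R, 0 <= x <= 1 & riemann_int g 0 x - x * riemann_int g 0 1 != 0) ->
  exists2 kap : R, 0 < kap & exists N, forall T, (N <= T)%N ->
    kap <= (\sum_(k < T) gam T k ^+ 2) / T%:R.
Proof.
move=> [x x01 Dx]; have /andP[x0 x1] := x01.
have [M HM] := riemann_integrable_bounded.
have M0 : 0 <= M by apply: le_trans (HM 0 _) => //; rewrite lexx ler01.
set Dl := riemann_int g 0 x - _ in Dx.
have [D DE] : exists D, D = `|Dl| by exists `|Dl|.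
have D0 : 0 < D by rewrite DE normr_gt0.
have i01 : 0 <= (1 : R) <= 1 by rewrite ler01 lexx.
have D8 : 0 < D / 8 by rewrite divr_gt0.
have [N1 H1] := gsum_cvg x01 D8; have [N2 H2] := gsum_cvg i01 D8.
pose eta := D / (8 * (D + M + 1)).
have DM : 0 < D + M + 1 by lra.
have eta0 : 0 < eta by rewrite divr_gt0// mulr_gt0.
have eta1 : eta <= 1.
  by rewrite ler_pdivrMr ?mulr_gt0//; lra.
have etaM : 2 * M * eta <= D / 4.
  have -> : D / 4 = 2 * (D + M + 1) * eta by rewrite /eta; field; rewrite gt_eqF.
  by rewrite ler_wpM2r ?(ltW eta0)//; lra.
exists (D ^+ 2 / 16 * (eta / 2)); first by rewrite mulr_gt0// divr_gt0// exprn_gt0.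
pose N := (maxn (maxn N1 N2) (maxn (Num.bound (2 / eta)).+1 (Num.bound (8 * M / D)).+1))%N.
exists N => T; rewrite !geq_max => /andP[/andP[T1 T2] /andP[T3 T4]].
have T0 : (0 < T)%N by exact: leq_trans T3.
have T0' : 0 < T%:R :> R by rewrite ltr0n.
set ks := Num.truncn (T%:R * x).
have /andP[n1 n2] := truncn_itv (mulr_ge0 (ltW T0') x0); rewrite -/ks in n1 n2.
have ksT : (ks <= T)%N.
  by rewrite -(ler_nat R) (le_trans n1)// ger_pMr.
have h1 := H1 T T1; have h2 := H2 T T2; rewrite -/ks in h1.
rewrite mulr1 natrK in h2.
have ux : 0 <= x - ks%:R / T%:R <= T%:R^-1.
  rewrite subr_ge0 ler_pdivrMr// mulrC n1 /= lerBlDl.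
  by rewrite -[X in _ + X]mul1r -mulrDl natr1 ler_pdivlMr// mulrC ltW.
have gT : `|gsum T T| <= M.
  have := gsum_le HM T0 (leq0n T) (leqnn T).
  by rewrite {2}/gsum big_geq// mul0r !subr0 divff ?gt_eqF// mul1r.
have h8 : T%:R^-1 * M <= D / 8.
  have H9 : 8 * M / D <= T%:R.
    apply: le_trans (ltW (archi_boundP _)) _; first by rewrite divr_ge0 ?(ltW D0)// mulr_ge0.
    by rewrite ler_nat ltnW.
  move: H9; rewrite ler_pdivrMr// => H9; rewrite mulrC ler_pdivrMr//; lra.
have gks : D / 2 <= `|gam T ks|.
  have b1 : `|(x - ks%:R / T%:R) * gsum T T| <= D / 8.
    apply: le_trans h8; rewrite normrM; apply: ler_pM => //.
    by rewrite ger0_norm; case/andP: ux.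
  have b2 : `|x * (gsum T T - riemann_int g 0 1)| <= D / 8.
    by rewrite normrM (ger0_norm x0) -[leRHS]mul1r; apply: ler_pM.
  have E : Dl = gam T ks - (gsum T ks - riemann_int g 0 x)
     - (x - ks%:R / T%:R) * gsum T T + x * (gsum T T - riemann_int g 0 1).
    by rewrite /gam /Dl; ring.
  have : D <= `|gam T ks| + D / 8 + D / 8 + D / 8.
    rewrite [leLHS]DE E; apply: le_trans (ler_normD _ _) _; apply: lerD => //.
    apply: le_trans (ler_normB _ _) _; apply: lerD => //.
    by apply: le_trans (ler_normB _ _) _; apply: lerD.
  by lra.
pose L := Num.truncn (eta * T%:R).
have eT : 0 <= eta * T%:R by rewrite mulr_ge0// ltW.
have /andP[l1 l2] := truncn_itv eT; rewrite -/L in l1 l2.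
have LT : (L <= T)%N by rewrite -(ler_nat R) (le_trans l1)// ler_piMl.
(* A window of length [L] starting at [ks], pushed to the left when it would overrun [T]. *)
pose s := minn ks (T - L).
have sL : (s + L <= T)%N.
  by apply: leq_trans (leq_add (geq_minr _ _) (leqnn L)) _; rewrite subnK.
have sk : (s <= ks)%N by exact: geq_minl.
have ks' : (ks <= s + L)%N.
  by rewrite /s /minn; case: ltnP => _; [exact: leq_addr|rewrite subnK].
have low k : (s <= k < s + L)%N -> D ^+ 2 / 16 <= gam T k ^+ 2.
  move=> /andP[k1 k2].
  have kT : (k <= T)%N by exact: leq_trans (ltnW k2) sL.
  have d : `|gam T k - gam T ks| <= D / 4.
    apply: le_trans etaM.
    case: (leqP k ks) => kk.
      rewrite distrC; apply: le_trans (gam_lip HM T0 kk ksT) _.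
      rewrite ler_wpM2l ?mulr_ge0// ler_pdivrMr//; apply: le_trans l1.
      rewrite -natrB// ler_nat leq_subLR; apply: leq_trans ks' _.
      by rewrite leq_add2r.
    apply: le_trans (gam_lip HM T0 (ltnW kk) kT) _.
    rewrite ler_wpM2l ?mulr_ge0// ler_pdivrMr//; apply: le_trans l1.
    rewrite -natrB ?(ltnW kk)// ler_nat leq_subLR; apply: leq_trans (ltnW k2) _.
    by rewrite leq_add2r.
  have : D / 4 <= `|gam T k|.
    have := ler_normB (gam T k) (gam T k - gam T ks).
    by rewrite opprB addrCA subrr addr0; lra.
  move=> h; rewrite -(real_normK (num_real (gam T k))).
  have p : 0 <= `|gam T k| by [].
  by nra.
rewrite ler_pdivlMr//.
apply: (@le_trans _ _ (\sum_(s <= k < s + L) gam T k ^+ 2)).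
  apply: (@le_trans _ _ (\sum_(s <= k < s + L) (D ^+ 2 / 16))).
    rewrite sumr_const_nat addKn -(mulr_natr _ L) -[leLHS]mulrA ler_wpM2l//.
      by rewrite divr_ge0// sqr_ge0.
    have : 2 / eta <= T%:R.
      apply: le_trans (ltW (archi_boundP _)) _; first by rewrite divr_ge0// ltW.
      by rewrite ler_nat ltnW.
    rewrite ler_pdivrMr// => h.
    by move: l2; rewrite -(natr1 L); lra.
  by rewrite big_nat_cond [leRHS]big_nat_cond; apply: ler_sum => k; rewrite andbT; exact: low.
rewrite -(big_mkord xpredT (fun k => gam T k ^+ 2)).
rewrite [leRHS](@big_cat_nat _ _ _ s)//=; last by rewrite (leq_trans _ sL)// leq_addr.
rewrite [X in _ <= _ + X](@big_cat_nat _ _ _ (s + L))//= ?leq_addr//.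
rewrite addrCA lerDl addr_ge0//.
  by rewrite sumr_ge0// => k _; exact: sqr_ge0.
by rewrite sumr_ge0// => k _; exact: sqr_ge0.
Qed.

End riemann_sums.

(** * The panel statistics *)

Section more_expectation.
Context {d : measure_display} {Omega : measurableType d} {R : realType}.
Variable P : probability Omega R.

Lemma Ex_le_sqrt (X : Omega -> R) c : L2 P X -> 0 <= c ->
  Ex P (fun w => X w ^+ 2) <= c ^+ 2 -> Ex P X <= c.
Proof.
move=> L2X c0 h; have i1 := L2_L1 L2X; have i2 := L2X.2.
have : 0 <= Ex P (fun w => (X w ^+ 2 - 2 * Ex P X * X w) + Ex P X ^+ 2).
  apply: Ex_ge0 => w; rewrite [leRHS](_ : _ = (X w - Ex P X) ^+ 2) ?sqr_ge0//; ring.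
rewrite (ExD (L1B i2 (L1Z _ i1)) (L1_cst P _)) Ex_cst (ExB i2 (L1Z _ i1)) (ExZ _ i1).
by move=> h2; nra.
Qed.

Lemma iseq_reindex (I J : finType) n (z : I -> nat -> Omega -> R) Fil K (f : J -> I) :
  injective f -> iseq P n z Fil K -> iseq P n (fun j => z (f j)) Fil K.
Proof.
move=> fi Z; split.
- exact: is_fil Z.
- exact: is_film Z.
- by move=> i j; exact: is_adapted Z (f i) j.
- by move=> i j; exact: is_L4 Z (f i) j.
- by move=> i j; exact: is_mean Z (f i) j.
- by move=> i l j jn; rewrite (is_cov Z (f i) (f l) jn) (inj_eq fi).
- by move=> i j; exact: is_m4 Z (f i) j.
- by move=> i l j jn il; apply: (is_sqcov Z) => //; rewrite (inj_eq fi).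
- by move=> H i j; exact: is_ind1 Z H (f i) j.
- by move=> H i l j jn aH iH; rewrite -(inj_eq fi); exact: (is_ind2 Z (f i) (f l) jn aH iH).
Qed.

End more_expectation.

(** * Integrals and suprema of step functions *)

Section step_functions.
Context {R : realType}.
Notation mu := (@lebesgue_measure R).

Lemma step_integral (u : nat -> R) T : (0 < T)%N ->
  \int[mu]_(x in `[0, 1]) u (Num.truncn (T%:R * x)) = (\sum_(k < T) u k) / T%:R.
Proof.
move=> T0; have T0' : 0 < T%:R :> R by rewrite ltr0n.
(* The value [T] of the floor is taken only at the point 1, a null set. *)
pose J k : set R := if (k < T)%N then `[k%:R / T%:R, k.+1%:R / T%:R[%classic else [set 1].
have mJ k : measurable (J k).
  by rewrite /J; case: ifP => _; [exact: measurable_itv|exact: measurable_set1].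
have JT x k : 0 <= x <= 1 -> (k <= T)%N -> (x \in J k) = (Num.truncn (T%:R * x) == k).
  move=> /andP[x0 x1] kT; have x0' : 0 <= T%:R * x by rewrite mulr_ge0// ltW.
  rewrite truncn_eq// /J; case: ltnP => h.
    by rewrite mem_setE in_itv /= ler_pdivrMr// ltr_pdivlMr// (mulrC x).
  have -> : k = T by apply/eqP; rewrite eqn_leq kT h.
  apply/idP/idP => [|/andP[+ _]].
    by rewrite inE /= => ->; rewrite mulr1 lexx ltr_nat ltnSn.
  by rewrite ler_pMr// => h1; rewrite inE /=; apply/le_anti/andP.
have mu01 : (mu `[0%R, 1%R] < +oo)%E by rewrite lebesgue_measure_itv /= lte_fin ltr01 ltry.
have m01 : measurable (`[0, 1]%classic : set (measurableTypeR R)) by exact: measurable_itv.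
have mI k : measurable_fun setT (\1_(J k) : R -> R) by exact: (measurable_indic (mJ k)).
have iB (f : R -> R) c : measurable_fun setT f -> (forall x, `|f x| <= c) ->
    mu.-integrable `[0, 1] (EFin \o f).
  move=> mf fc; apply: measurable_bounded_integrable => //; first exact: measurable_funTS.
  by exists c; split; rewrite ?num_real// => x cx y _ /=; exact: le_trans (fc y) (ltW cx).
have I1 k x : `|\1_(J k) x| <= 1 :> R.
  by rewrite indicE; case: (_ \in _); rewrite ?normr1 ?normr0.
have iJ k : mu.-integrable `[0, 1] (EFin \o \1_(J k)) by exact: (iB _ 1).
have iS n : mu.-integrable `[0, 1] (EFin \o (fun x => \sum_(k < n) u k * \1_(J k) x)).
  apply: (iB _ (\sum_(k < n) `|u k|)).
    apply: measurable_sum => k; apply: measurable_funM => //; exact: measurable_cst.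
  move=> x; apply: (le_trans (ler_norm_sum _ _ _)); apply: ler_sum => k _.
  by rewrite normrM ler_piMr.
have i1 c k : mu.-integrable `[0, 1] (EFin \o (fun x => c * \1_(J k) x)).
  apply: (iB _ `|c|); last by move=> x; rewrite normrM ler_piMr.
  by apply: measurable_funM => //; exact: measurable_cst.
have vJ k : (k <= T)%N -> \int[mu]_(x in `[0, 1]) \1_(J k) x = if (k < T)%N then T%:R^-1 else 0.
  move=> kT; rewrite /Rintegral integral_indic//; last exact: mJ.
  rewrite /J; case: ltnP => h.
    rewrite setIidl; last first.
      move=> x /=; rewrite !in_itv /= => /andP[x0 x1]; apply/andP; split.
        by apply: le_trans x0; rewrite divr_ge0.
      by apply: (le_trans (ltW x1)); rewrite ler_pdivrMr// mul1r ler_nat.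
    suff E : mu `[(k%:R / T%:R)%R, (k.+1%:R / T%:R)%R[ = (T%:R^-1)%:E.
      exact: (congr1 fine E).
    rewrite lebesgue_measure_itv /= lte_fin ltr_pM2r ?invr_gt0// ltr_nat ltnSn.
    by rewrite -EFinB -mulrBl -natrB// subSnn mul1r.
  rewrite setIidl; last by move=> x /= ->; rewrite in_itv /= lexx ler01.
  exact: (congr1 fine (lebesgue_measure_set1 (1 : R))).
have key n : (n <= T.+1)%N ->
  \int[mu]_(x in `[0, 1]) (\sum_(k < n) u k * \1_(J k) x) =
    \sum_(k < n) u k * (if (k < T)%N then T%:R^-1 else 0).
  elim: n => [|n IH] nT.
    rewrite big_ord0 (_ : (fun x => _) = (fun=> 0)); last first.
      by apply/funext => x; rewrite big_ord0.
    by rewrite Rintegral_cst ?mul0r//; exact: measurable_itv.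
  rewrite (_ : (fun x => \sum_(k < n.+1) u k * \1_(J k) x) =
     (fun x => \sum_(k < n) u k * \1_(J k) x + u n * \1_(J n) x)); last first.
    by apply/funext => x; rewrite big_ord_recr.
  rewrite (RintegralD m01 (iS n) (i1 (u n) n)) (IH (ltnW nT)) big_ord_recr /=.
  by congr (_ + _); rewrite (RintegralZl (u n) m01 (iJ n)) (vJ _ nT).
have := key T.+1 (leqnn _); rewrite big_ord_recr /= ltnn mulr0 addr0 => e.
transitivity (\int[mu]_(x in `[0, 1]) \sum_(k < T.+1) u k * \1_(J k) x).
  apply: eq_Rintegral => x; rewrite inE /= in_itv /= => x01.
  have kT : (Num.truncn (T%:R * x) < T.+1)%N.
    rewrite ltnS -(ler_nat R); have /andP[x0 x1] := x01.
    apply: (@le_trans _ _ (T%:R * x)); last by rewrite ger_pMr.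
    by rewrite truncn_le mulr_ge0// ltW.
  rewrite (bigD1 (Ordinal kT))//= indicE JT// eqxx mulr1 big1 ?addr0//.
  move=> k /eqP kk; rewrite indicE JT//; last by rewrite -ltnS ltn_ord.
  by case: eqP => [E|_]; rewrite ?mulr0//; case: kk; exact: val_inj.
rewrite e mulr_suml; apply: eq_bigr => k _; by rewrite ltn_ord.
Qed.

Lemma sup_truncn (u : nat -> R) T :
  sup [set u (Num.truncn (T%:R * (x : R))) | x in `[0, 1]] = rmax u T.
Proof.
have T0' : 0 <= T%:R :> R by [].
have hub : ubound [set u (Num.truncn (T%:R * (x : R))) | x in `[0, 1]] (rmax u T).
  move=> _ [x /= + <-]; rewrite in_itv /= => /andP[x0 x1]; apply: rmax_ge.
  rewrite -(ler_nat R); apply: (@le_trans _ _ (T%:R * x)).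
    by rewrite (truncn_le (T%:R * x)) mulr_ge0.
  by rewrite ler_piMr.
have ne : [set u (Num.truncn (T%:R * (x : R))) | x in `[0, 1]] !=set0.
  by exists (u (Num.truncn (T%:R * (0 : R)))); exists 0 => //=; rewrite in_itv /= lexx ler01.
apply/le_anti/andP; split; first exact: ge_sup.
have [k kT ->] := rmax_ex u T.
apply: ub_le_sup; first by exists (rmax u T).
case: (posnP T) => [T0|T0].
  move: kT; rewrite T0 leqn0 => /eqP ->.
  by exists 0 => /=; rewrite ?in_itv /= ?lexx ?ler01// mulr0 truncn0.
have T1 : 0 < T%:R :> R by rewrite ltr0n.
exists (k%:R / T%:R); last by rewrite mulrC divfK ?gt_eqF// natrK.
by rewrite /= in_itv /= divr_ge0//= ler_pdivrMr// mul1r ler_nat.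
Qed.

Lemma Psi_scale bm N (u : nat -> R) c : 0 <= c ->
  Psi bm N (fun k => c * u k) = c * Psi bm N u.
Proof.
move=> c0; case: bm => /=; last by rewrite -mulr_sumr mulrA.
apply/le_anti/andP; split.
  by apply: rmax_le => k kN; rewrite ler_wpM2l//; exact: rmax_ge.
have [k kN ->] := rmax_ex u N; exact: (@rmax_ge _ (fun k => c * u k)).
Qed.

End step_functions.

(** * Expansion of the panel process *)

Section decomposition.
Context {R : realType}.

(** The scaled panel process at an integer time; the factors sqrt d have cancelled. *)
Definition hstat (s Phi : nat -> R) (g : R -> R) (T n : nat) (a : 'cV[R]_n)
    (S : 'I_n -> nat -> R) (S0 : nat -> R) (k : nat) : R :=
  (common_part s Phi n)^-1 *
    \sum_(i < n) ((s i * bridge T (S i) k + Phi i * bridge T S0 k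
                   + Num.sqrt T%:R * a i 0 * gam g T k) ^+ 2 / (s i ^+ 2 + Phi i ^+ 2)
                  - vbridge T k).

(** The means [mu i] drop out, since the CUSUM of a constant is zero. *)
Lemma cusum_mixed (mu s Phi : nat -> R) (g : R -> R) (T n : nat) (a : 'cV[R]_n)
    (y : 'I_n -> nat -> R) (y0 : nat -> R) i x : (0 < T)%N ->
  let k := Num.truncn (T%:R * x) in
  cusum T (change_obs mu g T a (fun i t => s i * y i t + Phi i * y0 t) i) x =
  s i * bridge T (fun k => \sum_(j < k) y i j.+1) k
  + Phi i * bridge T (fun k => \sum_(j < k) y0 j.+1) k
  + Num.sqrt T%:R * a i 0 * gam g T k.
Proof.
move=> T0 k; have T0' : 0 < T%:R :> R by rewrite ltr0n.
have r0 : 0 < Num.sqrt T%:R :> R by rewrite sqrtr_gt0.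
have rr : Num.sqrt T%:R ^+ 2 = T%:R :> R by rewrite sqr_sqrtr// ltW.
have sumE m : \sum_(1 <= t < m.+1) change_obs mu g T a (fun i t => s i * y i t + Phi i * y0 t) i t =
    m%:R * mu i + a i 0 * (T%:R * gsum g T m)
    + (s i * \sum_(j < m) y i j.+1 + Phi i * \sum_(j < m) y0 j.+1).
  rewrite /change_obs !big_split /= sumr_const_nat subn1 /=.
  rewrite -!mulr_sumr /gsum; congr (_ + _ * _ + (_ * _ + _ * _)).
  - by rewrite mulr_natl.
  - by rewrite [RHS]mulrC divfK// gt_eqF.
  - by rewrite big_add1 /= big_mkord.
  - by rewrite big_add1 /= big_mkord.
rewrite /cusum -/k !sumE /bridge /gam.
move: (gsum g T k) (gsum g T T) (\sum_(j < k) y i j.+1) (\sum_(j < T) y i j.+1) => G1 G2 y1 y2.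
move: (\sum_(j < k) y0 j.+1) (\sum_(j < T) y0 j.+1) => y3 y4.
move: (mu i) (a i 0) (s i) (Phi i) => m1 a1 s1 p1.
have [r [rE r1]] : exists r : R, r = Num.sqrt T%:R /\ r != 0 by eexists; split=> //; rewrite gt_eqF.
rewrite -rE -rr -rE; field; exact: r1.
Qed.

Lemma panel_hstat (mu s Phi : nat -> R) (g : R -> R) (T n : nat) (a : 'cV[R]_n)
    (y : 'I_n -> nat -> R) (y0 : nat -> R) x : (0 < T)%N -> (0 < n)%N ->
  Num.sqrt n%:R / common_part s Phi n *
  panel (fun i => s i ^+ 2 + Phi i ^+ 2) T
    (change_obs mu g T a (fun i t => s i * y i t + Phi i * y0 t)) x =
  hstat s Phi g T a (fun i k => \sum_(j < k) y i j.+1) (fun k => \sum_(j < k) y0 j.+1)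
    (Num.truncn (T%:R * x)).
Proof.
move=> T0 n0; rewrite /panel /hstat; set k := Num.truncn _.
have r0 : Num.sqrt n%:R != 0 :> R by rewrite gt_eqF// sqrtr_gt0 ltr0n.
rewrite mulrA (mulrAC (Num.sqrt _)) divff// mul1r; congr (_ * _); apply: eq_bigr => i _.
by rewrite cusum_mixed.
Qed.

Lemma bridge_sum (I : finType) (c : I -> R) T (S : I -> nat -> R) k :
  \sum_i c i * bridge T (S i) k = bridge T (fun k => \sum_i c i * S i k) k.
Proof.
rewrite /bridge (mulr_sumr _ _ _ (k%:R / T%:R)) -sumrB mulr_sumr.
by apply: eq_bigr => i _; ring.
Qed.

Lemma hstat_decomposition (s Phi : nat -> R) (g : R -> R) T n (a : 'cV[R]_n) S S0 k :
  (forall i, 0 < s i ^+ 2 + Phi i ^+ 2) -> 0 < common_part s Phi n ->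
  let A := common_part s Phi n in
  let sg i := s i ^+ 2 + Phi i ^+ 2 in
  hstat s Phi g T a S S0 k =
  hbridge T S0 k + T%:R * ((\sum_(i < n) a i 0 ^+ 2 / sg i) / A) * gam g T k ^+ 2
  + (A^-1 * (\sum_(i < n) s i ^+ 2 / sg i * (bridge T (S i) k ^+ 2 - vbridge T k))
     + 2 / A * bridge T S0 k * bridge T (fun k => \sum_(i < n) s i * Phi i / sg i * S i k) k
     + 2 / A * Num.sqrt T%:R * gam g T k
         * bridge T (fun k => \sum_(i < n) s i * a i 0 / sg i * S i k) k
     + 2 / A * Num.sqrt T%:R * gam g T k * bridge T S0 k
         * \sum_(i < n) Phi i * a i 0 / sg i).
Proof.
move=> sg0 A0 A sg.
have rr : Num.sqrt T%:R ^+ 2 = T%:R :> R by rewrite sqr_sqrtr.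
rewrite /hstat -/A -!bridge_sum /hbridge.
have [B0 B0E] : exists B : R, B = bridge T S0 k by eexists.
have [v vE] : exists v : R, v = vbridge T k by eexists.
have [ga gaE] : exists v : R, v = gam g T k by eexists.
have [r rE] : exists r : R, r = Num.sqrt T%:R by eexists.
rewrite -B0E -vE -gaE -rE -rr -rE.
(* The centring [v] is shared between the idiosyncratic and the common squares in proportion to
   their variances, so that both come out compensated. *)
have -> : \sum_(i < n) ((s i * bridge T (S i) k + Phi i * B0 + r * a i 0 * ga) ^+ 2 / sg i - v) =
    (B0 ^+ 2 - v) * (\sum_(i < n) Phi i ^+ 2 / sg i) +
    (\sum_(i < n) a i 0 ^+ 2 / sg i) * (r ^+ 2 * ga ^+ 2) +
    ((\sum_(i < n) s i ^+ 2 / sg i * (bridge T (S i) k ^+ 2 - v)) +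
     2 * B0 * (\sum_(i < n) s i * Phi i / sg i * bridge T (S i) k) +
     2 * r * ga * (\sum_(i < n) s i * a i 0 / sg i * bridge T (S i) k) +
     2 * r * ga * B0 * \sum_(i < n) Phi i * a i 0 / sg i).
  rewrite !mulr_sumr mulr_suml -!big_split /=; apply: eq_bigr => i _.
  have := sg0 i; rewrite /sg; move: (bridge T (S i) k) (a i 0) (s i) (Phi i) => b a1 s1 p1 h.
  by field; apply/eqP => h0; rewrite h0 ltxx in h.
rewrite -[\sum_(i < n) Phi i ^+ 2 / sg i]/A.
move: (\sum_(i < n) a i 0 ^+ 2 / sg i) => D; have An : A != 0 by rewrite gt_eqF.
move: (A) An => A' An.
move: (\sum_(i < n) s i ^+ 2 / sg i * (bridge T (S i) k ^+ 2 - v)) => x1.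
move: (\sum_(i < n) s i * Phi i / sg i * bridge T (S i) k) => x2.
move: (\sum_(i < n) s i * a i 0 / sg i * bridge T (S i) k) => x3.
move: (\sum_(i < n) Phi i * a i 0 / sg i) => x4.
by field.
Qed.

(* [S T - S k] is the reversed walk at time T - k: each term is a compensated square. *)
Lemma bridge_sqr_reversal T (S : nat -> R) k : (0 < T)%N ->
  bridge T S k ^+ 2 - vbridge T k =
  T%:R^-1 * ((1 - k%:R / T%:R) * (S k ^+ 2 - k%:R)
             + k%:R / T%:R * ((S T - S k) ^+ 2 - (T%:R - k%:R))
             - k%:R / T%:R * (1 - k%:R / T%:R) * (S T ^+ 2 - T%:R)).
Proof.
move=> T0; have T0' : 0 < T%:R :> R by rewrite ltr0n.
rewrite /bridge /vbridge exprMn exprVn sqr_sqrtr ?ltW//.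
move: (S k) (S T) (k%:R) => x y z.
by field; rewrite gt_eqF.
Qed.

End decomposition.

(** * Mean bound on the error, uniform in time *)

Section remainder.
Context {d : measure_display} {Omega : measurableType d} {R : realType}.
Variable P : probability Omega R.

Lemma ler_1Dpow4 (x : R) : x <= 1 + x ^+ 4 /\ x ^+ 2 <= 1 + x ^+ 4.
Proof.
rewrite -[4%N]/(2 * 2)%N exprM.
have := sqr_ge0 (x - 2^-1); have := sqr_ge0 (x ^+ 2 - 2^-1).
by move: (x) => y; split; nra.
Qed.

Lemma bridge_le T (S : nat -> R) k m : (0 < T)%N -> (k <= T)%N ->
  (forall j, (j <= T)%N -> `|S j| <= m) -> `|bridge T S k| <= 2 * (m / Num.sqrt T%:R).
Proof.
move=> T0 kT h; have T0' : 0 < T%:R :> R by rewrite ltr0n.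
have r0 : 0 < Num.sqrt T%:R :> R by rewrite sqrtr_gt0.
have m0 : 0 <= m by apply: le_trans (h 0%N _).
have u1 : k%:R / T%:R <= 1 :> R by rewrite ler_pdivrMr// mul1r ler_nat.
rewrite /bridge normrM ger0_norm ?invr_ge0 ?(ltW r0)// [leRHS](_ : _ = (Num.sqrt T%:R)^-1 * (2 * m)).
  apply: ler_wpM2l; first by rewrite invr_ge0 ltW.
  apply: (le_trans (ler_normB _ _)); rewrite [leRHS](_ : _ = m + m); last by ring.
  rewrite lerD ?h//.
  rewrite normrM ger0_norm ?divr_ge0//; apply: le_trans (h T (leqnn T)).
  by rewrite ler_piMl.
by rewrite mulrA mulrC.
Qed.

(** The first three bounds rest on [s i ^+ 2 <= sg i]; the last is Cauchy-Schwarz, read off a sum of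
    squares at its minimiser [q]. *)
Lemma sqr_weights n (s Phi : nat -> R) (a : 'cV[R]_n) :
  (forall i, 0 < s i ^+ 2 + Phi i ^+ 2) ->
  let sg i := s i ^+ 2 + Phi i ^+ 2 in
  let D := \sum_(i < n) a i 0 ^+ 2 / sg i in
  [/\ \sum_(i < n) (s i ^+ 2 / sg i) ^+ 2 <= n%:R,
      \sum_(i < n) (s i * Phi i / sg i) ^+ 2 <= common_part s Phi n,
      \sum_(i < n) (s i * a i 0 / sg i) ^+ 2 <= D &
      0 < common_part s Phi n ->
        (\sum_(i < n) Phi i * a i 0 / sg i) ^+ 2 <= common_part s Phi n * D].
Proof.
move=> sg0 sg D.
have al1 i : 0 <= s i ^+ 2 / sg i <= 1.
  have h := sg0 i; apply/andP; split; first by rewrite divr_ge0 ?sqr_ge0// ltW.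
  by rewrite ler_pdivrMr// mul1r lerDl sqr_ge0.
have E x i : (s i * x / sg i) ^+ 2 = s i ^+ 2 / sg i * (x ^+ 2 / sg i).
  have h : sg i != 0 by rewrite gt_eqF//; exact: sg0.
  by move: (sg i) h => v h; field.
have h x i : (s i * x / sg i) ^+ 2 <= x ^+ 2 / sg i.
  rewrite E; have /andP[a0 a1] := al1 i.
  by rewrite ler_piMl// divr_ge0 ?sqr_ge0// ltW// sg0.
split.
- rewrite -[n in n%:R]card_ord -sum1_card natr_sum; apply: ler_sum => i _.
  by have /andP[a0 a1] := al1 i; rewrite exprn_ile1.
- by apply: ler_sum => i _; exact: h.
- by apply: ler_sum => i _; exact: h.
move=> A0; set ka := \sum_(i < n) _.
have [q qE] : exists q, q = ka / common_part s Phi n by eexists.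
have : 0 <= \sum_(i < n) (a i 0 - q * Phi i) ^+ 2 / sg i.
  by apply: sumr_ge0 => i _; rewrite divr_ge0 ?sqr_ge0// ltW// sg0.
have -> : \sum_(i < n) (a i 0 - q * Phi i) ^+ 2 / sg i =
    D - 2 * q * ka + q ^+ 2 * common_part s Phi n.
  rewrite /D /ka /common_part !mulr_sumr -sumrB -big_split /=.
  by apply: eq_bigr => i _; rewrite /sg; ring.
have -> : D - 2 * q * ka + q ^+ 2 * common_part s Phi n = D - ka ^+ 2 / common_part s Phi n.
  by rewrite qE; field; rewrite gt_eqF.
by rewrite subr_ge0 ler_pdivrMr// mulrC.
Qed.

(** The weights in [bridge_sqr_reversal] are the same for all components, so the quadratic form in
    the bridges reduces to those in the forward and reversed walks. *)
Lemma quad_bridge_le T n (z z' : 'I_n -> nat -> Omega -> R) (c : 'I_n -> R) w k :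
  (0 < T)%N -> (k <= T)%N ->
  (forall i, psum (z' i) (T - k) w = psum (z i) T w - psum (z i) k w) ->
  `|\sum_i c i * (bridge T (fun k => psum (z i) k w) k ^+ 2 - vbridge T k)| <=
  (2 * maxabs (quadD z c) T w + maxabs (quadD z' c) T w) / T%:R.
Proof.
move=> T0 kT rev; have T0' : 0 < T%:R :> R by rewrite ltr0n.
have [u uE] : exists u : R, u = k%:R / T%:R by eexists.
have u0 : 0 <= u by rewrite uE divr_ge0.
have u1 : u <= 1 by rewrite uE ler_pdivrMr// mul1r ler_nat.
have -> : \sum_i c i * (bridge T (fun k => psum (z i) k w) k ^+ 2 - vbridge T k) =
    T%:R^-1 * ((1 - u) * psum (quadD z c) k w + u * psum (quadD z' c) (T - k) w
             - u * (1 - u) * psum (quadD z c) T w).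
  rewrite !psum_quadD !mulr_sumr -big_split /= -sumrB mulr_sumr.
  apply: eq_bigr => i _; rewrite bridge_sqr_reversal// rev natrB// -uE; ring.
rewrite normrM ger0_norm ?invr_ge0// mulrC ler_pM2r ?invr_gt0//.
have h1 := maxabs_ge (quadD z c) w kT.
have h2 := maxabs_ge (quadD z c) w (leqnn T).
have h3 := maxabs_ge (quadD z' c) w (leq_subr k T).
have m0 : 0 <= maxabs (quadD z c) T w by exact: maxabs_ge0.
have m1 : 0 <= maxabs (quadD z' c) T w by exact: maxabs_ge0.
move: (psum (quadD z c) k w) (psum (quadD z c) T w) (psum (quadD z' c) (T - k) w) h1 h2 h3.
move: (maxabs (quadD z c) T w) (maxabs (quadD z' c) T w) m0 m1 => m m' m0 m1 x y x' h1 h2 h3.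
apply: (le_trans (ler_normB _ _)); apply: (le_trans (lerD (ler_normD _ _) (lexx _))).
rewrite !normrM !(ger0_norm (x := u))// (ger0_norm (x := 1 - u)) ?subr_ge0//.
have a1 : (1 - u) * `|x| <= m by apply: le_trans h1; rewrite ler_piMl// gerBl.
have a2 : u * `|x'| <= m' by apply: le_trans h3; rewrite ler_piMl.
have a3 : u * (1 - u) * `|y| <= m.
  by apply: le_trans h2; rewrite ler_piMl// mulr_ile1// ?subr_ge0// gerBl.
lra.
Qed.

Lemma hstat_remainder (s Phi : nat -> R) (g : R -> R) (T n : nat) (a : 'cV[R]_n)
    (z z' : 'I_n -> nat -> Omega -> R) (z0 : nat -> Omega -> R) Fil Fil' (M K C : R) :
  (0 < T)%N -> (forall i, 0 < s i ^+ 2 + Phi i ^+ 2) -> 0 < common_part s Phi n ->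
  (forall y, 0 <= y <= 1 -> `|g y| <= M) -> 1 <= K ->
  iseq P T z Fil K -> iseq P T z' Fil' K ->
  (forall i k w, (k <= T)%N ->
     psum (z' i) (T - k) w = psum (z i) T w - psum (z i) k w) ->
  L4 P (fun w => maxabs z0 T w / Num.sqrt T%:R) ->
  Ex P (fun w => (maxabs z0 T w / Num.sqrt T%:R) ^+ 4) <= C ->
  let A := common_part s Phi n in
  let D := \sum_(i < n) a i 0 ^+ 2 / (s i ^+ 2 + Phi i ^+ 2) in
  let E := (Num.sqrt A)^-1 * Num.sqrt D in
  exists Q : Omega -> R,
  [/\ L1 P Q,
      (forall w k, (k <= T)%N ->
         `|hstat s Phi g T a (fun i k => psum (z i) k w) (fun k => psum z0 k w) k
           - hbridge T (fun k => psum z0 k w) k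
           - (Num.sqrt T%:R * E) ^+ 2 * gam g T k ^+ 2| <= Q w) &
      Ex P Q <= 24 * (8 + 2 * K) * (Num.sqrt n%:R / A) + 4 * (9 + C) / Num.sqrt A
                + (24 * M / Num.sqrt A + 8 * M * (1 + C)) * (Num.sqrt T%:R * E)].
Proof.
move=> T0 sg0 A0 gM K1 Z Z' rev L4W EW A D E.
have T0' : 0 < T%:R :> R by rewrite ltr0n.
have [r [rE r0 rr]] : exists r : R, [/\ r = Num.sqrt T%:R, 0 < r & r ^+ 2 = T%:R].
  by eexists; split=> //; rewrite ?sqrtr_gt0// sqr_sqrtr// ltW.
have [b [bE b0 bb]] : exists b : R, [/\ b = Num.sqrt A, 0 < b & b ^+ 2 = A].
  by eexists; split=> //; rewrite ?sqrtr_gt0// sqr_sqrtr// ltW.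
have D0 : 0 <= D by apply: sumr_ge0 => i _; rewrite divr_ge0 ?sqr_ge0// ltW.
have [e [eE e0 ee]] : exists e : R, [/\ e = Num.sqrt D, 0 <= e & e ^+ 2 = D].
  by eexists; split=> //; rewrite ?sqrtr_ge0// sqr_sqrtr.
have [q [qE q0 qq]] : exists q : R, [/\ q = Num.sqrt n%:R, 0 <= q & q ^+ 2 = n%:R].
  by eexists; split=> //; rewrite ?sqrtr_ge0// sqr_sqrtr.
have M0 : 0 <= M by apply: le_trans (gM 0 _); rewrite ?normr_ge0// lexx ler01.
have C0 : 0 <= C.
  by apply: le_trans EW; apply: Ex_ge0 => w; rewrite exprn_even_ge0.
have [w1 w2 w3 w4] := sqr_weights a sg0.
pose al (i : 'I_n) := s i ^+ 2 / (s i ^+ 2 + Phi i ^+ 2).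
pose be (i : 'I_n) := s i * Phi i / (s i ^+ 2 + Phi i ^+ 2).
pose th (i : 'I_n) := s i * a i 0 / (s i ^+ 2 + Phi i ^+ 2).
have [ka kaE] : exists ka, ka = \sum_(i < n) Phi i * a i 0 / (s i ^+ 2 + Phi i ^+ 2).
  by eexists.
have kab : `|ka| <= b * e.
  rewrite -ler_sqr ?nnegrE ?mulr_ge0 ?(ltW b0)// real_normK ?num_real//.
  by rewrite exprMn bb ee kaE w4.
have [FW [FWE L2F EF]] : exists F, [/\ F = maxabs (quadD z al) T, L2 P F &
    Ex P (fun w => F w ^+ 2) <= 8 * (8 + 2 * K) * T%:R ^+ 2 * n%:R].
  have [h1 h2] := quad_max Z al; exists (maxabs (quadD z al) T); split=> //.
  by apply: (le_trans h2); rewrite ler_wpM2l// ?mulr_ge0 ?sqr_ge0//; lra.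
have [BW [BWE L2B EB]] : exists F, [/\ F = maxabs (quadD z' al) T, L2 P F &
    Ex P (fun w => F w ^+ 2) <= 8 * (8 + 2 * K) * T%:R ^+ 2 * n%:R].
  have [h1 h2] := quad_max Z' al; exists (maxabs (quadD z' al) T); split=> //.
  by apply: (le_trans h2); rewrite ler_wpM2l// ?mulr_ge0 ?sqr_ge0//; lra.
have linW c V : \sum_i c i ^+ 2 <= V -> exists F : Omega -> R,
    [/\ F = (fun w => r^-1 * maxabs (linD z c) T w), L2 P F &
    Ex P (fun w => F w ^+ 2) <= 8 * V].
  move=> cV; have [h1 h2] := lin_max Z c.
  exists (fun w => r^-1 * maxabs (linD z c) T w); split=> //; first exact: L2Z.
  rewrite (_ : (fun w => _ ^+ 2) = (fun w => r^-1 ^+ 2 * maxabs (linD z c) T w ^+ 2)).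
    rewrite (ExZ _ h1.2) exprVn rr ler_pdivrMl//; apply: (le_trans h2).
    by rewrite mulrCA mulrA ler_wpM2l.
  by apply/funext => w; rewrite exprMn.
have [BeW [BeE L2Be EBe]] := linW be _ w2.
have [ThW [ThE L2Th ETh]] := linW th _ w3.
have [W0 [W0E L4W0 EW0]] : exists W0, [/\ W0 = (fun w => maxabs z0 T w / r),
    L4 P W0 & Ex P (fun w => W0 w ^+ 4) <= C].
  by exists (fun w => maxabs z0 T w / r); rewrite rE.
have c1 : 1 <= 8 * (8 + 2 * K) by lra.
have mean_quad F : L2 P F -> Ex P (fun w => F w ^+ 2) <= 8 * (8 + 2 * K) * T%:R ^+ 2 * n%:R ->
    Ex P F <= 8 * (8 + 2 * K) * T%:R * q.
  move=> L2F' EF'; apply: Ex_le_sqrt => //.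
    by rewrite !mulr_ge0//; lra.
  apply: (le_trans EF'); rewrite -qq; move: c1; move: (8 * (8 + 2 * K)) => x x1.
  by rewrite 2!exprMn ler_wpM2r ?sqr_ge0// ler_wpM2r ?sqr_ge0// ler_eXnr.
have mF := mean_quad _ L2F EF; have mB := mean_quad _ L2B EB.
have mT : Ex P ThW <= 3 * e.
  apply: Ex_le_sqrt => //; first by rewrite mulr_ge0.
  by apply: (le_trans ETh); rewrite -/D exprMn ee ler_wpM2r// -natrX ler_nat.
have i1 := L2_L1 (L4_L2 L4W0); have i2 := L2_L1 L4W0.2.
have i4 : L1 P (fun w => W0 w ^+ 4).
  by have := L4W0.2.2; under eq_fun do rewrite -exprM.
have i4' := L1D (L1_cst P 1) i4.
have E4 : Ex P (fun w => 1 + W0 w ^+ 4) <= 1 + C.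
  by rewrite (ExD (L1_cst P 1) i4) Ex_cst lerD2l.
have mW2 : Ex P (fun w => W0 w ^+ 2) <= 1 + C.
  by apply: le_trans E4; apply: Ex_le => // w; exact: (ler_1Dpow4 _).2.
have mW1 : Ex P W0 <= 1 + C.
  by apply: le_trans E4; apply: Ex_le => // w; exact: (ler_1Dpow4 _).1.
have [An Tn bn] : [/\ A != 0, T%:R != 0 :> R & b != 0].
  by rewrite !gt_eqF.
(* In order: the idiosyncratic quadratic form, the product of the common bridge with a linear form,
   and the two terms linear in the change. *)
pose Q w := (A * T%:R)^-1 * (2 * FW w + BW w) + 4 / A * (b * W0 w ^+ 2 + b^-1 * BeW w ^+ 2)
   + 8 * M * r / A * (ThW w + b * e * W0 w).
have jF := L2_L1 L2F; have jB := L2_L1 L2B; have jT := L2_L1 L2Th; have jBe := L2Be.2.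
have k1 := L1D (L1Z 2 jF) jB.
have k2 := L1D (L1Z b i2) (L1Z b^-1 jBe).
have k3 := L1D jT (L1Z (b * e) i1).
have k12 := L1D (L1Z (A * T%:R)^-1 k1) (L1Z (4 / A) k2).
have k4 := L1Z (8 * M * r / A) k3.
exists Q; split; first exact: (L1D k12 k4).
  move=> w k kT; rewrite hstat_decomposition// -/A -/D.
  have -> : (Num.sqrt T%:R * E) ^+ 2 = T%:R * (D / A).
    by rewrite /E -rE -bE -eE 2!exprMn exprVn rr bb ee (mulrC A^-1).
  have h0 : `|bridge T (fun k => psum z0 k w) k| <= 2 * W0 w.
    by rewrite W0E rE; apply: bridge_le => // j jT'; exact: maxabs_ge.
  have hlin c : `|bridge T (fun k => \sum_(i < n) c i * psum (z i) k w) k| <=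
      2 * (r^-1 * maxabs (linD z c) T w).
    rewrite (mulrC r^-1) rE.
    rewrite (_ : (fun k => _) = (fun k => psum (linD z c) k w)); last first.
      by apply/funext => j; rewrite psum_linD.
    by apply: bridge_le => // j jT'; exact: maxabs_ge.
  have h1 : `|bridge T (fun k => \sum_(i < n) be i * psum (z i) k w) k| <= 2 * BeW w.
    by rewrite BeE; exact: hlin.
  have h2 : `|bridge T (fun k => \sum_(i < n) th i * psum (z i) k w) k| <= 2 * ThW w.
    by rewrite ThE; exact: hlin.
  have h3 := @quad_bridge_le T n z z' al w k T0 kT (fun i => rev i k w kT).
  rewrite -FWE -BWE in h3.
  have h4 := gam_bound gM T0 kT.
  have hW : 0 <= W0 w.
    by rewrite -(pmulr_rge0 (W0 w) (ltr0Sn R 1)); exact: le_trans (normr_ge0 _) h0.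
  have hBe : 0 <= BeW w.
    by rewrite -(pmulr_rge0 (BeW w) (ltr0Sn R 1)); exact: le_trans (normr_ge0 _) h1.
  have hTh : 0 <= ThW w.
    by rewrite -(pmulr_rge0 (ThW w) (ltr0Sn R 1)); exact: le_trans (normr_ge0 _) h2.
  rewrite -kaE -rE; move: h0 h1 h2 h3 h4; rewrite /Q /be /th /al.
  move: (bridge T (fun k => psum z0 k w) k) => B0.
  move: (bridge T (fun k => \sum_(i < n) s i * Phi i / (s i ^+ 2 + Phi i ^+ 2) * psum (z i) k w) k) => B1.
  move: (bridge T (fun k => \sum_(i < n) s i * a i 0 / (s i ^+ 2 + Phi i ^+ 2) * psum (z i) k w) k) => B2.
  move: (\sum_(i < n) s i ^+ 2 / (s i ^+ 2 + Phi i ^+ 2) * _) => B3.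
  move: (gam g T k) (FW w) (BW w) (BeW w) (ThW w) (W0 w) hBe hTh hW => ga f1 f2 f3 f4 f5 hBe hTh hW h0 h1 h2 h3 h4.
  rewrite [X in `|X|](_ : _ = A^-1 * B3 + 2 / A * B0 * B1 + 2 / A * r * ga * B2
     + 2 / A * r * ga * B0 * ka); last by ring.
  have [p [p0 pA p4 p8]] : exists p, [/\ 0 < p, 2 / A = p, 4 / A = 2 * p & 8 * M * r / A = 4 * M * r * p].
    by exists (2 / A); split; rewrite ?divr_gt0//; field.
  rewrite pA p4 p8.
  have pr : 0 <= p * r by rewrite mulr_ge0// ltW.
  have t1 : `|A^-1 * B3| <= (A * T%:R)^-1 * (2 * f1 + f2).
    rewrite normrM ger0_norm ?invr_ge0 ?(ltW A0)// invfM -(mulrA A^-1) (mulrC T%:R^-1).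
    apply: ler_wpM2l; last exact: h3.
    by rewrite invr_ge0 ltW.
  (* The product is split with weight [b = sqrt A] because the second factor has mean square of
     order [A]; both parts are then of order [b]. *)
  have t2 : `|p * B0 * B1| <= 2 * p * (b * f5 ^+ 2 + b^-1 * f3 ^+ 2).
    rewrite 2!normrM (ger0_norm (ltW p0)) -mulrA (mulrC 2) -(mulrA p) ler_wpM2l ?(ltW p0)//.
    apply: (@le_trans _ _ ((2 * f5) * (2 * f3))); first exact: ler_pM.
    have : 0 <= 2 * (b^-1 * (b * f5 - f3) ^+ 2).
      by apply: mulr_ge0 => //; apply: mulr_ge0; [rewrite invr_ge0 ltW|exact: sqr_ge0].
    rewrite (_ : 2 * (b^-1 * (b * f5 - f3) ^+ 2) =
      2 * (b * f5 ^+ 2 + b^-1 * f3 ^+ 2) - 2 * f5 * (2 * f3)) ?subr_ge0//.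
    by field.
  have t3 : `|p * r * ga * B2| <= 4 * M * r * p * f4.
    rewrite 3!normrM (ger0_norm (ltW p0)) (ger0_norm (ltW r0)).
    rewrite (_ : 4 * M * r * p * f4 = p * r * (2 * M) * (2 * f4)); last by ring.
    apply: ler_pM => //; first by rewrite mulr_ge0.
    by rewrite ler_wpM2l.
  have t4 : `|p * r * ga * B0 * ka| <= 4 * M * r * p * (b * e * f5).
    rewrite 4!normrM (ger0_norm (ltW p0)) (ger0_norm (ltW r0)).
    rewrite (_ : 4 * M * r * p * (b * e * f5) = p * r * (2 * M) * (2 * f5) * (b * e)); last by ring.
    apply: ler_pM => //; first by do 2 apply: mulr_ge0 => //.
    apply: ler_pM => //; first by rewrite mulr_ge0.
    by rewrite ler_wpM2l.
  rewrite (mulrDr (4 * M * r * p)) addrA.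
  apply: (le_trans (ler_normD _ _)); rewrite lerD//.
  apply: (le_trans (ler_normD _ _)); rewrite lerD//.
  by apply: (le_trans (ler_normD _ _)); rewrite lerD.
rewrite /Q (ExD k12 k4) (ExD (L1Z (A * T%:R)^-1 k1) (L1Z (4 / A) k2)).
rewrite (ExZ _ k1) (ExZ _ k2) (ExZ _ k3) (ExD (L1Z 2 jF) jB) (ExZ _ jF).
rewrite (ExD (L1Z b i2) (L1Z b^-1 jBe)) (ExZ _ i2) (ExZ _ jBe).
rewrite (ExD jT (L1Z (b * e) i1)) (ExZ _ i1) -rE -qE /E -bE -eE.
move: mF mB mT mW1 mW2 EBe; rewrite -/A -bb.
move: (Ex P FW) (Ex P BW) (Ex P ThW) (Ex P W0) (Ex P (fun w => W0 w ^+ 2)) (Ex P (fun w => BeW w ^+ 2)).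
move=> x1 x2 x3 x4 x5 x6 m1 m2 m3 m4 m5 m6.
move: bn Tn b0 r0 M0 e0 T0' => bn Tn b0 r0 M0 e0 T0'.
have u1 : (b ^+ 2 * T%:R)^-1 * (2 * x1 + x2) <= 24 * (8 + 2 * K) * (q / b ^+ 2).
  rewrite ler_pdivrMl ?mulr_gt0 ?exprn_gt0//.
  rewrite (_ : _ * _ * (24 * (8 + 2 * K) * (q / b ^+ 2)) = 3 * (8 * (8 + 2 * K) * T%:R * q)).
    lra.
  by field.
have u2 : 4 / b ^+ 2 * (b * x5 + b^-1 * x6) <= 4 * (9 + C) / b.
  rewrite (_ : 4 * (9 + C) / b = 4 / b ^+ 2 * (b * (1 + C) + b^-1 * (8 * b ^+ 2))); last by field.
  rewrite ler_wpM2l ?divr_ge0 ?sqr_ge0// lerD// ler_wpM2l ?invr_ge0 ?(ltW b0)//.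
have u3 : 8 * M * r / b ^+ 2 * (x3 + b * e * x4) <=
    (24 * M / b + 8 * M * (1 + C)) * (r * (b^-1 * e)).
  rewrite (_ : (24 * M / b + 8 * M * (1 + C)) * (r * (b^-1 * e)) =
    8 * M * r / b ^+ 2 * (3 * e + b * e * (1 + C))); last by field.
  rewrite ler_wpM2l ?divr_ge0 ?sqr_ge0 ?mulr_ge0 ?(ltW r0)// lerD// ler_wpM2l// mulr_ge0// ltW//.
apply: lerD; last exact: u3. apply: lerD.
  exact: u1.
exact: u2.
Qed.

End remainder.

(** * High dimensional efficiency *)

Section asymptotics.
Context {disp : measure_display} {Omega : measurableType disp} {R : realType}.
Variable P : probability Omega R.
Variable d : nat -> nat.
Hypothesis d_gt0 : forall T, (0 < d T)%N.
Variable g : R -> R.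
Hypothesis g_int : riemann_integrable g 0 1.
Variable eta : forall n : nat, 'I_n.+1 -> nat -> {RV P >-> R}.
Arguments eta : clear implicits.
Hypothesis eta_innov : forall T, innovations T (eta (d T)).
Variables (nu m : R).
Hypothesis nu_gt4 : 4 < nu.
Hypothesis eta_moment : forall (T : nat) (i : 'I_(d T).+1) (t : nat), (1 <= t <= T)%N ->
  ('E_P[fun w => (`|eta (d T) i t w| `^ nu)%R] <= m%:E)%E.
Variables s Phi : nat -> R.
Hypothesis sg_gt0 : forall i, 0 < s i ^+ 2 + Phi i ^+ 2.
Hypothesis A_large : common_part s Phi (d T) / Num.sqrt (d T)%:R @[T --> \oo] --> +oo.

Definition idio (T : nat) (i : 'I_(d T)) (j : nat) : Omega -> R :=
  eta (d T) (widen_ord (leqnSn (d T)) i) j.+1.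

Definition common (T j : nat) : Omega -> R := eta (d T) ord_max j.+1.

Definition hproc (T : nat) (a : 'cV[R]_(d T)) (w : Omega) : nat -> R :=
  hstat s Phi g T a (fun i k => psum (idio i) k w) (fun k => psum (common T) k w).

Let widen_inj n : injective (widen_ord (leqnSn n)).
Proof. by move=> i j /(congr1 val) /= h; apply: val_inj. Qed.

Let common_iseq T k0 len : (0 < T)%N -> (k0 + len <= T)%N ->
  exists Fil, iseq P len (fun (_ : unit) j => common T (k0 + j)) Fil (1 + m).
Proof.
move=> T0 kT.
have [||Fil h] := innovations_iseq (eta_innov T) nu_gt4 (eta_moment (T := T)) (N := len)
  (tau := fun j => (k0 + j).+1).
- by move=> j jl /=; rewrite (leq_trans _ kT)// ltn_add2l.
- by move=> j k _ _ [] /addnI.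
exists Fil; apply: (iseq_reindex (f := fun _ : unit => ord_max) _ h).
by move=> [] [].
Qed.

Let idio_iseq T : exists Fil, iseq P T (@idio T) Fil (1 + m).
Proof.
have [||Fil h] := innovations_iseq (eta_innov T) nu_gt4 (eta_moment (T := T)) (N := T)
  (tau := fun j => j.+1).
- by [].
- by move=> j k _ _ [].
by exists Fil; exact: (iseq_reindex (@widen_inj (d T)) h).
Qed.

Let reversed_iseq T : exists Fil, iseq P T
  (fun i j => eta (d T) (widen_ord (leqnSn (d T)) i) (T - j)%N : Omega -> R) Fil (1 + m).
Proof.
have [||Fil h] := innovations_iseq (eta_innov T) nu_gt4 (eta_moment (T := T)) (N := T)
  (tau := fun j => (T - j)%N).
- by move=> j jT; rewrite subn_gt0 jT leq_subr.
- by move=> j k jT kT; lia.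
by exists Fil; exact: (iseq_reindex (@widen_inj (d T)) h).
Qed.

Let m_ge0 : 1 <= 1 + m.
Proof.
have [//||Fil h] := @common_iseq 1 0 1; first by [].
exact: (iseq_K_ge1 h tt).
Qed.

Let psum_reversed T (x : nat -> Omega -> R) k w : (k <= T)%N ->
  psum (fun j => x (T - j)%N) (T - k) w =
  psum (fun j => x j.+1) T w - psum (fun j => x j.+1) k w.
Proof.
move=> kT; rewrite /psum.
have -> : \sum_(j < T) x j.+1 w = \sum_(j < k) x j.+1 w + \sum_(j < T - k) x (k + j).+1 w.
  by rewrite -[in LHS](subnKC kT) big_split_ord.
rewrite addrAC subrr add0r.
rewrite [RHS](reindex_inj rev_ord_inj) /=; apply: eq_bigr => j _.
by congr (x _ w); have := ltn_ord j; lia.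
Qed.

Let C4 : R := 16 * (8 + 2 * (1 + m)) + 2.

Let remainder M T (a : 'cV[R]_(d T)) :
  (forall y, 0 <= y <= 1 -> `|g y| <= M) -> (0 < T)%N -> 0 < common_part s Phi (d T) ->
  exists Q : Omega -> R,
  [/\ L1 P Q,
      (forall w k, (k <= T)%N ->
         `|hproc a w k - hbridge T (fun k => psum (common T) k w) k
           - (Num.sqrt T%:R * efficiency3 s Phi a) ^+ 2 * gam g T k ^+ 2| <= Q w) &
      Ex P Q <= 24 * (8 + 2 * (1 + m)) * (Num.sqrt (d T)%:R / common_part s Phi (d T))
                + 4 * (9 + C4) / Num.sqrt (common_part s Phi (d T))
                + (24 * M / Num.sqrt (common_part s Phi (d T)) + 8 * M * (1 + C4))
                  * (Num.sqrt T%:R * efficiency3 s Phi a)].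
Proof.
move=> gM T0 A0; have [F1 Z1] := idio_iseq T; have [F2 Z2] := reversed_iseq T.
have [h1 h2] := wmax_L4 common_iseq T0.
have -> : efficiency3 s Phi a = (Num.sqrt (common_part s Phi (d T)))^-1 *
    Num.sqrt (\sum_(i < d T) a i 0 ^+ 2 / (s i ^+ 2 + Phi i ^+ 2)).
  rewrite /efficiency3; congr (_ * Num.sqrt _).
  rewrite mul_mx_diag mxE; apply: eq_bigr => i _.
  by rewrite !mxE expr2 mulrAC.
apply: (hstat_remainder a T0 sg_gt0 A0 gM m_ge0 Z1 Z2 _ h1 h2) => i k w kT.
exact: (psum_reversed (fun j => eta (d T) (widen_ord (leqnSn (d T)) i) j)).
Qed.


(** As [d T >= 1], the divergence of the ratio makes the common part itself diverge. *)
Let A_lower X : \forall T \near \oo, X * Num.sqrt (d T)%:R <= common_part s Phi (d T) /\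
  (X <= common_part s Phi (d T) \/ X < 0).
Proof.
have /cvgryPge/(_ X) := A_large; apply: filterS => T h.
have r1 : 1 <= Num.sqrt (d T)%:R :> R by rewrite -[leLHS]sqrtr1 ler_sqrt// ler1n d_gt0.
have r0 : 0 < Num.sqrt (d T)%:R :> R by apply: lt_le_trans r1.
have h2 : X * Num.sqrt (d T)%:R <= common_part s Phi (d T) by rewrite -ler_pdivlMr.
split=> //; case: (leP 0 X) => X0; last by right.
by left; apply: le_trans h2; rewrite ler_peMr.
Qed.

Let eps_small c1 c2 e : 0 <= c1 -> 0 <= c2 -> 0 < e -> \forall T \near \oo,
  [/\ (0 < T)%N, 1 <= common_part s Phi (d T) &
      c1 * (Num.sqrt (d T)%:R / common_part s Phi (d T))
      + c2 / Num.sqrt (common_part s Phi (d T)) <= e].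
Proof.
move=> c10 c20 e0.
have [Y [Y1 Ye]] : exists Y, 1 <= Y /\ (c1 + c2) / e <= Y.
  by exists (Num.max 1 ((c1 + c2) / e)); rewrite !le_max !lexx orbT.
have Y0 : 0 < Y by apply: lt_le_trans Y1.
(* The level is [Y ^+ 2] because one of the terms involves the square root of the common part. *)
have := A_lower (Y ^+ 2); apply: filterS2 (nbhs_infty_gt 0%N) => T T0 [h1 [h2|]]; last first.
  by rewrite ltNge sqr_ge0.
have [A AE] : exists A, A = common_part s Phi (d T) by eexists.
rewrite -AE in h1 h2 *.
have A1 : 1 <= A by apply: le_trans h2; rewrite exprn_ege1.
have A0 : 0 < A by apply: lt_le_trans A1.
have YA : Y <= Num.sqrt A by rewrite -(ger0_norm (ltW Y0)) -sqrtr_sqr ler_sqrt // ltW.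
have sA : 0 < Num.sqrt A by apply: lt_le_trans YA.
split=> //; apply: (@le_trans _ _ (c1 / Y + c2 / Y)).
  apply: lerD; apply: ler_wpM2l => //; last by rewrite lef_pV2.
  rewrite ler_pdivrMr// ler_pdivlMl//; apply: le_trans h1.
  by rewrite ler_wpM2r ?sqrtr_ge0// expr2 ler_peMl// ltW.
by rewrite -mulrDl ler_pdivrMr// mulrC -ler_pdivrMr.
Qed.

(** The threshold on [T] does not depend on [a], so that the bound may be used along any sequence of
    alternatives. *)
Let remainder_near M e : (forall y, 0 <= y <= 1 -> `|g y| <= M) -> 0 < e ->
  \forall T \near \oo, forall a : 'cV[R]_(d T),
  exists Q : Omega -> R,
  [/\ (0 < T)%N, 0 < common_part s Phi (d T), L1 P Q,
      (forall w k, (k <= T)%N ->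
         `|hproc a w k - hbridge T (fun k => psum (common T) k w) k
           - (Num.sqrt T%:R * efficiency3 s Phi a) ^+ 2 * gam g T k ^+ 2| <= Q w) &
      Ex P Q <= e + (24 * M + 8 * M * (1 + C4)) * (Num.sqrt T%:R * efficiency3 s Phi a)].
Proof.
move=> gM e0; have K1 := m_ge0.
have M0 : 0 <= M by apply: le_trans (gM 0 _); rewrite ?normr_ge0// lexx ler01.
have b1 : 0 <= 24 * (8 + 2 * (1 + m)) by lra.
have b2 : 0 <= 4 * (9 + C4) by rewrite /C4; lra.
have := eps_small b1 b2 e0; apply: filterS => T [T0 A1 h] a.
have A0 : 0 < common_part s Phi (d T) by apply: lt_le_trans A1.
have [Q [i1 i2 i3]] := remainder a gM T0 A0; exists Q; split=> //.
apply: (le_trans i3); apply: lerD => //; apply: ler_wpM2r.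
  by rewrite mulr_ge0 ?sqrtr_ge0// mulr_ge0 ?sqrtr_ge0// invr_ge0 sqrtr_ge0.
rewrite lerD2r ler_pdivrMr ?sqrtr_gt0// ler_peMr ?mulr_ge0//.
by rewrite -[leLHS]sqrtr1 ler_sqrt // ltW.
Qed.

Variables (bm : bool) (stat : forall T : nat, 'cV[R]_(d T) -> Omega -> R).
Hypothesis mstat : forall T a, measurable_fun [set: Omega] (@stat T a).
(** The scaling is meaningless for the finitely many [T] that are 0 or have a zero common part. *)
Hypothesis statE : forall T (a : 'cV[R]_(d T)) w, (0 < T)%N ->
  0 < common_part s Phi (d T) -> stat a w = Psi bm T (hproc a w).

Let y T (a : 'cV[R]_(d T)) : R := Num.sqrt T%:R * efficiency3 s Phi a.

Let y_ge0 T (a : 'cV[R]_(d T)) : 0 <= y a.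
Proof. by rewrite mulr_ge0 ?sqrtr_ge0// mulr_ge0 ?sqrtr_ge0// invr_ge0 sqrtr_ge0. Qed.

Let mwalk := walk_stat_measurable common_iseq bm.

Let stat_walk_close (a : forall T, 'cV[R]_(d T)) f : blip f ->
  y (a T) @[T --> \oo] --> (0 : R) ->
  Ex P (f \o stat (a T)) - Ex P (f \o walk_stat common bm T) @[T --> \oo] --> (0 : R).
Proof.
move=> bf ya; have [M gM] := riemann_integrable_bounded g_int.
have [[l l0 fl] _] := bf.
have M0 : 0 <= M by apply: le_trans (gM 0 _); rewrite ?normr_ge0// lexx ler01.
have [c5 [c5E c50]] : exists c5, c5 = 24 * M + 8 * M * (1 + C4) /\ 0 <= c5.
  eexists; split=> //; have C40 : 0 <= C4 by have := m_ge0; rewrite /C4; lra.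
  by rewrite addr_ge0// ?mulr_ge0// addr_ge0.
apply/cvgrPdist_le => e e0.
have l1 : 0 < l + 1 by rewrite ltr_wpDl.
have e1 : 0 < e / (2 * (l + 1)) by rewrite divr_gt0// mulr_gt0.
have [e' [e'E e'0]] : exists e', e' = e / (2 * (l + 1)) /\ 0 < e' by eexists.
have q0 : 0 < c5 + 4 * M ^+ 2 + 1 by rewrite ltr_wpDl// addr_ge0// mulr_ge0// sqr_ge0.
(* The minimum with 1 lets the quadratic contribution of the change be absorbed in the linear
   one. *)
have dl : 0 < Num.min 1 (e' / (c5 + 4 * M ^+ 2 + 1)) by rewrite lt_min ltr01 divr_gt0.
have /cvgrPdist_le/(_ _ dl) hy := ya.
apply: filterS2 hy (remainder_near gM e'0) => T hy /(_ (a T)) [Q [T0 A0 iQ hQ EQ]].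
rewrite -/(y (a T)) -c5E in EQ hQ; move: hy.
rewrite sub0r normrN ger0_norm ?y_ge0// le_min => /andP[y1 ye].
have yy := y_ge0 (a T).
move: (y (a T)) EQ hQ y1 ye yy => v EQ hQ y1 ye yy.
have close w : `|stat (a T) w - walk_stat common bm T w| <= Q w + v ^+ 2 * (4 * M ^+ 2).
  rewrite statE//; apply: Psi_close => // k kT.
  have h := hQ w k kT; have hg := gam_bound gM T0 kT.
  have hg2 : gam g T k ^+ 2 <= 4 * M ^+ 2.
    rewrite -real_normK ?num_real// (_ : 4 * M ^+ 2 = (2 * M) ^+ 2); last by ring.
    by rewrite ler_sqr ?nnegrE ?mulr_ge0.
  have hv : `|v ^+ 2 * gam g T k ^+ 2| <= v ^+ 2 * (4 * M ^+ 2).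
    rewrite ger0_norm; first by apply: ler_wpM2l => //; exact: sqr_ge0.
    by apply: mulr_ge0; exact: sqr_ge0.
  by rewrite -[X in `|X|](subrK (v ^+ 2 * gam g T k ^+ 2)); apply: le_trans (ler_normD _ _) (lerD h hv).
have j1 := L1_blip P bf (mstat (a T)); have j2 := L1_blip P bf (mwalk T).
have jB := L1D iQ (L1_cst P (v ^+ 2 * (4 * M ^+ 2))).
rewrite sub0r normrN -(ExB j1 j2).
apply: (le_trans (Ex_abs_le (L1B j1 j2) (L1Z l jB) _)).
  by move=> w; apply: (le_trans (fl _ _)); rewrite ler_wpM2l.
rewrite (ExZ _ jB) (ExD iQ (L1_cst P _)) Ex_cst.
have hv : c5 * v + v ^+ 2 * (4 * M ^+ 2) <= e'.
  apply: (@le_trans _ _ ((c5 + 4 * M ^+ 2) * v)).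
    rewrite (mulrDl c5) lerD2l (mulrC (v ^+ 2)); apply: ler_wpM2l.
      by rewrite mulr_ge0 ?sqr_ge0.
    by rewrite expr2 ler_piMl.
  move: ye; rewrite ler_pdivlMr// => ye; apply: le_trans ye.
  by rewrite mulrC ler_wpM2l// lerDl.
apply: (@le_trans _ _ (l * (2 * e'))); first by rewrite ler_wpM2l//; lra.
rewrite e'E (_ : l * (2 * (e / (2 * (l + 1)))) = l / (l + 1) * e).
  by rewrite ler_piMl ?(ltW e0)// ler_pdivrMr// mul1r lerDl.
by field; rewrite gt_eqF.
Qed.


Hypothesis g_change : exists2 x : R, 0 <= x <= 1 &
  riemann_int g 0 x - x * riemann_int g 0 1 != 0.

Let hbridge_ge T S k : (0 < T)%N -> - 4^-1 <= hbridge T S k :> R.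
Proof.
move=> T0; have T0' : 0 < T%:R :> R by rewrite ltr0n.
suff h : vbridge T k <= 4^-1 :> R.
  by rewrite /hbridge; apply: (@le_trans _ _ (- vbridge T k)); rewrite ?lerN2// lerDr sqr_ge0.
rewrite /vbridge ler_pdivrMr ?exprn_gt0//; move: (k%:R : R) (T%:R : R) => x t.
by have := sqr_ge0 (t - 2 * x); nra.
Qed.

(** The maximum too is bounded below by the time mean, where the mean square of [gam] appears; the
    bridge part is never below -1/4. *)
Let stat_lower T (a : 'cV[R]_(d T)) w Q v kap : (0 < T)%N -> 0 < common_part s Phi (d T) ->
  (forall k, (k <= T)%N -> `|hproc a w k - hbridge T (fun k => psum (common T) k w) k
           - v ^+ 2 * gam g T k ^+ 2| <= Q) ->
  kap <= (\sum_(k < T) gam g T k ^+ 2) / T%:R ->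
  v ^+ 2 * kap - 4^-1 - Q <= stat a w.
Proof.
move=> T0 A0 hQ hk; have T0' : 0 < T%:R :> R by rewrite ltr0n.
rewrite statE//; apply: (@le_trans _ _ (Psi false T (hproc a w))); last first.
  by case: bm => //; exact: Psi_mean_le_max.
rewrite /= ler_pdivlMr//.
apply: (@le_trans _ _ (\sum_(k < T) (v ^+ 2 * gam g T k ^+ 2 - 4^-1 - Q))).
  rewrite sumrB sumrB -mulr_sumr !sumr_const card_ord -(mulr_natr 4^-1) -(mulr_natr Q).
  rewrite !mulrBl !lerD2r -mulrA ler_wpM2l ?sqr_ge0//.
  by rewrite -ler_pdivlMr.
apply: ler_sum => k _; have kT : (k <= T)%N by rewrite ltnW.
have := hQ k kT; have := @hbridge_ge T (fun k => psum (common T) k w) k T0.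
by rewrite ler_norml => h1 /andP[h2 _]; lra.
Qed.

Let stat_dvg (a : forall T, 'cV[R]_(d T)) : y (a T) @[T --> \oo] --> +oo ->
  dvg_in_probability P (fun T => stat (a T)).
Proof.
move=> ya m0; have [M gM] := riemann_integrable_bounded g_int.
have M0 : 0 <= M by apply: le_trans (gM 0 _); rewrite ?normr_ge0// lexx ler01.
have [kap kap0 [N hN]] := gam_mean_square g_int g_change.
have [c5 [c5E c50]] : exists c5, c5 = 24 * M + 8 * M * (1 + C4) /\ 0 <= c5.
  eexists; split=> //; have C40 : 0 <= C4 by have := m_ge0; rewrite /C4; lra.
  by rewrite addr_ge0// ?mulr_ge0// addr_ge0.
have mset T : measurable [set w | m0 < stat (a T) w].
  rewrite (_ : [set w | m0 < stat (a T) w] = stat (a T) @^-1` `]m0, +oo[%classic).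
    by rewrite -[X in measurable X]setTI; apply: mstat => //; exact: measurable_itv.
  by apply/seteqP; split=> w /=; rewrite in_itv /= andbT.
have key e : 0 < e -> \forall T \near \oo, (P [set w | (stat (a T) w <= m0)%R] <= e%:E)%E.
  move=> e0.
  (* The last bound leaves at least half of the signal above the level [m0]; the second makes the
     mean [(1 + c5) * v] of the error at most [e] times that half. *)
  have [Y [Y1 Y2 Y3]] : exists Y, [/\ 1 <= Y, 2 * (1 + c5) / (e * kap) <= Y &
      2 * (`|m0| + 4^-1 + 1) / kap <= Y].
    exists (Num.max 1 (Num.max (2 * (1 + c5) / (e * kap)) (2 * (`|m0| + 4^-1 + 1) / kap))).
    by rewrite !le_max !lexx !orbT.
  have /cvgryPge/(_ Y) hy := ya.
  have hN' : \forall T \near \oo, (N <= T)%N by exact: nbhs_infty_ge.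
  apply: filterS3 hy hN' (remainder_near gM ltr01) => T hy NT /(_ (a T)) [Q [T0 A0 iQ hQ EQ]].
  have hkap := hN T NT.
  rewrite -/(y (a T)) -c5E in EQ hQ; move: (y (a T)) EQ hQ hy => v EQ hQ hy.
  have v1 : 1 <= v by apply: le_trans hy.
  have v0 : 0 < v by apply: lt_le_trans v1.
  have hm := ler_norm m0.
  have q1 : 2 * (1 + c5) <= v * (e * kap).
    by rewrite -ler_pdivrMr ?mulr_gt0//; apply: le_trans hy.
  have q2 : 2 * (`|m0| + 4^-1 + 1) <= v ^+ 2 * kap.
    rewrite -ler_pdivrMr//; apply: (le_trans Y3); apply: (le_trans hy).
    by rewrite expr2 ler_peMr// ltW.
  have [lam lamE] : exists lam, lam = v ^+ 2 * kap - 4^-1 - m0 by eexists.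
  have lam2 : v ^+ 2 * kap / 2 <= lam by rewrite lamE; lra.
  have lam0 : 0 < lam by apply: lt_le_trans lam2; rewrite divr_gt0// mulr_gt0// exprn_gt0.
  have Q0 w : 0 <= Q w by apply: le_trans (hQ w 0%N (leq0n T)).
  apply: (@le_trans _ _ (P [set w | (lam <= Q w)%R])).
    apply: le_measure.
    - rewrite inE (_ : [set w | (stat (a T) w <= m0)%R] = ~` [set w | (m0 < stat (a T) w)%R]).
        exact: measurableC.
      by apply/seteqP; split=> w /=; rewrite leNgt => /negP.
    - rewrite inE (_ : [set w | (lam <= Q w)%R] = Q @^-1` `[lam, +oo[%classic).
        by rewrite -[X in measurable X]setTI; apply: (L1_meas iQ) => //; exact: measurable_itv.
      by apply/seteqP; split=> w /=; rewrite in_itv /= andbT.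
    - move=> w /= h; have := @stat_lower T (a T) w (Q w) v kap T0 A0 (hQ w) hkap.
      by rewrite lamE; lra.
  apply: (le_trans (prob_le_Ex iQ Q0 lam0)); rewrite lee_fin ler_pdivrMr//.
  apply: (le_trans EQ); apply: (@le_trans _ _ (e * (v ^+ 2 * kap / 2))); last first.
    by rewrite ler_wpM2l// ltW.
  apply: (@le_trans _ _ ((1 + c5) * v)); first by rewrite mulrDl mul1r lerD2r.
  rewrite (_ : e * (v ^+ 2 * kap / 2) = (v * (e * kap)) / 2 * v); last by field.
  by rewrite ler_wpM2r ?(ltW v0)// ler_pdivlMr// mulrC.
have PE T : P [set w | m0 < stat (a T) w] = (fine (P [set w | m0 < stat (a T) w]))%:E.
  by rewrite fineK// fin_num_measure.
rewrite (_ : (fun T => _) = (fun T => (fine (P [set w | m0 < stat (a T) w]))%:E)); last first.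
  by apply/funext => T; exact: PE.
apply: cvg_EFin; first by apply: nearW.
apply/cvgrPdist_le => e e0; apply: filterS (key e e0) => T /=.
rewrite (_ : [set w | (stat (a T) w <= m0)%R] = ~` [set w | (m0 < stat (a T) w)%R]); last first.
  by apply/seteqP; split=> w /=; rewrite leNgt => /negP.
rewrite probability_setC// PE -EFinB lee_fin => h.
rewrite ger0_norm// subr_ge0 -lee_fin -PE; exact: probability_le1.
Qed.

Lemma efficiency_of_hproc : high_dim_efficiency P stat
  (fun T (a : 'cV[R]_(d T)) => efficiency3 s Phi a).
Proof.
split; first exact: mstat.
have [L hL] : exists L : probability R R, forall f, blip f ->
    Ex P (f \o walk_stat common bm n) @[n --> \oo] --> Ex L f.
  apply: (limit_law mwalk (C := 4 * (1 + C4) + 1)).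
    apply: filterS (nbhs_infty_gt 0%N) => T T0; exact: (walk_stat_L1 common_iseq).
  by move=> f bf; exact: (donsker common_iseq).
have conv (a : forall T, 'cV[R]_(d T)) : y (a T) @[T --> \oo] --> (0 : R) ->
    cvg_in_distribution P (fun T => stat (a T)) L.
  move=> ya; apply: cvg_in_distribution_blip => // f bf.
  rewrite -[Ex L f]add0r (_ : (fun T => Ex P (f \o stat (a T))) = (fun T =>
    Ex P (f \o stat (a T)) - Ex P (f \o walk_stat common bm T)
    + Ex P (f \o walk_stat common bm T))); last by apply/funext => T; rewrite subrK.
  by apply: cvgD; [exact: stat_walk_close|exact: hL].
exists L; split.
- exact: (walk_law_nondegenerate common_iseq hL).
(* The null hypothesis is the sequence of zero efficiency. *)
- apply: (conv (fun T => 0)).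
  rewrite (_ : (fun T => y _) = fun=> 0); first exact: cvg_cst.
  apply/funext => T; rewrite /y /efficiency3 mulmx0 mxE.
  by rewrite sqrtr0 !mulr0.
- by move=> a _; split; [exact: stat_dvg|exact: conv].
Qed.

End asymptotics.

(** * Maximum and integral as instances of one functional *)

Section panel_statistics.
Context {R : realType}.

Definition panel_stat (bm : bool) (sigma2 : nat -> R) T n (X : 'I_n -> nat -> R) : R :=
  if bm then panel_max sigma2 T X else panel_int sigma2 T X.

Lemma panel_stat_Psi bm sigma2 T n (X : 'I_n -> nat -> R) c h : (0 < T)%N -> 0 < c ->
  (forall x, c * panel sigma2 T X x = h (Num.truncn (T%:R * x))) ->
  c * panel_stat bm sigma2 T X = Psi bm T h.
Proof.
move=> T0 c0 ch; have pE : panel sigma2 T X = fun x => c^-1 * h (Num.truncn (T%:R * x)).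
  by apply/funext => x; rewrite -ch mulKf// gt_eqF.
have -> : panel_stat bm sigma2 T X = Psi bm T (fun k => c^-1 * h k).
  rewrite /panel_stat /panel_max /panel_int pE; case: bm => /=.
    exact: (sup_truncn (fun k => c^-1 * h k)).
  exact: (step_integral (fun k => c^-1 * h k)).
by rewrite Psi_scale ?invr_ge0 ?(ltW c0)// mulVKf// gt_eqF.
Qed.

(** At sample size 0 the inverse of sqrt 0 is 0, so the data disappear; this settles measurability
    there. *)
Lemma panel_stat0 bm sigma2 n (X X' : 'I_n -> nat -> R) :
  panel_stat bm sigma2 0 X = panel_stat bm sigma2 0 X'.
Proof.
rewrite /panel_stat /panel_max /panel_int.
suff -> : panel sigma2 0 X = panel sigma2 0 X' by [].
apply/funext => x; congr (_ * _); apply: eq_bigr => i _.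
by rewrite /cusum sqrtr0 invr0 !mul0r.
Qed.

End panel_statistics.

Section measurability.
Context {disp : measure_display} {Omega : measurableType disp} {R : realType}.
Variable P : probability Omega R.
Variables (d : nat -> nat) (g : R -> R).
Variable eta : forall n : nat, 'I_n.+1 -> nat -> {RV P >-> R}.
Variables s Phi : nat -> R.

Lemma hproc_measurable T (a : 'cV[R]_(d T)) k :
  measurable_fun [set: Omega] (fun w => hproc g eta s Phi a w k).
Proof.
have mp (x : nat -> {RV P >-> R}) l :
    measurable_fun [set: Omega] (fun w => psum (fun j => x j.+1 : Omega -> R) l w).
  by apply: measurable_sum => j.
have mb (x : nat -> {RV P >-> R}) :
    measurable_fun [set: Omega] (fun w => bridge T (fun k => psum (fun j => x j.+1 : Omega -> R) k w) k).
  apply: measurable_funM; first exact: measurable_cst.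
  apply: measurable_funB; first exact: mp.
  by apply: measurable_funM; [exact: measurable_cst|exact: mp].
apply: measurable_funM; first exact: measurable_cst.
apply: measurable_sum => i; apply: measurable_funB; last exact: measurable_cst.
apply: measurable_funM; last exact: measurable_cst.
apply: measurable_funX; apply: measurable_funD; last exact: measurable_cst.
apply: measurable_funD; apply: measurable_funM; first exact: measurable_cst.
- exact: (mb (fun j => @eta (d T) (widen_ord (leqnSn (d T)) i) j)).
- exact: measurable_cst.
- exact: (mb (fun j => @eta (d T) ord_max j)).
Qed.

End measurability.

Unset Implicit Arguments.
Theorem theorem3p4 (disp : measure_display) (Omega : measurableType disp)
  (R : realType) (P : probability Omega R)
  (d : nat -> nat) (d_gt0 : forall T, (0 < d T)%N)
  (d_cvg : d T @[T --> \oo] --> \oo)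
  (mu : nat -> R) (g : R -> R) (g_int : riemann_integrable g 0 1)
  (g_change : exists2 x : R, 0 <= x <= 1 &
     riemann_int g 0 x - x * riemann_int g 0 1 != 0)
  (eta : forall n : nat, 'I_n.+1 -> nat -> {RV P >-> R})
  (eta_innov : forall T, innovations T (eta (d T)))
  (nu : R) (nu_gt4 : 4 < nu)
  (eta_moment : exists M : R, forall (T : nat) (i : 'I_(d T).+1) (t : nat),
     (1 <= t <= T)%N ->
     ('E_P[fun w => (`|eta (d T) i t w| `^ nu)%R] <= M%:E)%E)
  (s Phi : nat -> R) (c C : R) (c_gt0 : 0 < c)
  (s_bound : forall i, c <= s i <= C)
  (Phi_bound : forall i, Phi i ^+ 2 <= C)
  (A_large : common_part s Phi (d T) / Num.sqrt (d T)%:R @[T --> \oo] --> +oo) :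
  let sigma2 := fun i => s i ^+ 2 + Phi i ^+ 2 in
  let X := fun (T : nat) (Delta : 'cV[R]_(d T)) (w : Omega) =>
    change_obs mu g T Delta
      (fun i t => mixed_error s Phi (eta (d T)) i t w) in
  let scale := fun T : nat => Num.sqrt (d T)%:R / common_part s Phi (d T) in
  high_dim_efficiency P
    (fun T Delta w => scale T * panel_max sigma2 T (X T Delta w))
    (fun T Delta => efficiency3 s Phi Delta) /\
  high_dim_efficiency P
    (fun T Delta w => scale T * panel_int sigma2 T (X T Delta w))
    (fun T Delta => efficiency3 s Phi Delta).

Proof.
move=> sigma2 X scale; have [m hm] := eta_moment.
have sg0 i : 0 < s i ^+ 2 + Phi i ^+ 2.
  have /andP[h _] := s_bound i.
  by rewrite ltr_pwDl ?sqr_ge0// exprn_gt0// (lt_le_trans c_gt0 h).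
suff main bm : high_dim_efficiency P
    (fun T Delta w => scale T * panel_stat bm sigma2 T (X T Delta w))
    (fun T Delta => efficiency3 s Phi Delta).
  by split; [exact: (main true)|exact: (main false)].
have statE T (a : 'cV[R]_(d T)) w : (0 < T)%N -> 0 < common_part s Phi (d T) ->
    scale T * panel_stat bm sigma2 T (X T a w) = Psi bm T (hproc g eta s Phi a w).
  move=> T0 A0; apply: panel_stat_Psi => //.
    by rewrite divr_gt0// sqrtr_gt0 ltr0n.
  move=> x; exact: (panel_hstat mu s Phi g a
    (fun i t => eta (d T) (widen_ord (leqnSn (d T)) i) t w)
    (fun t => eta (d T) ord_max t w) x T0 (d_gt0 T)).
apply: (efficiency_of_hproc d_gt0 g_int eta_innov nu_gt4 hm sg0 A_large _ statE g_change).
move=> T; have [->|T0] := posnP T => a.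
  apply: (eq_measurable_fun (cst (scale 0%N * panel_stat bm sigma2 0 (fun (_ : 'I_(d 0)) _ => 0)))).
    by move=> w _; congr (_ * _); exact: panel_stat0.
  exact: measurable_cst.
have [A0|A0] := ltP 0 (common_part s Phi (d T)).
  apply: (eq_measurable_fun (fun w => Psi bm T (hproc g eta s Phi a w))).
    by move=> w _; rewrite statE.
  by apply: Psi_measurable => k _; exact: hproc_measurable.
(* Without a common part the scale is a division by zero, that is 0, and the statistic is
   constant. *)
have A00 : common_part s Phi (d T) = 0.
  apply/le_anti/andP; split=> //; apply: sumr_ge0 => i _.
  by rewrite divr_ge0 ?sqr_ge0// ltW.
apply: (eq_measurable_fun (cst (0 : R))); last exact: measurable_cst.
by move=> w _; rewrite /scale A00 invr0 mulr0 mul0r.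
Qed.
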